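(* Let $\Theta=(T,\{K_t\},\{\Sigma_e\},\{\phi_e\})$ be a tree system of metric compacta and let $\Pi$ be a partition of $T$ into subtrees. Then the consolidation $\Theta_\Pi$ is a tree system of metric compacta, and $\lim\Theta_\Pi$ is homeomorphic to $\lim\Theta$, via the canonical bijection which is the identity on each $K_t$ ($t\in V_T$), sends each end of a subtree $S\in\Pi$ to the same end viewed as an end of $T$, and sends an end of $T_\Pi$ represented by a ray $(S_0,S_1,\dots)$ to the end of $T$ represented by the ray in $T$ passing consecutively through the edges $e_i$ joining $S_{i-1}$ to $S_i$ and the paths in $S_i$ between them.
   Context: Trees: for a tree $T$, $V_T$ is its vertex set and $O_T$ its set of oriented edges; each $e\in O_T$ has initial vertex $\alpha(e)$, terminal vertex $\omega(e)$, and $\bar e$ denotes the oppositely oriented edge; $N_t=\{e\in O_T:\alpha(e)=t\}$. A family of subsets of a compact metric space is null if for every $\epsilon>0$ only finitely many of its members have diameter $\ge\epsilon$. A tree system of metric compacta is a tuple $\Theta=(T,\{K_t\},\{\Sigma_e\},\{\phi_e\})$ where $T$ is a countable tree, each $K_t$ is a compact metric space, each $\Sigma_e$ is a nonempty compact subset of $K_{\alpha(e)}$, each $\phi_e:\Sigma_e\to\Sigma_{\bar e}$ is a homeomorphism with $\phi_{\bar e}=\phi_e^{-1}$, and for each $t$ the family $\{\Sigma_e:e\in N_t\}$ consists of pairwise disjoint sets and is null in $K_t$. Limit: $E_T$ is the set of ends of $T$; $\#\Theta$ is the quotient of $\bigsqcup_tK_t$ by $x\sim\phi_e(x)$; as a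 set $\lim\Theta=\#\Theta\sqcup E_T$. For a finite subtree $F$, $K_F$ is the quotient of $\bigsqcup_{t\in V_F}K_t$ by $x\sim\phi_e(x)$ for edges $e$ of $F$; $N_F=\{e:\alpha(e)\in V_F,\omega(e)\notin V_F\}$; $U\subset K_F$ is saturated if each $\Sigma_e$ ($e\in N_F$) is contained in or disjoint from $U$; for saturated $U$, $G(U)$ is the union of $U$, of all $K_t$ ($t\notin V_F$) such that the shortest path from $F$ to $t$ starts with some $e\in N_F$ with $\Sigma_e\subset U$, and of all ends represented by rays starting in $F$ and leaving $F$ immediately through such an edge $e$. The topology on $\lim\Theta$ has basis all $G(U)$ with $U$ open and saturated in some $K_F$. For a subtree $S$, $\Theta_S$ denotes the restriction of $\Theta$ to $S$ (vertices and edges of $S$ only). Consolidation: a partition $\Pi$ of $T$ into subtrees is a family of subtrees (possibly single vertices) whose vertex sets are pairwise disjoint and cover $V_T$. The consolidation $\Theta_\Pi=(T_\Pi,\{K_S\}_{S\in\Pi},\{\Sigma_e\}_{e\in O_\Pi},\{\phi_e\}_{e\in O_\Pi})$ has underlying tree $T_\Pi$ with vertex set $\Pi$ and oriented edge set $O_\Pi$ = the edges of $T$ not lying in any $S\in\Pi$, where $\alpha_\Pi(e)$ (resp. $\omega_\Pi(e)$) is the $S\in\Pi$ containing $\alpha(e)$ (resp. $\omega(e)$); $K_S=\lim\Theta_S$; and $\Sigma_e\subset K_{\alpha(e)}\subset K_{\alpha_\Pi(e)}$, $\phi_e$ are as in $\Theta$. *)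

(* Defs.v *)
From Stdlib Require Import Reals List Relations Classical ProofIrrelevance.
Open Scope R_scope.

Definition is_metric {X : Type} (d : X -> X -> R) : Prop :=
  (forall x y, d x y = 0 <-> x = y) /\
  (forall x y, d x y = d y x) /\
  (forall x y z, d x z <= d x y + d y z).

Definition metric_open {X : Type} (d : X -> X -> R) (U : X -> Prop) : Prop :=
  forall x, U x -> exists r, 0 < r /\ forall y, d x y < r -> U y.

Definition compact_set {X : Type} (opnX : (X -> Prop) -> Prop) (A : X -> Prop) : Prop :=
  forall F : (X -> Prop) -> Prop,
    (forall U, F U -> opnX U) ->
    (forall x, A x -> exists U, F U /\ U x) ->
    exists l : list (X -> Prop),
      (forall U, In U l -> F U) /\ (forall x, A x -> exists U, In U l /\ U x).

Definition diam_ge {X : Type} (d : X -> X -> R) (A : X -> Prop) (eps : R) : Prop :=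
  forall delta, delta < eps -> exists x y, A x /\ A y /\ delta < d x y.

Definition null_family {X I : Type} (d : X -> X -> R) (idx : I -> Prop)
  (A : I -> X -> Prop) : Prop :=
  forall eps, 0 < eps ->
    exists l : list I, forall i, idx i -> diam_ge d (A i) eps -> In i l.

(* TV = vertices, TO = oriented edges, talpha = initial vertex,
   trev = orientation reversal e |-> bar e, TK t = the space K_t with open
   sets topn t.  Subsets Sigma_e and the maps phi_e live on the disjoint
   union tot = {t & K_t}; phi_e is given by its graph. *)
Record TS := mkTS {
  TV : Type;
  TO : Type;
  talpha : TO -> TV;
  trev : TO -> TO;
  trev_inv : forall e, trev (trev e) = e;
  TK : TV -> Type;
  topn : forall t, (TK t -> Prop) -> Prop;
  tSig : TO -> {t : TV & TK t} -> Prop;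
  tphi : TO -> {t : TV & TK t} -> {t : TV & TK t} -> Prop }.

Definition tot (T : TS) : Type := {t : TV T & TK T t}.
Definition omega (T : TS) (e : TO T) : TV T := talpha T (trev T e).

Fixpoint is_path (T : TS) (p : list (TO T)) (u v : TV T) : Prop :=
  match p with
  | nil => u = v
  | e :: p' => talpha T e = u /\ is_path T p' (omega T e) v
  end.

Fixpoint reduced (T : TS) (p : list (TO T)) : Prop :=
  match p with
  | e :: ((e' :: _) as p') => e' <> trev T e /\ reduced T p'
  | _ => True
  end.

(* countable tree: countable vertex set, unique reduced path between any
   two vertices (this also excludes loops and multiple edges) *)
Definition is_tree (T : TS) : Prop :=
  (exists f : TV T -> nat, forall u v, f u = f v -> u = v) /\
  (forall u v, exists p, (is_path T p u v /\ reduced T p) /\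
     forall q, is_path T q u v /\ reduced T q -> q = p).

Definition is_subtree (T : TS) (B : TV T -> Prop) : Prop :=
  (exists v, B v) /\
  (forall u v, B u -> B v -> exists p, is_path T p u v /\
     forall e, In e p -> B (talpha T e) /\ B (omega T e)).

Definition fin_subtree (T : TS) (B : TV T -> Prop) : Prop :=
  is_subtree T B /\ exists l, forall v, B v -> In v l.

Definition is_ray (T : TS) (r : nat -> TO T) : Prop :=
  forall n, talpha T (r (S n)) = omega T (r n) /\ r (S n) <> trev T (r n).

Definition endcls (T : TS) (r : nat -> TO T) : (nat -> TO T) -> Prop :=
  fun r' => is_ray T r' /\ exists m k, forall n, r (m + n)%nat = r' (k + n)%nat.

Definition Ends (T : TS) : Type :=
  {E : (nat -> TO T) -> Prop | exists r, is_ray T r /\ E = endcls T r}.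

Definition glue (T : TS) (x y : tot T) : Prop := exists e, tphi T e x y.
Definition cls (T : TS) (x : tot T) : tot T -> Prop :=
  fun y => clos_refl_sym_trans (tot T) (glue T) x y.
Definition Pts (T : TS) : Type := {C : tot T -> Prop | exists x, C = cls T x}.
Definition limT (T : TS) : Type := (Pts T + Ends T)%type.

Definition ptof (T : TS) (x : tot T) : limT T :=
  inl (exist _ (cls T x) (ex_intro _ x eq_refl)).

(* U is an open saturated subset of K_F (represented by its preimage in the
   disjoint union of the K_t, t in F) *)
Definition sat_open (T : TS) (F : TV T -> Prop) (U : tot T -> Prop) : Prop :=
  (forall x, U x -> F (projT1 x)) /\
  (forall e x y, F (talpha T e) -> F (omega T e) -> tphi T e x y -> (U x <-> U y)) /\
  (forall t, F t -> topn T t (fun k => U (existT _ t k))) /\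
  (forall e, F (talpha T e) -> ~ F (omega T e) ->
     (forall x, tSig T e x -> U x) \/ (forall x, tSig T e x -> ~ U x)).

Definition exits (T : TS) (F : TV T -> Prop) (U : tot T -> Prop) (e : TO T) : Prop :=
  F (talpha T e) /\ ~ F (omega T e) /\ forall x, tSig T e x -> U x.

(* the shortest path from F to t starts with e *)
Definition beyond (T : TS) (F : TV T -> Prop) (e : TO T) (t : TV T) : Prop :=
  exists p, is_path T (e :: p) (talpha T e) t /\ reduced T (e :: p) /\
    forall e', In e' (e :: p) -> ~ F (omega T e').

Definition Gset (T : TS) (F : TV T -> Prop) (U : tot T -> Prop) (q : limT T) : Prop :=
  match q with
  | inl C => exists x, proj1_sig C x /\
               (U x \/ exists e, exits T F U e /\ beyond T F e (projT1 x))
  | inr E => exists r, proj1_sig E r /\ exits T F U (r 0%nat)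
  end.

Definition lim_open (T : TS) (W : limT T -> Prop) : Prop :=
  forall q, W q -> exists F U, fin_subtree T F /\ sat_open T F U /\
    Gset T F U q /\ forall q', Gset T F U q' -> W q'.

Definition lim_cont (T1 T2 : TS) (f : limT T1 -> limT T2) : Prop :=
  forall W, lim_open T2 W -> lim_open T1 (fun a => W (f a)).

Definition tot_open (T : TS) (W : tot T -> Prop) : Prop :=
  forall t, topn T t (fun k => W (existT _ t k)).

Definition is_tree_system (T : TS) : Prop :=
  is_tree T /\
  (forall t, compact_set (topn T t) (fun _ => True) /\
     exists d : TK T t -> TK T t -> R, is_metric d /\
       (forall U, topn T t U <-> metric_open d U) /\
       null_family d (fun e => talpha T e = t) (fun e k => tSig T e (existT _ t k))) /\
  (forall e x, tSig T e x -> projT1 x = talpha T e) /\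
  (forall e, exists x, tSig T e x) /\
  (forall e, compact_set (topn T (talpha T e)) (fun k => tSig T e (existT _ (talpha T e) k))) /\
  (forall e x y, tphi T e x y -> tSig T e x /\ tSig T (trev T e) y) /\
  (forall e x, tSig T e x -> exists y, tphi T e x y) /\
  (forall e x y y', tphi T e x y -> tphi T e x y' -> y = y') /\
  (forall e x y, tphi T (trev T e) y x <-> tphi T e x y) /\
  (* ... and continuous (hence a homeomorphism) *)
  (forall e W, tot_open T W -> exists W', tot_open T W' /\
     forall x y, tphi T e x y -> (W y <-> W' x)) /\
  (forall e e' x, e <> e' -> tSig T e x -> tSig T e' x -> False).

Lemma restr_rev_pf (T : TS) (B : TV T -> Prop)
  (e : {e : TO T | B (talpha T e) /\ B (omega T e)}) :
  B (talpha T (trev T (proj1_sig e))) /\ B (omega T (trev T (proj1_sig e))).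
Proof.
  destruct e as [e [h1 h2]]; simpl; unfold omega in *; rewrite trev_inv; auto.
Qed.

Definition restr_rev (T : TS) (B : TV T -> Prop)
  (e : {e : TO T | B (talpha T e) /\ B (omega T e)}) :
  {e : TO T | B (talpha T e) /\ B (omega T e)} :=
  exist _ (trev T (proj1_sig e)) (restr_rev_pf T B e).

Lemma restr_rev_inv (T : TS) (B : TV T -> Prop) e :
  restr_rev T B (restr_rev T B e) = e.
Proof.
  destruct e as [e h]; unfold restr_rev; simpl; apply subset_eq_compat;
  apply trev_inv.
Qed.

Definition restr_emb (T : TS) (B : TV T -> Prop)
  (x : {t : {v : TV T | B v} & TK T (proj1_sig t)}) : tot T :=
  existT _ (proj1_sig (projT1 x)) (projT2 x).

Definition restr (T : TS) (B : TV T -> Prop) : TS :=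
  @mkTS {v : TV T | B v} {e : TO T | B (talpha T e) /\ B (omega T e)}
    (fun e => exist _ (talpha T (proj1_sig e)) (proj1 (proj2_sig e)))
    (restr_rev T B) (restr_rev_inv T B)
    (fun t => TK T (proj1_sig t))
    (fun t => topn T (proj1_sig t))
    (fun e x => tSig T (proj1_sig e) (restr_emb T B x))
    (fun e x y => tphi T (proj1_sig e) (restr_emb T B x) (restr_emb T B y)).

(* A partition Pi of T into subtrees is given by blk : V_T -> I whose
   fibers (the blocks) are subtrees. *)
Definition blkT (T : TS) {I : Type} (blk : TV T -> I) (i : I) : TS :=
  restr T (fun v => blk v = i).

Definition inblk (T : TS) {I : Type} (blk : TV T -> I) (i : I) (x : tot T)
  (H : blk (projT1 x) = i) : limT (blkT T blk i) :=
  ptof (blkT T blk i)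
    (existT (fun t : {v : TV T | blk v = i} => TK T (proj1_sig t))
       (exist _ (projT1 x) H) (projT2 x)).

Lemma consol_rev_pf (T : TS) {I : Type} (blk : TV T -> I)
  (e : {e : TO T | blk (talpha T e) <> blk (omega T e)}) :
  blk (talpha T (trev T (proj1_sig e))) <> blk (omega T (trev T (proj1_sig e))).
Proof.
  destruct e as [e h]; simpl; unfold omega in *; rewrite trev_inv; auto.
Qed.

Definition consol_rev (T : TS) {I : Type} (blk : TV T -> I)
  (e : {e : TO T | blk (talpha T e) <> blk (omega T e)}) :
  {e : TO T | blk (talpha T e) <> blk (omega T e)} :=
  exist _ (trev T (proj1_sig e)) (consol_rev_pf T blk e).

Lemma consol_rev_inv (T : TS) {I : Type} (blk : TV T -> I) e :
  consol_rev T blk (consol_rev T blk e) = e.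
Proof.
  destruct e as [e h]; unfold consol_rev; simpl; apply subset_eq_compat;
  apply trev_inv.
Qed.

Definition consol (T : TS) {I : Type} (blk : TV T -> I) : TS :=
  @mkTS I {e : TO T | blk (talpha T e) <> blk (omega T e)}
    (fun e => blk (talpha T (proj1_sig e)))
    (consol_rev T blk) (consol_rev_inv T blk)
    (fun i => limT (blkT T blk i))
    (fun i => lim_open (blkT T blk i))
    (fun e y => exists (x : tot T) (H : blk (projT1 x) = projT1 y),
        tSig T (proj1_sig e) x /\ projT2 y = inblk T blk (projT1 y) x H)
    (fun e y z => exists (x x' : tot T) (H : blk (projT1 x) = projT1 y)
                    (H' : blk (projT1 x') = projT1 z),
        tphi T (proj1_sig e) x x' /\
        projT2 y = inblk T blk (projT1 y) x H /\
        projT2 z = inblk T blk (projT1 z) x' H').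

Definition canon (T : TS) {I : Type} (blk : TV T -> I)
  (a : limT (consol T blk)) (q : limT T) : Prop :=
  match a with
  | inl C =>
      exists y : tot (consol T blk), proj1_sig C y /\
      (
        (exists (x : tot T) (H : blk (projT1 x) = projT1 y),
           projT2 y = inblk T blk (projT1 y) x H /\
           exists D, q = inl D /\ proj1_sig D x)
        \/
        (exists (E : Ends (blkT T blk (projT1 y))) (r : nat -> TO (blkT T blk (projT1 y))),
           projT2 y = @inr (Pts (blkT T blk (projT1 y))) _ E /\ proj1_sig E r /\
           exists E', q = inr E' /\ proj1_sig E' (fun n => proj1_sig (r n))))
  | inr E =>
      exists (rho : nat -> TO (consol T blk)) (r : nat -> TO T) (k : nat -> nat),
        proj1_sig E rho /\
        (exists E', q = inr E' /\ proj1_sig E' r) /\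
        k 0%nat = 0%nat /\ (forall n, (k n < k (S n))%nat) /\
        (forall n, r (k n) = proj1_sig (rho n)) /\
        (forall m, (forall n, m <> k n) -> blk (talpha T (r m)) = blk (omega T (r m)))
  end.

(* Main.v *)
(* A point of a limit lies in at most two of the spaces K_t, and a basic set G(U)
   is constant beyond any edge whose far side misses F; limits are studied
   through this relation "beyond an edge".  A limit is compact: otherwise one
   follows branches without finite subcover along a ray, whose end nevertheless
   has a neighbourhood inside the cover containing one of these branches.  Basic
   sets of one-vertex and one-edge subtrees give a countable family separating
   points, so a limit is metrizable by Urysohn functions.  Nullity of the Sigma_e,
   read as "all but finitely many are small with respect to any given open
   cover", passes from the K_t to lim Theta_S; together with uniqueness of
   reduced paths this makes Theta_Pi a tree system.  The canonical map is a
   continuous bijection from a compact to a Hausdorff space: the preimage of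
   G(U) is again basic, given by the blocks meeting F and the traces of G(U) on
   their limits. *)

Require Import Defs.
From Stdlib Require Import Reals List Relations Classical ProofIrrelevance.
From Stdlib Require Import ClassicalEpsilon FunctionalExtensionality
  PropExtensionality Lra Lia Cantor FinFun.

(** The vertex spaces of the consolidation are themselves limits, so each must be shown metrizable
    and its sets [Sigma_e] null for the metric found. That metric comes from Urysohn functions and
    has no relation to the metrics of the [K_t]; this is why nullity is carried through open covers,
    which see only the topology. Nullity also supplies the open sets: a neighbourhood in [K_t] need
    not be saturated, and its largest saturated subset is open because all but finitely many
    [Sigma_e] are small. One-vertex sets cannot separate two points of the same [Sigma_e], since a
    saturated set over a single end vertex of [e] contains both or neither; over the edge itself
    [Sigma_e] may be split, and these are the only pairs that need it. Continuity of the
    consolidated [phi_e] and of the inverse of the canonical map both come from compactness: a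
    compact subset of a limit is closed. *)

Lemma fun_choice {A B : Type} (P : A -> B -> Prop) :
  (forall a, exists b, P a b) -> exists f, forall a, P a (f a).
Proof.
  intros H.
  exists (fun a => proj1_sig (constructive_indefinite_description _ (H a))).
  intros a; apply proj2_sig.
Qed.

Lemma dep_choice {A : Type} {B : A -> Type} (P : forall a, B a -> Prop) :
  (forall a, exists b, P a b) -> exists f : forall a, B a, forall a, P a (f a).
Proof.
  intros H.
  exists (fun a => proj1_sig (constructive_indefinite_description _ (H a))).
  intros a; apply proj2_sig.
Qed.

Lemma set_ext {X : Type} (A B : X -> Prop) : (forall x, A x <-> B x) -> A = B.
Proof.
  intros H; apply functional_extensionality; intros x.
  apply propositional_extensionality; apply H.
Qed.

(** * Compact Hausdorff spaces and metrization *)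

Definition topology {X : Type} (op : (X -> Prop) -> Prop) : Prop :=
  op (fun _ => True) /\
  (forall U V, op U -> op V -> op (fun x => U x /\ V x)) /\
  (forall U, (forall x, U x -> exists V, op V /\ V x /\ forall y, V y -> U y) -> op U).

Definition closed {X : Type} (op : (X -> Prop) -> Prop) (C : X -> Prop) : Prop :=
  op (fun x => ~ C x).

Definition hausdorff {X : Type} (op : (X -> Prop) -> Prop) : Prop :=
  forall x y, x <> y -> exists U V, op U /\ op V /\ U x /\ V y /\
    forall z, U z -> V z -> False.

(* Most compactness arguments below are instances of this induction. *)
Lemma compact_ind {X : Type} (op : (X -> Prop) -> Prop) (A : X -> Prop)
  (P : (X -> Prop) -> Prop) :
  compact_set op A ->
  P (fun _ => False) ->
  (forall U V, P U -> P V -> P (fun x => U x \/ V x)) ->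
  (forall U V : X -> Prop, (forall x, U x -> V x) -> P V -> P U) ->
  (forall a, A a -> exists V, op V /\ V a /\ P V) -> P A.
Proof.
  intros HA H0 HU HS HL.
  destruct (HA (fun V => op V /\ P V)) as [l [Hl Hc]].
  - intros U [HU' _]; exact HU'.
  - intros x Hx; destruct (HL x Hx) as [V [HV [Vx PV]]]; exists V; auto.
  - apply (HS A (fun x => exists U, In U l /\ U x)); [exact Hc|].
    clear Hc; induction l as [|U l IH].
    + apply (HS _ (fun _ => False)); [|exact H0].
      intros x [U [[] _]].
    + apply (HS _ (fun x => U x \/ exists V, In V l /\ V x)).
      * intros x [V [[HV|HV] Vx]]; [subst; left; exact Vx|right; exists V; auto].
      * apply HU; [apply (Hl U); left; reflexivity|].
        apply IH; intros V HV; apply Hl; right; exact HV.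
Qed.

Lemma op_union {X : Type} (op : (X -> Prop) -> Prop) (U V : X -> Prop) :
  topology op -> op U -> op V -> op (fun x => U x \/ V x).
Proof.
  intros [_ [_ H]] HU HV; apply H.
  intros x [Ux|Vx]; [exists U|exists V]; auto.
Qed.

Lemma op_empty {X : Type} (op : (X -> Prop) -> Prop) :
  topology op -> op (fun _ => False).
Proof. intros [_ [_ H]]; apply H; intros x []. Qed.

Lemma op_ext {X : Type} (op : (X -> Prop) -> Prop) (U V : X -> Prop) :
  (forall x, U x <-> V x) -> op U -> op V.
Proof. intros H; rewrite (set_ext U V H); auto. Qed.

Lemma compact_inter_closed {X : Type} (op : (X -> Prop) -> Prop) (A C : X -> Prop) :
  compact_set op A -> closed op C -> compact_set op (fun x => A x /\ C x).
Proof.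
  intros HA HC F HF Hcov.
  destruct (HA (fun U => F U \/ U = (fun x => ~ C x))) as [l [Hl Hc]].
  - intros U [HU | ->]; [apply HF; exact HU|exact HC].
  - intros x Ax; destruct (classic (C x)) as [Cx|Cx].
    + destruct (Hcov x (conj Ax Cx)) as [U [HU Ux]]; exists U; auto.
    + exists (fun x => ~ C x); auto.
  - assert (Hl' : forall l, (forall U, In U l -> F U \/ U = (fun x => ~ C x)) ->
      exists l', (forall U, In U l' -> F U) /\
        forall x, C x -> (exists U, In U l /\ U x) -> exists U, In U l' /\ U x).
    { clear; intros l; induction l as [|U l IH]; intros Hl.
      - exists nil; split; [intros U []|intros x _ [U [[] _]]].
      - destruct IH as [l' [Hl' Hc]]; [intros V HV; apply Hl; right; exact HV|].
        destruct (Hl U (or_introl eq_refl)) as [HU|HU].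
        + exists (U :: l'); split.
          * intros V [<-|HV]; auto.
          * intros x Cx [V [[<-|HV] Vx]].
            -- exists U; split; [left; reflexivity|exact Vx].
            -- destruct (Hc x Cx) as [W [HW Wx]]; [exists V; auto|].
               exists W; split; [right; exact HW|exact Wx].
        + exists l'; split; [exact Hl'|].
          intros x Cx [V [[<-|HV] Vx]].
          * subst U; contradiction.
          * apply Hc; [exact Cx|exists V; auto]. }
    destruct (Hl' l Hl) as [l' [H1 H2]].
    exists l'; split; [exact H1|].
    intros x [Ax Cx]; apply H2; [exact Cx|apply Hc; exact Ax].
Qed.

Lemma compact_image {X Y : Type} (opX : (X -> Prop) -> Prop)
  (opY : (Y -> Prop) -> Prop) (f : X -> Y) (A : X -> Prop) :
  (forall W, opY W -> opX (fun x => W (f x))) ->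
  compact_set opX A -> compact_set opY (fun y => exists x, A x /\ y = f x).
Proof.
  intros Hf HA F HF Hcov.
  apply (compact_ind opX A (fun Z => exists l : list (Y -> Prop),
    (forall U, In U l -> F U) /\
    forall y, (exists x, Z x /\ y = f x) -> exists U, In U l /\ U y) HA).
  - exists nil; split; [intros U []|intros y [x [[] _]]].
  - intros U V [l [H1 H2]] [l' [H1' H2']]; exists (l ++ l'); split.
    + intros W HW; apply in_app_or in HW; destruct HW; auto.
    + intros y [x [[Ux|Vx] ->]].
      * destruct (H2 (f x)) as [W [HW Wy]]; [exists x; auto|].
        exists W; split; [apply in_or_app; auto|exact Wy].
      * destruct (H2' (f x)) as [W [HW Wy]]; [exists x; auto|].
        exists W; split; [apply in_or_app; auto|exact Wy].
  - intros U V HUV [l [H1 H2]]; exists l; split; [exact H1|].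
    intros y [x [Ux ->]]; apply H2; exists x; auto.
  - intros a Aa; destruct (Hcov (f a)) as [W [HW Wa]]; [exists a; auto|].
    exists (fun x => W (f x)); split; [apply Hf; apply HF; exact HW|].
    split; [exact Wa|]; exists (W :: nil); split.
    + intros U [<-|[]]; exact HW.
    + intros y [x [Wx ->]]; exists W; split; [left; reflexivity|exact Wx].
Qed.

Lemma compact_sep_point {X : Type} (op : (X -> Prop) -> Prop) (A : X -> Prop) (x : X) :
  topology op -> hausdorff op -> compact_set op A -> ~ A x ->
  exists U V, op U /\ op V /\ U x /\ (forall a, A a -> V a) /\
    forall z, U z -> V z -> False.
Proof.
  intros Ht Hh HA Hx; pose proof Ht as [HT [HI _]].
  apply (compact_ind op A (fun Z => exists U V, op U /\ op V /\ U x /\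
    (forall a, Z a -> V a) /\ forall z, U z -> V z -> False) HA).
  - exists (fun _ => True), (fun _ => False); repeat split; auto.
    apply op_empty; exact Ht.
  - intros Z Z' [U [V [H1 [H2 [H3 [H4 H5]]]]]] [U' [V' [H1' [H2' [H3' [H4' H5']]]]]].
    exists (fun x => U x /\ U' x), (fun x => V x \/ V' x); repeat split; auto.
    + apply op_union; auto.
    + intros a [Ha|Ha]; auto.
    + intros z [Hz Hz'] [Vz|Vz]; eauto.
  - intros Z Z' HZ [U [V [H1 [H2 [H3 [H4 H5]]]]]]; exists U, V; repeat split; auto.
  - intros a Aa.
    destruct (Hh x a) as [U [V [HU [HV [Ux [Va D]]]]]]; [intros ->; auto|].
    exists V; repeat split; auto; exists U, V; repeat split; auto.
Qed.

Lemma compact_is_closed {X : Type} (op : (X -> Prop) -> Prop) (A : X -> Prop) :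
  topology op -> hausdorff op -> compact_set op A -> closed op A.
Proof.
  intros Ht Hh HA; apply Ht; intros x Hx.
  destruct (compact_sep_point op A x Ht Hh HA Hx) as [U [V [HU [_ [Ux [HV D]]]]]].
  exists U; repeat split; auto; intros y Uy Ay; apply (D y); auto.
Qed.

(** Normality of compact Hausdorff spaces, in the interpolation form that the dyadic construction
    below iterates; [K] is the complement of an open set that contains the complement of [U] and
    misses [V]. *)
Lemma compact_interpolate {X : Type} (op : (X -> Prop) -> Prop) (C U : X -> Prop) :
  topology op -> hausdorff op -> compact_set op (fun _ => True) ->
  closed op C -> op U -> (forall x, C x -> U x) ->
  exists V K, op V /\ closed op K /\ (forall x, C x -> V x) /\
    (forall x, V x -> K x) /\ (forall x, K x -> U x).
Proof.
  intros Ht Hh Hc HC HU HCU; pose proof Ht as [HT [HI _]].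
  assert (HCc : compact_set op C).
  { pose proof (compact_inter_closed op _ C Hc HC) as H.
    rewrite (set_ext C (fun x => True /\ C x)); [exact H|tauto]. }
  assert (HUc : compact_set op (fun x => ~ U x)).
  { assert (H' : closed op (fun x => ~ U x)).
    { apply (op_ext op U); [intros x; split; [tauto|apply NNPP]|exact HU]. }
    pose proof (compact_inter_closed op _ _ Hc H') as H.
    rewrite (set_ext (fun x => ~ U x) (fun x => True /\ ~ U x)); [exact H|tauto]. }
  assert (S : exists V W, op V /\ op W /\ (forall x, C x -> V x) /\
    (forall x, ~ U x -> W x) /\ forall z, V z -> W z -> False).
  { apply (compact_ind op C (fun Z => exists V W, op V /\ op W /\
      (forall x, Z x -> V x) /\ (forall x, ~ U x -> W x) /\
      forall z, V z -> W z -> False) HCc).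
    - exists (fun _ => False), (fun _ => True); repeat split; auto.
      apply op_empty; exact Ht.
    - intros Z Z' [V [W [H1 [H2 [H3 [H4 H5]]]]]] [V' [W' [H1' [H2' [H3' [H4' H5']]]]]].
      exists (fun x => V x \/ V' x), (fun x => W x /\ W' x); repeat split; auto.
      + apply op_union; auto.
      + intros a [Ha|Ha]; auto.
      + intros z [Vz|Vz] [Wz Wz']; eauto.
    - intros Z Z' HZ [V [W [H1 [H2 [H3 [H4 H5]]]]]]; exists V, W; repeat split; auto.
    - intros a Ca.
      destruct (compact_sep_point op (fun x => ~ U x) a Ht Hh HUc)
        as [V [W [HV [HW [Va [HW' D]]]]]]; [auto|].
      exists V; repeat split; auto; exists V, W; repeat split; auto. }
  destruct S as [V [W [HV [HW [CV [UW D]]]]]].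
  exists V, (fun x => ~ W x); split; [exact HV|].
  split; [|split; [exact CV|split]].
  - apply (op_ext op W); [intros x; split; [tauto|apply NNPP]|exact HW].
  - intros x Vx Wx; apply (D x); auto.
  - intros x Wx; apply NNPP; intros Ux; apply Wx; auto.
Qed.

(** * Urysohn functions *)

Lemma lim_close (u v : nat -> R) (l m c : R) (n : nat) :
  Un_cv u l -> Un_cv v m -> (forall k, (n <= k)%nat -> Rabs (u k - v k) <= c) ->
  Rabs (l - m) <= c.
Proof.
  intros Hu Hv Hc; apply Rnot_lt_le; intros Hlt.
  set (e := (Rabs (l - m) - c) / 2).
  assert (He : e > 0) by (unfold e; lra).
  destruct (Hu e He) as [N1 H1]; destruct (Hv e He) as [N2 H2].
  set (k := (n + N1 + N2)%nat).
  assert (A1 := H1 k ltac:(unfold k; lia)).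
  assert (A2 := H2 k ltac:(unfold k; lia)).
  assert (A3 := Hc k ltac:(unfold k; lia)).
  unfold R_dist, Rdist in *.
  assert (Rabs (l - m) < e + c + e).
  { apply Rabs_def2 in A1; apply Rabs_def2 in A2.
    assert (A4 := Rle_abs (u k - v k)).
    assert (A5 := Rle_abs (- (u k - v k))); rewrite Rabs_Ropp in A5.
    apply Rabs_def1; lra. }
  unfold e in *; lra.
Qed.

Section Urysohn.
Context {X : Type} (op : (X -> Prop) -> Prop).
Context (Ht : topology op) (Hh : hausdorff op) (Hc : compact_set op (fun _ => True)).

Let good (C U : X -> Prop) := closed op C /\ op U /\ forall x, C x -> U x.

Context (V K : (X -> Prop) * (X -> Prop) -> (X -> Prop)).
Context (HVK : forall C U, good C U -> good C (V (C, U)) /\ good (K (C, U)) U /\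
  forall x, V (C, U) x -> K (C, U) x).

(** Dyadic step functions approximating a Urysohn function. The pair [C], [U] is split into [C], [V]
    and [K], [U], and the two approximations are averaged; this recursion replaces a family of open
    sets indexed by dyadic rationals. *)
Fixpoint ury (n : nat) (C U : X -> Prop) (x : X) : R :=
  match n with
  | O => if excluded_middle_informative (U x) then 0 else 1
  | S n => (ury n C (V (C, U)) x + ury n (K (C, U)) U x) / 2
  end.

Lemma ury_bounds n C U x : 0 <= ury n C U x <= 1.
Proof.
  revert C U; induction n as [|n IH]; intros C U; simpl.
  - destruct excluded_middle_informative; lra.
  - pose proof (IH C (V (C, U))); pose proof (IH (K (C, U)) U); lra.
Qed.

Lemma ury_0 n C U x : good C U -> C x -> ury n C U x = 0.
Proof.
  revert C U; induction n as [|n IH]; intros C U HG Cx; simpl.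
  - destruct excluded_middle_informative as [|H]; [reflexivity|].
    destruct H; apply HG; exact Cx.
  - destruct (HVK C U HG) as [G1 [G2 H]].
    rewrite IH, IH; auto; [lra|]. apply H; apply G1; exact Cx.
Qed.

Lemma ury_1 n C U x : good C U -> ~ U x -> ury n C U x = 1.
Proof.
  revert C U; induction n as [|n IH]; intros C U HG Ux; simpl.
  - destruct excluded_middle_informative as [H|H]; [contradiction|reflexivity].
  - destruct (HVK C U HG) as [G1 [G2 H]].
    rewrite IH, IH; auto; [lra|]. intros Vx; apply Ux; apply G2; apply H; exact Vx.
Qed.

(** At level 0 the value is 0 on [U], and off [U] every level has value 1; averaging preserves the
    inequality. Monotonicity gives pointwise convergence. *)
Lemma ury_incr n C U x : good C U -> ury n C U x <= ury (S n) C U x.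
Proof.
  revert C U; induction n as [|n IH]; intros C U HG.
  - simpl ury at 1; destruct excluded_middle_informative as [H|H].
    + apply ury_bounds.
    + rewrite ury_1; auto; lra.
  - destruct (HVK C U HG) as [G1 [G2 H]].
    change (ury (S n) C U x) with ((ury n C (V (C, U)) x + ury n (K (C, U)) U x) / 2).
    change (ury (S (S n)) C U x) with
      ((ury (S n) C (V (C, U)) x + ury (S n) (K (C, U)) U x) / 2).
    pose proof (IH _ _ G1); pose proof (IH _ _ G2); lra.
Qed.

(* Of the two halves of [ury (S m) C U], the first is constant off [V] and the
   second is constant on [K]; as [V] lies inside [K], only one of them varies
   between nearby points, so the oscillation halves at each level. *)
Lemma ury_osc n C U x : good C U -> exists N, op N /\ N x /\
  forall y, N y -> forall m, (n <= m)%nat ->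
    Rabs (ury m C U y - ury m C U x) <= (/ 2) ^ n.
Proof.
  revert C U; induction n as [|n IH]; intros C U HG.
  - exists (fun _ => True); split; [apply (proj1 Ht)|]; split; [exact I|].
    intros y _ m _; simpl; pose proof (ury_bounds m C U x);
    pose proof (ury_bounds m C U y); apply Rabs_le; lra.
  - destruct (HVK C U HG) as [G1 [G2 H]].
    destruct (IH _ _ G1) as [N1 [O1 [X1 D1]]].
    destruct (IH _ _ G2) as [N2 [O2 [X2 D2]]].
    assert (HN : exists N, op N /\ N x /\ forall y, N y ->
      ((K (C, U) x /\ K (C, U) y) \/ (~ V (C, U) x /\ ~ V (C, U) y))).
    { destruct (classic (V (C, U) x)) as [Vx|Vx].
      - exists (V (C, U)); split; [apply G1|]; split; [exact Vx|].
        intros y Vy; left; auto.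
      - destruct (classic (K (C, U) x)) as [Kx|Kx].
        + exists (fun _ => True); split; [apply (proj1 Ht)|]; split; [exact I|].
          intros y _; destruct (classic (K (C, U) y)) as [Ky|Ky]; [left; auto|].
          right; split; auto.
        + exists (fun y => ~ K (C, U) y); split; [apply G2|]; split; [exact Kx|].
          intros y Ky; right; split; auto. }
    destruct HN as [N [ON [Nx DN]]].
    exists (fun y => N y /\ (N1 y /\ N2 y)); split; [do 2 (apply (proj1 (proj2 Ht)); [assumption|]); assumption|].
    split; [auto|]; intros y [Ny [Ny1 Ny2]] m Hm.
    destruct m as [|m]; [lia|]; simpl.
    assert (B1 := D1 y Ny1 m ltac:(lia)); assert (B2 := D2 y Ny2 m ltac:(lia)).
    destruct (DN y Ny) as [[Kx Ky]|[Vx Vy]].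
    + rewrite (ury_0 m (K (C, U)) U x), (ury_0 m (K (C, U)) U y); auto.
      match goal with |- Rabs ?t <= _ => replace t with
        (/ 2 * (ury m C (V (C, U)) y - ury m C (V (C, U)) x)) by lra end.
      rewrite Rabs_mult, (Rabs_right (/ 2)) by lra; nra.
    + rewrite (ury_1 m C (V (C, U)) x), (ury_1 m C (V (C, U)) y); auto.
      match goal with |- Rabs ?t <= _ => replace t with
        (/ 2 * (ury m (K (C, U)) U y - ury m (K (C, U)) U x)) by lra end.
      rewrite Rabs_mult, (Rabs_right (/ 2)) by lra; nra.
Qed.

End Urysohn.

Definition cont_fun {X : Type} (op : (X -> Prop) -> Prop) (f : X -> R) : Prop :=
  forall x eps, 0 < eps -> exists N, op N /\ N x /\
    forall y, N y -> Rabs (f y - f x) < eps.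

Lemma urysohn {X : Type} (op : (X -> Prop) -> Prop) (C U : X -> Prop) :
  topology op -> hausdorff op -> compact_set op (fun _ => True) ->
  closed op C -> op U -> (forall x, C x -> U x) ->
  exists f : X -> R, cont_fun op f /\ (forall x, 0 <= f x <= 1) /\
    (forall x, C x -> f x = 0) /\ (forall x, ~ U x -> f x = 1).
Proof.
  intros Ht Hh Hc HC HU HCU.
  set (good := fun C U : X -> Prop => closed op C /\ op U /\ forall x, C x -> U x).
  destruct (fun_choice (fun (p : (X -> Prop) * (X -> Prop)) (q : (X -> Prop) * (X -> Prop)) =>
    good (fst p) (snd p) -> good (fst p) (fst q) /\ good (snd q) (snd p) /\
      forall x, fst q x -> snd q x)) as [vk Hvk].
  { intros [C' U']; destruct (classic (good C' U')) as [[G1 [G2 G3]]|G].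
    - destruct (compact_interpolate op C' U' Ht Hh Hc G1 G2 G3) as [V [K HVK]].
      exists (V, K); intros _; simpl; unfold good; intuition.
    (* Default value at pairs that are not nested; the recursion starts at a good pair and produces
       only good ones. *)
    - exists (C', U'); intros G'; contradiction. }
  set (V := fun p => fst (vk p)); set (K := fun p => snd (vk p)).
  assert (HVK : forall C U, good C U -> good C (V (C, U)) /\ good (K (C, U)) U /\
    forall x, V (C, U) x -> K (C, U) x) by (intros C' U'; apply (Hvk (C', U'))).
  assert (HG : good C U) by (unfold good; auto).
  set (g := fun n x => ury V K n C U x).
  destruct (fun_choice (fun x l => Un_cv (fun n => g n x) l)) as [f Hf].
  { intros x.
    destruct (growing_cv (fun n => g n x)) as [l Hl].
    - intros n; apply (ury_incr op V K HVK); exact HG.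
    - exists 1; intros r [n ->]; apply ury_bounds.
    - exists l; exact Hl. }
  assert (Hconst : forall c, Un_cv (fun _ => c) c).
  { intros c e He; exists 0%nat; intros n _; unfold R_dist, Rdist.
    rewrite Rminus_diag, Rabs_R0; exact He. }
  exists f; repeat split.
  - intros x eps Heps.
    destruct (pow_lt_1_zero (/ 2) ltac:(rewrite Rabs_right; lra) eps Heps) as [n Hn].
    specialize (Hn n (Nat.le_refl n)).
    destruct (ury_osc op Ht V K HVK n C U x HG) as [N [ON [Nx HN]]].
    exists N; repeat split; auto; intros y Ny.
    apply Rle_lt_trans with ((/ 2) ^ n).
    + apply (lim_close _ _ _ _ _ n (Hf y) (Hf x)); intros k Hk; apply HN; auto.
    + rewrite Rabs_right in Hn; [exact Hn|]. apply Rle_ge, pow_le; lra.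
  - apply Rnot_lt_le; intros Hlt.
    destruct (Hf x (- f x) ltac:(lra)) as [n Hn].
    specialize (Hn n (Nat.le_refl n)); unfold R_dist, Rdist in Hn.
    apply Rabs_def2 in Hn; pose proof (ury_bounds V K n C U x); unfold g in *; lra.
  - apply Rnot_lt_le; intros Hlt.
    destruct (Hf x (f x - 1) ltac:(lra)) as [n Hn].
    specialize (Hn n (Nat.le_refl n)); unfold R_dist, Rdist in Hn.
    apply Rabs_def2 in Hn; pose proof (ury_bounds V K n C U x); unfold g in *; lra.
  - intros x Cx; apply (UL_sequence (fun n => g n x)); [apply Hf|].
    intros e He; exists 0%nat; intros n _; unfold g; rewrite (ury_0 op V K HVK); auto.
    unfold R_dist, Rdist; rewrite Rminus_diag, Rabs_R0; exact He.
  - intros x Cx; apply (UL_sequence (fun n => g n x)); [apply Hf|].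
    intros e He; exists 0%nat; intros n _; unfold g; rewrite (ury_1 op V K HVK); auto.
    unfold R_dist, Rdist; rewrite Rminus_diag, Rabs_R0; exact He.
Qed.

(** * Metrization by a separating sequence *)

Lemma sup_exists (u : nat -> R) : (forall n, 0 <= u n <= 1) ->
  exists s, (forall n, u n <= s) /\ (forall b, (forall n, u n <= b) -> s <= b).
Proof.
  intros Hu.
  destruct (completeness (fun r => exists n, r = u n)) as [s [Hs1 Hs2]].
  - exists 1; intros r [n ->]; apply Hu.
  - exists (u 0%nat); exists 0%nat; reflexivity.
  - exists s; split.
    + intros n; apply Hs1; exists n; reflexivity.
    + intros b Hb; apply Hs2; intros r [n ->]; apply Hb.
Qed.

(* The metric is [sup_n |f_n x - f_n y| / (n+1)] for a separating sequence of
   continuous functions. *)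
Lemma metrizable_of_functions {X : Type} (op : (X -> Prop) -> Prop) (f : nat -> X -> R) :
  topology op -> compact_set op (fun _ => True) ->
  (forall n, cont_fun op (f n)) -> (forall n x, 0 <= f n x <= 1) ->
  (forall x y, x <> y -> exists n, f n x <> f n y) ->
  exists d, is_metric d /\ forall U, op U <-> metric_open d U.
Proof.
  intros Ht Hc Hf Hb Hs.
  set (w := fun n => / (INR n + 1)).
  assert (Hw : forall n, 0 < w n <= 1).
  { intros n; unfold w; pose proof (pos_INR n); split.
    - apply Rinv_0_lt_compat; lra.
    - rewrite <- Rinv_1; apply Rinv_le_contravar; lra. }
  assert (Hu : forall n x y, 0 <= w n * Rabs (f n x - f n y) <= 1).
  { intros n x y; pose proof (Hw n); pose proof (Rabs_pos (f n x - f n y)).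
    assert (Rabs (f n x - f n y) <= 1).
    { apply Rabs_le; pose proof (Hb n x); pose proof (Hb n y); lra. }
    nra. }
  destruct (fun_choice (fun (p : X * X) s =>
    (forall n, w n * Rabs (f n (fst p) - f n (snd p)) <= s) /\
    (forall b, (forall n, w n * Rabs (f n (fst p) - f n (snd p)) <= b) -> s <= b)))
    as [D HD].
  { intros [x y]; apply sup_exists; intros n; apply Hu. }
  set (d := fun x y => D (x, y)).
  assert (D1 : forall x y n, w n * Rabs (f n x - f n y) <= d x y)
    by (intros x y; apply (HD (x, y))).
  assert (D2 : forall x y b, (forall n, w n * Rabs (f n x - f n y) <= b) -> d x y <= b)
    by (intros x y; apply (HD (x, y))).
  assert (Hd0 : forall x y, 0 <= d x y).
  { intros x y; eapply Rle_trans; [apply (Hu 0%nat x y)|apply D1]. }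
  assert (Hpos : forall x y, x <> y -> 0 < d x y).
  { intros x y Hxy; destruct (Hs x y Hxy) as [n Hn].
    apply Rlt_le_trans with (w n * Rabs (f n x - f n y)); [|apply D1].
    apply Rmult_lt_0_compat; [apply Hw|]. apply Rabs_pos_lt; lra. }
  assert (Hsym : forall x y, d x y = d y x).
  { intros x y; apply Rle_antisym; apply D2; intros n; rewrite Rabs_minus_sym; apply D1. }
  assert (Htri : forall x y z, d x z <= d x y + d y z).
  { intros x y z; apply D2; intros n.
    pose proof (D1 x y n); pose proof (D1 y z n); pose proof (Hw n).
    assert (Rabs (f n x - f n z) <= Rabs (f n x - f n y) + Rabs (f n y - f n z)).
    { replace (f n x - f n z) with ((f n x - f n y) + (f n y - f n z)) by lra.
      apply Rabs_triang. }
    nra. }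
  assert (Hball : forall x r, 0 < r -> exists N, op N /\ N x /\ forall y, N y -> d x y < r).
  { intros x r Hr.
    (* From [K] on the weight alone bounds the term by [r / 2]; the finitely many earlier terms are
       bounded by continuity of the [f n]. *)
    assert (HK : exists K, forall n, (K <= n)%nat -> w n <= r / 2).
    { destruct (archimed_cor1 (r / 2) ltac:(lra)) as [K [HK1 HK2]].
      exists K; intros n Hn; apply Rlt_le; eapply Rle_lt_trans; [|exact HK1].
      apply Rinv_le_contravar; [apply lt_0_INR; exact HK2|].
      apply le_INR in Hn; lra. }
    destruct HK as [K HK].
    assert (HN : forall K, exists N, op N /\ N x /\ forall y, N y -> forall n, (n < K)%nat ->
      Rabs (f n x - f n y) <= r / 2).
    { clear HK K; intros K; induction K as [|K [N [ON [Nx HN]]]].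
      - exists (fun _ => True); split; [apply (proj1 Ht)|]; split; [exact I|].
        intros y _ n Hn; lia.
      - destruct (Hf K x (r / 2) ltac:(lra)) as [N' [ON' [Nx' HN']]].
        exists (fun y => N y /\ N' y); split; [apply (proj1 (proj2 Ht)); auto|].
        split; [auto|]; intros y [Ny Ny'] n Hn.
        destruct (Nat.eq_dec n K) as [->|]; [|apply HN; [exact Ny|lia]].
        rewrite Rabs_minus_sym; apply Rlt_le, HN'; exact Ny'. }
    destruct (HN K) as [N [ON [Nx HN1]]]; exists N; split; [exact ON|].
    split; [exact Nx|]; intros y Ny.
    apply Rle_lt_trans with (r / 2); [|lra]; apply D2; intros n.
    pose proof (Hw n); pose proof (Rabs_pos (f n x - f n y)).
    destruct (Nat.le_gt_cases K n) as [Hn|Hn].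
    - pose proof (HK n Hn).
      assert (Rabs (f n x - f n y) <= 1).
      { apply Rabs_le; pose proof (Hb n x); pose proof (Hb n y); lra. }
      nra.
    - pose proof (HN1 y Ny n Hn); nra. }
  exists d; split; [split; [|split; [exact Hsym|exact Htri]]|].
  - intros x y; split.
    + intros H; apply NNPP; intros Hxy; pose proof (Hpos x y Hxy); lra.
    + intros ->; apply Rle_antisym; [|apply Hd0]; apply D2; intros n.
      rewrite Rminus_diag, Rabs_R0; lra.
  - intros U; split.
    + intros HU x Ux.
      assert (HCl : closed op (fun y => ~ U y)).
      { apply (op_ext op U); [intros y; split; [tauto|apply NNPP]|exact HU]. }
      (* The complement of [U] is compact and misses [x], so its distance from [x] is positive. *)
      assert (HP : exists r, 0 < r /\ forall y, (True /\ ~ U y) -> r <= d x y).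
      { apply (compact_ind op (fun y => True /\ ~ U y)
          (fun Z => exists r, 0 < r /\ forall y, Z y -> r <= d x y)
          (compact_inter_closed op _ _ Hc HCl)).
        - exists 1; split; [lra|intros y []].
        - intros Z Z' [r [Hr H]] [r' [Hr' H']]; exists (Rmin r r'); split.
          + apply Rmin_pos; auto.
          + intros y [Hy|Hy]; [apply H in Hy|apply H' in Hy].
            * eapply Rle_trans; [apply Rmin_l|exact Hy].
            * eapply Rle_trans; [apply Rmin_r|exact Hy].
        - intros Z Z' HZ [r [Hr H]]; exists r; split; auto.
        - intros a [_ Ua].
          assert (Hxa : 0 < d x a) by (apply Hpos; intros ->; contradiction).
          destruct (Hball a (d x a / 2) ltac:(lra)) as [N [ON [Na HN]]].
          exists N; repeat split; auto; exists (d x a / 2); split; [lra|].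
          intros y Ny; apply HN in Ny; pose proof (Htri x y a).
          rewrite (Hsym y a) in *; lra. }
      destruct HP as [r [Hr H]]; exists r; split; [exact Hr|].
      intros y Hy; apply NNPP; intros Uy; specialize (H y (conj I Uy)); lra.
    + intros HU; apply Ht; intros x Ux; destruct (HU x Ux) as [r [Hr H]].
      destruct (Hball x r Hr) as [N [ON [Nx HN]]]; exists N; auto.
Qed.

Definition separating {X : Type} (D : nat -> X -> Prop) : Prop :=
  forall x y, x <> y -> exists m n, D m x /\ D n y /\ forall z, D m z -> D n z -> False.

Lemma separating_hausdorff {X : Type} (op : (X -> Prop) -> Prop) (D : nat -> X -> Prop) :
  (forall n, op (D n)) -> separating D -> hausdorff op.
Proof.
  intros HD Hs x y Hxy; destruct (Hs x y Hxy) as [m [n [Hm [Hn H]]]].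
  exists (D m), (D n); auto.
Qed.

(* Finite unions of members of [D] are coded by the binary digits of [k]. *)
Definition bitunion {X : Type} (D : nat -> X -> Prop) (k : nat) (x : X) : Prop :=
  exists i, Nat.testbit k i = true /\ D i x.

Lemma bitunion_0 {X : Type} (D : nat -> X -> Prop) x : ~ bitunion D 0 x.
Proof. intros [i [H _]]; rewrite Nat.bits_0 in H; discriminate. Qed.

Lemma bitunion_lor {X : Type} (D : nat -> X -> Prop) k l x :
  bitunion D (Nat.lor k l) x <-> bitunion D k x \/ bitunion D l x.
Proof.
  split.
  - intros [i [H Hi]]; rewrite Nat.lor_spec in H; apply Bool.orb_true_iff in H.
    destruct H; [left|right]; exists i; auto.
  - intros [[i [H Hi]]|[i [H Hi]]]; exists i; rewrite Nat.lor_spec, H; split; auto.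
    apply Bool.orb_true_r.
Qed.

Lemma bitunion_single {X : Type} (D : nat -> X -> Prop) i x :
  bitunion D (Nat.setbit 0 i) x <-> D i x.
Proof.
  split.
  - intros [j [H Hj]]; apply Nat.setbit_iff in H; rewrite Nat.bits_0 in H.
    destruct H as [<-|H]; [exact Hj|discriminate].
  - intros H; exists i; split; [apply Nat.setbit_eq|exact H].
Qed.

Lemma bitunion_open {X : Type} (op : (X -> Prop) -> Prop) (D : nat -> X -> Prop) k :
  topology op -> (forall n, op (D n)) -> op (bitunion D k).
Proof.
  intros Ht HD; apply Ht; intros x [i [Hi Dx]]; exists (D i); repeat split; auto.
  intros y Dy; exists i; auto.
Qed.

(** Countably many Urysohn functions suffice. If [D b] contains [y] and not [x], the compact
    complement of [D b] is covered by finitely many members of [D] that miss [y]; their union is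
    some [bitunion D k], and the function with index [(b, k)] is 0 at [x] and 1 at [y]. *)
Lemma metrizable_of_separating {X : Type} (op : (X -> Prop) -> Prop)
  (D : nat -> X -> Prop) :
  topology op -> compact_set op (fun _ => True) ->
  (forall n, op (D n)) -> separating D ->
  exists d, is_metric d /\ forall U, op U <-> metric_open d U.
Proof.
  intros Ht Hc HD Hs.
  assert (Hh := separating_hausdorff op D HD Hs).
  destruct (fun_choice (fun (p : nat * nat) (f : X -> R) =>
    cont_fun op f /\ (forall x, 0 <= f x <= 1) /\
    ((forall x, ~ D (fst p) x -> bitunion D (snd p) x) ->
      (forall x, ~ D (fst p) x -> f x = 0) /\
      (forall x, ~ bitunion D (snd p) x -> f x = 1)))) as [f Hf].
  { intros [m k]; simpl.
    destruct (classic (forall x, ~ D m x -> bitunion D k x)) as [H|H].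
    - destruct (urysohn op (fun x => ~ D m x) (bitunion D k) Ht Hh Hc) as [f Hf].
      + apply (op_ext op (D m)); [intros x; split; [tauto|apply NNPP]|apply HD].
      + apply bitunion_open; auto.
      + exact H.
      + exists f; intuition.
    (* Index pairs whose sets are not nested receive a constant function. *)
    - exists (fun _ => 0); split; [|split; [intros; lra|intros; contradiction]].
      intros x e He; exists (fun _ => True); split; [apply (proj1 Ht)|].
      split; [exact I|]; intros y _; rewrite Rminus_diag, Rabs_R0; exact He. }
  apply (metrizable_of_functions op (fun n => f (of_nat n))); auto.
  - intros n; apply Hf.
  - intros n; apply Hf.
  - intros x y Hxy; destruct (Hs x y Hxy) as [a [b [Da [Db Hab]]]].
    assert (HC : closed op (fun z => ~ D b z)).
    { apply (op_ext op (D b)); [intros z; split; [tauto|apply NNPP]|apply HD]. }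
    assert (HP : exists k, (forall z, True /\ ~ D b z -> bitunion D k z) /\
      ~ bitunion D k y).
    { apply (compact_ind op (fun z => True /\ ~ D b z) (fun Z => exists k,
        (forall z, Z z -> bitunion D k z) /\ ~ bitunion D k y)
        (compact_inter_closed op _ _ Hc HC)).
      - exists 0%nat; split; [intros z []|apply bitunion_0].
      - intros Z Z' [k [H1 H2]] [k' [H1' H2']]; exists (Nat.lor k k'); split.
        + intros z [Hz|Hz]; apply bitunion_lor; auto.
        + rewrite bitunion_lor; tauto.
      - intros Z Z' HZ [k [H1 H2]]; exists k; auto.
      - intros c [_ Hc']; destruct (Hs c y) as [i [j [Di [Dj Hij]]]].
        + intros ->; contradiction.
        + exists (D i); split; [apply HD|]; split; [exact Di|]; exists (Nat.setbit 0 i); split.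
          * intros z; apply bitunion_single.
          * rewrite bitunion_single; intros Diy; eauto. }
    destruct HP as [k [H1 H2]]; exists (to_nat (b, k)); rewrite cancel_of_to.
    destruct (Hf (b, k)) as [_ [_ H]]; simpl in H.
    destruct H as [F0 F1]; [intros z Hz; apply H1; auto|].
    rewrite F0 by (intros Dx; eauto); rewrite F1 by exact H2; lra.
Qed.

(** * Compact metric spaces: nullity and countable bases *)

Lemma metric_refl {X : Type} (d : X -> X -> R) x : is_metric d -> d x x = 0.
Proof. intros [H _]; apply H; reflexivity. Qed.

Lemma metric_pos {X : Type} (d : X -> X -> R) x y : is_metric d -> 0 <= d x y.
Proof.
  intros Hd; pose proof (metric_refl d x Hd); destruct Hd as [_ [Hs Ht]].
  pose proof (Ht x y x); rewrite (Hs y x) in *; lra.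
Qed.

Lemma metric_topology {X : Type} (op : (X -> Prop) -> Prop) (d : X -> X -> R) :
  (forall U, op U <-> metric_open d U) -> topology op.
Proof.
  intros H; split; [|split].
  - apply H; intros x _; exists 1; split; [lra|auto].
  - intros U V HU HV; apply H; apply H in HU; apply H in HV; intros x [Ux Vx].
    destruct (HU x Ux) as [r [Hr HUr]]; destruct (HV x Vx) as [s [Hs HVs]].
    exists (Rmin r s); split; [apply Rmin_pos; auto|]; intros y Hy; split.
    + apply HUr; eapply Rlt_le_trans; [exact Hy|apply Rmin_l].
    + apply HVs; eapply Rlt_le_trans; [exact Hy|apply Rmin_r].
  - intros U HU; apply H; intros x Ux; destruct (HU x Ux) as [V [HV [Vx HVU]]].
    apply H in HV; destruct (HV x Vx) as [r [Hr HVr]]; exists r; auto.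
Qed.

Lemma ball_open {X : Type} (op : (X -> Prop) -> Prop) (d : X -> X -> R) x r :
  is_metric d -> (forall U, op U <-> metric_open d U) -> op (fun y => d x y < r).
Proof.
  intros [_ [_ Ht]] H; apply H; intros y Hy; exists (r - d x y); split; [lra|].
  intros z Hz; pose proof (Ht x y z); lra.
Qed.

Lemma metric_hausdorff {X : Type} (op : (X -> Prop) -> Prop) (d : X -> X -> R) :
  is_metric d -> (forall U, op U <-> metric_open d U) -> hausdorff op.
Proof.
  intros Hd H x y Hxy.
  assert (Hp : 0 < d x y).
  { destruct (metric_pos d x y Hd) as [Hp|Hp]; [exact Hp|].
    destruct Hxy; apply Hd; auto. }
  exists (fun z => d x z < d x y / 2), (fun z => d y z < d x y / 2).
  repeat split; try (apply ball_open; assumption);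
    try (rewrite metric_refl by exact Hd; lra).
  intros z H1 H2; destruct Hd as [_ [Hs Htri]]; pose proof (Htri x z y).
  rewrite (Hs z y) in *; lra.
Qed.

Lemma lebesgue {X : Type} (op : (X -> Prop) -> Prop) (d : X -> X -> R)
  (W : (X -> Prop) -> Prop) :
  is_metric d -> (forall U, op U <-> metric_open d U) ->
  compact_set op (fun _ => True) ->
  (forall x, exists U, op U /\ W U /\ U x) ->
  exists r, 0 < r /\ forall x, exists U, W U /\ forall y, d x y < r -> U y.
Proof.
  intros Hd H Hc HW.
  destruct (compact_ind op (fun _ => True) (fun Z => exists r, 0 < r /\
    forall x, Z x -> exists U, W U /\ forall y, d x y < r -> U y) Hc) as [r [Hr HL]].
  - exists 1; split; [lra|intros x []].
  - intros Z Z' [r [Hr HZ]] [s [Hs HZ']]; exists (Rmin r s); split; [apply Rmin_pos; auto|].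
    intros x [Hx|Hx].
    + destruct (HZ x Hx) as [U [WU HU]]; exists U; split; auto; intros y Hy.
      apply HU; eapply Rlt_le_trans; [exact Hy|apply Rmin_l].
    + destruct (HZ' x Hx) as [U [WU HU]]; exists U; split; auto; intros y Hy.
      apply HU; eapply Rlt_le_trans; [exact Hy|apply Rmin_r].
  - intros Z Z' HZ [r [Hr HL]]; exists r; auto.
  - intros a _; destruct (HW a) as [U [HU [WU Ua]]]; apply H in HU.
    destruct (HU a Ua) as [r [Hr HUr]]; exists (fun y => d a y < r / 2).
    split; [apply ball_open; auto|]; split; [rewrite metric_refl by exact Hd; lra|].
    exists (r / 2); split; [lra|]; intros x Hx; exists U; split; [exact WU|].
    intros y Hy; apply HUr; destruct Hd as [_ [_ Htri]]; pose proof (Htri a x y); lra.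
  - exists r; split; auto.
Qed.

(* Topological form of nullity: all but finitely many of the sets are small
   with respect to any given open cover. *)
Definition cover_null {X I : Type} (op : (X -> Prop) -> Prop) (idx : I -> Prop)
  (A : I -> X -> Prop) : Prop :=
  forall W : (X -> Prop) -> Prop,
    (forall U, W U -> op U) -> (forall x, exists U, W U /\ U x) ->
    exists l : list I, forall i, idx i -> ~ In i l -> exists U, W U /\ forall x, A i x -> U x.

(** A set of diameter below a Lebesgue number of the cover lies in the ball of that radius around
    any of its points, hence in one member of the cover. *)
Lemma null_cover {X I : Type} (op : (X -> Prop) -> Prop) (d : X -> X -> R)
  (idx : I -> Prop) (A : I -> X -> Prop) :
  is_metric d -> (forall U, op U <-> metric_open d U) ->
  compact_set op (fun _ => True) ->
  (forall i, idx i -> exists x, A i x) ->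
  null_family d idx A -> cover_null op idx A.
Proof.
  intros Hd H Hc HA Hn W HWo HWc.
  destruct (lebesgue op d W Hd H Hc) as [r [Hr HL]].
  - intros x; destruct (HWc x) as [U [WU Ux]]; exists U; auto.
  - destruct (Hn r Hr) as [l Hl]; exists l; intros i Hi Hil.
    destruct (HA i Hi) as [x Ax]; destruct (HL x) as [U [WU HU]].
    exists U; split; [exact WU|]; intros y Ay; apply HU.
    apply NNPP; intros Hxy; apply Hil, Hl; [exact Hi|].
    intros delta Hdl; exists x, y; repeat split; auto; lra.
Qed.

Lemma cover_null_null {X I : Type} (op : (X -> Prop) -> Prop) (d : X -> X -> R)
  (idx : I -> Prop) (A : I -> X -> Prop) :
  is_metric d -> (forall U, op U <-> metric_open d U) ->
  cover_null op idx A -> null_family d idx A.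
Proof.
  intros Hd H Hn eps He.
  (* Points of one ball of radius [eps / 3] are less than [2 * eps / 3] apart, which stays strictly
     below [eps]. *)
  destruct (Hn (fun U => exists x, U = (fun y => d x y < eps / 3))) as [l Hl].
  - intros U [x ->]; apply ball_open; auto.
  - intros x; exists (fun y => d x y < eps / 3); split; [exists x; reflexivity|].
    rewrite metric_refl by exact Hd; lra.
  - exists l; intros i Hi HA; apply NNPP; intros Hil.
    destruct (Hl i Hi Hil) as [U [[c ->] HU]].
    destruct (HA (2 * eps / 3) ltac:(lra)) as [x [y [Ax [Ay Hxy]]]].
    apply HU in Ax; apply HU in Ay; destruct Hd as [_ [Hs Htri]].
    pose proof (Htri x c y); rewrite (Hs x c) in *; lra.
Qed.

(** The base consists of the balls of radius [1 / (k + 1)] around the points of a finite net of that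
    mesh; the index pairs [k] with a position in the net, and positions past its end give the empty
    set. *)
Lemma compact_metric_base {X : Type} (op : (X -> Prop) -> Prop) (d : X -> X -> R) :
  is_metric d -> (forall U, op U <-> metric_open d U) ->
  compact_set op (fun _ => True) ->
  exists B : nat -> X -> Prop, (forall n, op (B n)) /\
    forall x U, op U -> U x -> exists n, B n x /\ forall y, B n y -> U y.
Proof.
  intros Hd H Hc.
  assert (Hnet : forall k : nat, exists l : list X,
    forall x, exists p, In p l /\ d p x < / (INR k + 1)).
  { intros k.
    assert (Hk : 0 < / (INR k + 1)) by (apply Rinv_0_lt_compat; pose proof (pos_INR k); lra).
    destruct (compact_ind op (fun _ => True) (fun Z => exists l : list X,
      forall x, Z x -> exists p, In p l /\ d p x < / (INR k + 1)) Hc) as [l Hl].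
    - exists nil; intros x [].
    - intros Z Z' [l Hl] [l' Hl']; exists (l ++ l'); intros x [Hx|Hx].
      + destruct (Hl x Hx) as [p [Hp1 Hp2]]; exists p; split; auto; apply in_or_app; auto.
      + destruct (Hl' x Hx) as [p [Hp1 Hp2]]; exists p; split; auto; apply in_or_app; auto.
    - intros Z Z' HZ [l Hl]; exists l; auto.
    - intros a _; exists (fun y => d a y < / (INR k + 1)); split; [apply ball_open; auto|].
      split; [rewrite metric_refl by exact Hd; exact Hk|].
      exists (a :: nil); intros x Hx; exists a; split; [left; reflexivity|exact Hx].
    - exists l; intros x; apply Hl; exact I. }
  destruct (fun_choice _ Hnet) as [net Hn].
  exists (fun n y => exists p, nth_error (net (fst (of_nat n))) (snd (of_nat n)) = Some p /\
    d p y < / (INR (fst (of_nat n)) + 1)).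
  split.
  - intros n; destruct (nth_error (net (fst (of_nat n))) (snd (of_nat n))) as [p|].
    + apply (op_ext op (fun y => d p y < / (INR (fst (of_nat n)) + 1))).
      * intros y; split; [intros Hy; exists p; auto|intros [q [Hq Hy]]; congruence].
      * apply ball_open; auto.
    + apply (op_ext op (fun _ => False)); [|apply op_empty; apply metric_topology with d; auto].
      intros y; split; [intros []|intros [q [Hq _]]; discriminate].
  - intros x U HU Ux; apply H in HU; destruct (HU x Ux) as [r [Hr HUr]].
    destruct (archimed_cor1 (r / 2) ltac:(lra)) as [K [HK1 HK2]].
    assert (HK : / (INR K + 1) < r / 2).
    { eapply Rle_lt_trans; [|exact HK1].
      apply Rinv_le_contravar; [apply lt_0_INR; exact HK2|lra]. }
    destruct (Hn K x) as [p [Hp Hpx]]; apply In_nth_error in Hp; destruct Hp as [j Hj].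
    exists (to_nat (K, j)); rewrite cancel_of_to; simpl; split.
    + exists p; auto.
    + intros y [q [Hq Hqy]]; replace q with p in * by congruence; apply HUr.
      destruct Hd as [_ [Hs Htri]]; pose proof (Htri x p y); rewrite (Hs x p) in *; lra.
Qed.

(** Disjoint compact sets are separated, not only points, because a saturated set at a vertex must
    treat each [Sigma_e] as a whole. *)
Lemma compact_metric_separating {X : Type} (op : (X -> Prop) -> Prop) (d : X -> X -> R) :
  is_metric d -> (forall U, op U <-> metric_open d U) ->
  compact_set op (fun _ => True) ->
  exists B : nat -> X -> Prop, (forall n, op (B n)) /\
    forall A C, compact_set op A -> compact_set op C -> (forall x, A x -> C x -> False) ->
      exists m n, (forall x, A x -> B m x) /\ (forall x, C x -> B n x) /\
        forall x, B m x -> B n x -> False.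
Proof.
  intros Hd H Hc.
  destruct (compact_metric_base op d Hd H Hc) as [B [HB1 HB2]].
  assert (Ht := metric_topology op d H).
  assert (Hh := metric_hausdorff op d Hd H).
  exists (bitunion B); split; [intros n; apply bitunion_open; auto|].
  assert (Hin : forall A U, compact_set op A -> op U -> (forall x, A x -> U x) ->
    exists n, (forall x, A x -> bitunion B n x) /\ forall x, bitunion B n x -> U x).
  { intros A U HA HU HAU.
    apply (compact_ind op A (fun Z => exists n, (forall x, Z x -> bitunion B n x) /\
      forall x, bitunion B n x -> U x) HA).
    - exists 0%nat; split; [intros x []|intros x Hx; destruct (bitunion_0 B x Hx)].
    - intros Z Z' [m [H1 H2]] [n [H3 H4]]; exists (Nat.lor m n).
      split; intros x; rewrite bitunion_lor; intros [Hx|Hx]; auto.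
    - intros Z Z' HZ [m [H1 H2]]; exists m; auto.
    - intros a Aa; destruct (HB2 a U HU (HAU a Aa)) as [n [Bn HBn]].
      exists (B n); repeat split; auto; exists (Nat.setbit 0 n).
      split; intros x; rewrite bitunion_single; auto. }
  intros A C HA HC HAC.
  destruct (compact_interpolate op A (fun x => ~ C x) Ht Hh Hc) as [V [K [H1 [H2 [H3 [H4 H5]]]]]].
  - apply compact_is_closed; auto.
  - apply compact_is_closed; auto.
  - intros x Ax Cx; eauto.
  - destruct (Hin A V HA H1 H3) as [m [M1 M2]].
    destruct (Hin C (fun x => ~ K x) HC H2) as [n [N1 N2]]; [intros x Cx Kx; exact (H5 x Kx Cx)|].
    exists m, n; repeat split; auto; intros x Bm Bn; apply (N2 x Bn); auto.
Qed.

(** * Trees, rays and ends *)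

Lemma omega_rev (T : TS) e : omega T (trev T e) = talpha T e.
Proof. unfold omega; rewrite trev_inv; reflexivity. Qed.

Lemma is_path_app (T : TS) p q u w :
  is_path T (p ++ q) u w <-> exists v, is_path T p u v /\ is_path T q v w.
Proof.
  revert u; induction p as [|e p IH]; intros u; simpl.
  - split; [intros H; exists u; auto|intros [v [-> H]]; exact H].
  - rewrite IH; split.
    + intros [H [v [H1 H2]]]; exists v; auto.
    + intros [v [[H H1] H2]]; split; [exact H|exists v; auto].
Qed.

Lemma reduced_cons (T : TS) e p :
  reduced T (e :: p) <->
  reduced T p /\ forall e' p', p = e' :: p' -> e' <> trev T e.
Proof.
  destruct p as [|e' p]; simpl.
  - split; [intros _; split; [exact I|discriminate]|auto].
  - split.
    + intros [H1 H2]; split; [exact H2|]; intros f p' [= <- _]; exact H1.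
    + intros [H1 H2]; split; [apply (H2 _ _ eq_refl)|exact H1].
Qed.

Lemma reduced_app_inv (T : TS) p q : reduced T (p ++ q) -> reduced T p /\ reduced T q.
Proof.
  induction p as [|e p IH]; simpl app; [split; [exact I|auto]|].
  rewrite !reduced_cons; intros [H1 H2]; apply IH in H1; destruct H1 as [H1 H3].
  repeat split; auto; intros e' p' ->; apply (H2 e' (p' ++ q)); reflexivity.
Qed.

Lemma reduced_app (T : TS) p e q :
  reduced T (p ++ e :: nil) -> reduced T (e :: q) -> reduced T (p ++ e :: q).
Proof.
  induction p as [|f p IH]; [auto|]; simpl app.
  rewrite !(reduced_cons T f); intros [H1 H2] H3; split; [auto|].
  intros e' p' H; destruct p as [|g p]; simpl in *; injection H as -> _.
  - apply (H2 _ _ eq_refl).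
  - apply (H2 _ _ eq_refl).
Qed.

Lemma reduced_snoc (T : TS) p e :
  reduced T p -> (forall p' f, p = p' ++ f :: nil -> e <> trev T f) ->
  reduced T (p ++ e :: nil).
Proof.
  induction p as [|f p IH]; [simpl; auto|]; simpl app; rewrite !(reduced_cons T f).
  intros [H1 H2] H3; split.
  - apply IH; [exact H1|]; intros p' g ->; apply (H3 (f :: p')); reflexivity.
  - intros e' p' H; destruct p as [|g p]; simpl in H; injection H as -> _.
    + apply (H3 nil); reflexivity.
    + apply (H2 _ _ eq_refl).
Qed.

(** Backtracks are cancelled as edges are prepended. The inclusion of edges is what keeps the
    reduced path inside any subtree that contains the given one. *)
Lemma path_reduce (T : TS) p u v : is_path T p u v ->
  exists q, is_path T q u v /\ reduced T q /\ incl q p.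
Proof.
  revert u; induction p as [|e p IH]; intros u H.
  - exists nil; repeat split; auto; intros x [].
  - destruct H as [Hu H]; destruct (IH _ H) as [q [H1 [H2 H3]]].
    destruct (classic (exists q', q = trev T e :: q')) as [[q' ->]|Hq].
    + exists q'; destruct H1 as [_ H1]; rewrite omega_rev, Hu in H1.
      split; [exact H1|]; split; [apply reduced_cons in H2; apply H2|].
      intros x Hx; right; apply H3; right; exact Hx.
    + exists (e :: q); split; [split; auto|]; split.
      * apply reduced_cons; split; [exact H2|]; intros e' p' -> ->; apply Hq; exists p'; auto.
      * intros x [<-|Hx]; [left; reflexivity|right; apply H3; exact Hx].
Qed.

Lemma restr_path (T : TS) (B : TV T -> Prop) p (u v : TV (restr T B)) :
  is_path (restr T B) p u v -> is_path T (map (@proj1_sig _ _) p) (proj1_sig u) (proj1_sig v).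
Proof.
  revert u; induction p as [|e p IH]; intros u; simpl.
  - intros ->; reflexivity.
  - intros [<- H]; split; [reflexivity|]; exact (IH _ H).
Qed.

Lemma sig_eq {A : Type} (P : A -> Prop) (x y : {a | P a}) :
  proj1_sig x = proj1_sig y -> x = y.
Proof. destruct x, y; simpl; apply subset_eq_compat. Qed.

Lemma restr_path_lift (T : TS) (B : TV T -> Prop) p (u v : TV (restr T B)) :
  is_path T p (proj1_sig u) (proj1_sig v) ->
  (forall e, In e p -> B (talpha T e) /\ B (omega T e)) ->
  exists q, map (@proj1_sig _ _) q = p /\ is_path (restr T B) q u v.
Proof.
  revert u; induction p as [|e p IH]; intros u; simpl.
  - intros H _; exists nil; split; [reflexivity|]; apply sig_eq; exact H.
  - intros [H1 H2] H.
    set (e' := exist (fun e => B (talpha T e) /\ B (omega T e)) e (H e (or_introl eq_refl))).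
    destruct (IH (omega (restr T B) e')) as [q [Hq1 Hq2]].
    + exact H2.
    + intros f Hf; apply H; right; exact Hf.
    + exists (e' :: q); split; [simpl; rewrite Hq1; reflexivity|].
      split; [apply sig_eq; exact H1|exact Hq2].
Qed.

Lemma restr_reduced (T : TS) (B : TV T -> Prop) p :
  reduced (restr T B) p <-> reduced T (map (@proj1_sig _ _) p).
Proof.
  induction p as [|e p IH]; [split; auto|].
  simpl map; rewrite !reduced_cons, IH; split; intros [H1 H2]; split; auto.
  - intros e' p' H; destruct p as [|f p]; [discriminate|]; injection H as <- _.
    intros He; apply (H2 f p eq_refl); apply sig_eq; exact He.
  - intros e' p' -> ->; apply (H2 _ _ eq_refl); reflexivity.
Qed.

(** * The part of a tree beyond an edge *)

Definition outedge (T : TS) (F : TV T -> Prop) (e : TO T) : Prop :=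
  F (talpha T e) /\ ~ F (omega T e).

(* the component of [t] after removal of the edge [e] is the one of [omega e] *)
Definition side (T : TS) (e : TO T) (t : TV T) : Prop :=
  exists p, is_path T (e :: p) (talpha T e) t /\ reduced T (e :: p).

Section Tree.
Context (T : TS) (HT : is_tree T).

Lemma tree_path u v : exists p, is_path T p u v /\ reduced T p.
Proof. destruct HT as [_ H]; destruct (H u v) as [p [Hp _]]; exists p; exact Hp. Qed.

Lemma tree_unique p q u v : is_path T p u v -> reduced T p ->
  is_path T q u v -> reduced T q -> p = q.
Proof.
  intros; destruct HT as [_ H']; destruct (H' u v) as [r [_ Hr]].
  rewrite (Hr p), (Hr q); auto.
Qed.

Lemma tree_no_loop p u : is_path T p u u -> reduced T p -> p = nil.
Proof. intros H1 H2; apply (tree_unique p nil u u); simpl; auto. Qed.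

Lemma alpha_ne_omega e : talpha T e <> omega T e.
Proof.
  intros H; assert (H' : e :: nil = nil); [|discriminate].
  apply (tree_no_loop _ (talpha T e)); simpl; auto.
Qed.

Lemma edge_eq e f : talpha T e = talpha T f -> omega T e = omega T f -> e = f.
Proof.
  intros H1 H2; assert (H' : e :: nil = f :: nil); [|congruence].
  apply (tree_unique _ _ (talpha T e) (omega T e)); simpl; auto.
Qed.

Lemma path_side_eq e p t : is_path T p (talpha T e) t -> reduced T p -> side T e t ->
  exists p', p = e :: p'.
Proof.
  intros H1 H2 [q [H3 H4]]; exists q; apply (tree_unique _ _ (talpha T e) t); auto.
Qed.

Lemma side_omega e : side T e (omega T e).
Proof. exists nil; simpl; auto. Qed.

Lemma not_side_alpha e : ~ side T e (talpha T e).
Proof. intros [p [H1 H2]]; apply tree_no_loop in H1; [discriminate|exact H2]. Qed.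

Lemma side_or e t : side T e t \/ side T (trev T e) t.
Proof.
  destruct (tree_path (talpha T e) t) as [p [H1 H2]].
  destruct (classic (exists p', p = e :: p')) as [[p' ->]|Hp].
  - left; exists p'; auto.
  - right; exists p; simpl; rewrite omega_rev; split; [auto|].
    apply reduced_cons; split; [exact H2|]; intros e' p' ->; rewrite trev_inv.
    intros ->; apply Hp; exists p'; reflexivity.
Qed.

Lemma side_not_rev e t : side T e t -> ~ side T (trev T e) t.
Proof.
  intros H [q [[_ H1] H2]]; rewrite omega_rev in H1.
  apply reduced_cons in H2; destruct H2 as [H2 H3].
  destruct (path_side_eq e q t H1 H2 H) as [p' ->].
  apply (H3 e p' eq_refl); rewrite trev_inv; reflexivity.
Qed.

(** The reduced path to the tail of [f] either ends with the reverse of [f] and is shortened, or is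
    extended by [f]. Only [e] and its reverse change sides. *)
Lemma side_step e f : f <> e -> f <> trev T e ->
  side T e (talpha T f) -> side T e (omega T f).
Proof.
  intros H1 H2 [p [H3 H4]].
  destruct (classic (exists p', e :: p = p' ++ trev T f :: nil)) as [[p' Hp]|Hp].
  - destruct p' as [|g p']; simpl in Hp; injection Hp as He ->.
    + destruct H2; rewrite He, trev_inv; reflexivity.
    + subst g; exists p'; rewrite app_comm_cons in H3, H4; apply is_path_app in H3.
      destruct H3 as [v [H3 [<- _]]]; split; [exact H3|].
      apply reduced_app_inv in H4; apply H4.
  - exists (p ++ f :: nil); rewrite app_comm_cons; split.
    + apply is_path_app; exists (talpha T f); simpl; auto.
    + apply reduced_snoc; [exact H4|]; intros p' g Hpg ->; apply Hp; exists p'.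
      rewrite trev_inv; exact Hpg.
Qed.

Lemma side_path e p u v : is_path T p u v ->
  (forall f, In f p -> f <> e /\ f <> trev T e) -> side T e u -> side T e v.
Proof.
  revert u; induction p as [|f p IH]; simpl; [intros u ->; auto|].
  intros u [<- H] Hf Hu; apply (IH _ H); [intros g Hg; apply Hf; auto|].
  apply side_step; try apply Hf; auto.
Qed.

Lemma side_path_omega e p t f : is_path T (e :: p) (talpha T e) t ->
  reduced T (e :: p) -> In f (e :: p) -> side T e (omega T f).
Proof.
  intros H1 H2 [<-|Hf]; [apply side_omega|].
  apply in_split in Hf; destruct Hf as [l1 [l2 ->]].
  exists (l1 ++ f :: nil); rewrite app_comm_cons in *.
  apply is_path_app in H1; destruct H1 as [w [H1 [H3 _]]]; split.
  - apply is_path_app; exists w; split; [exact H1|]; simpl; auto.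
  - replace ((e :: l1) ++ f :: l2) with (((e :: l1) ++ f :: nil) ++ l2) in H2
      by (rewrite <- app_assoc; reflexivity).
    apply reduced_app_inv in H2; apply H2.
Qed.

Lemma side_path_alpha e p t f : is_path T (e :: p) (talpha T e) t ->
  reduced T (e :: p) -> In f p -> side T e (talpha T f).
Proof.
  intros H1 H2 Hf; apply in_split in Hf; destruct Hf as [l1 [l2 ->]].
  exists l1; rewrite app_comm_cons in *.
  apply is_path_app in H1; destruct H1 as [w [H1 [<- _]]]; split; [exact H1|].
  apply reduced_app_inv in H2; apply H2.
Qed.

Lemma side_cons e e' t : talpha T e' = omega T e -> e' <> trev T e ->
  side T e' t -> side T e t.
Proof.
  intros H1 H2 [p [H3 H4]]; exists (e' :: p); split.
  - split; [reflexivity|]; rewrite <- H1; exact H3.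
  - apply reduced_cons; split; [exact H4|]; intros f q [= <- _]; exact H2.
Qed.

Lemma side_cases e t : side T e t -> t = omega T e \/
  exists e', talpha T e' = omega T e /\ e' <> trev T e /\ side T e' t.
Proof.
  intros [[|e' p] [[_ H1] H2]]; [left; simpl in H1; auto|right].
  apply reduced_cons in H2; destruct H2 as [H2 H3].
  assert (He : talpha T e' = omega T e) by apply H1.
  exists e'; split; [exact He|]; split; [exact (H3 _ _ eq_refl)|].
  exists p; split; [rewrite He; exact H1|exact H2].
Qed.

(** Convexity of subtrees: the reduction of a path inside [B] is reduced with the same ends, so it
    is the given reduced path. *)
Lemma subtree_path (B : TV T -> Prop) u v p : is_subtree T B -> B u -> B v ->
  is_path T p u v -> reduced T p -> forall e, In e p -> B (talpha T e) /\ B (omega T e).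
Proof.
  intros [_ HB] Bu Bv H1 H2 e He; destruct (HB u v Bu Bv) as [q [H3 H4]].
  destruct (path_reduce T q u v H3) as [q' [H5 [H6 H7]]].
  rewrite (tree_unique p q' u v) in He by auto; apply H4, H7; exact He.
Qed.

Lemma subtree_not_side (F : TV T -> Prop) e v : is_subtree T F -> outedge T F e ->
  F v -> ~ side T e v.
Proof.
  intros HF [H1 H2] Fv Hs; destruct (tree_path (talpha T e) v) as [p [H3 H4]].
  destruct (path_side_eq e p v H3 H4 Hs) as [p' ->]; apply H2.
  apply (subtree_path F _ _ _ HF H1 Fv H3 H4); left; reflexivity.
Qed.

Lemma subtree_same_side (B : TV T -> Prop) e u v : is_subtree T B ->
  ~ (B (talpha T e) /\ B (omega T e)) -> B u -> B v -> side T e u -> side T e v.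
Proof.
  intros HB He Bu Bv; destruct (tree_path u v) as [p [H1 H2]].
  apply (side_path e p); [exact H1|]; intros f Hf.
  pose proof (subtree_path B u v p HB Bu Bv H1 H2 f Hf) as [H3 H4].
  split; intros ->; apply He; auto; rewrite omega_rev in H4; auto.
Qed.

Lemma exit_exists (F : TV T -> Prop) t : is_subtree T F -> ~ F t ->
  exists e, outedge T F e /\ side T e t.
Proof.
  intros [[v Fv] _] Ft; destruct (tree_path v t) as [p [H1 H2]].
  revert v Fv H1 H2; induction p as [|e p IH]; intros v Fv H1 H2.
  - simpl in H1; subst; contradiction.
  - destruct H1 as [<- H1]; destruct (classic (F (omega T e))) as [Fe|Fe].
    + apply (IH _ Fe H1); apply reduced_cons in H2; apply H2.
    + exists e; split; [split; auto|]; exists p; simpl; auto.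
Qed.

(** A reduced path inside [F] from the tail of [e'] to that of [e], continued through [e] to [t], is
    reduced and so equals the path starting with [e']. If the part inside [F] were not empty, it
    would start with [e'], whose head is not in [F]. *)
Lemma exit_unique (F : TV T -> Prop) e e' t : is_subtree T F ->
  outedge T F e -> outedge T F e' -> side T e t -> side T e' t -> e = e'.
Proof.
  intros HF He He' [p [H1 H2]] [p' [H3 H4]].
  destruct (tree_path (talpha T e') (talpha T e)) as [q [H5 H6]].
  assert (Hq := subtree_path F _ _ q HF (proj1 He') (proj1 He) H5 H6).
  assert (H : q ++ e :: p = e' :: p').
  { apply (tree_unique _ _ (talpha T e') t); auto.
    - apply is_path_app; exists (talpha T e); auto.
    - apply reduced_app; [|exact H2]; apply reduced_snoc; [exact H6|].
      intros l f -> ->; apply (proj2 He); rewrite omega_rev.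
      apply Hq; apply in_or_app; right; left; reflexivity. }
  destruct q as [|f q]; simpl in H; injection H as H _; [exact H|].
  subst f; destruct (proj2 He'); apply Hq; left; reflexivity.
Qed.

Lemma beyond_side (F : TV T -> Prop) e t : is_subtree T F -> outedge T F e ->
  beyond T F e t <-> side T e t.
Proof.
  intros HF He; split.
  - intros [p [H1 [H2 _]]]; exists p; auto.
  - intros [p [H1 H2]]; exists p; repeat split; try apply H1; try apply H2.
    intros f Hf Ff; apply (subtree_not_side F e (omega T f) HF He Ff).
    apply (side_path_omega e p t); auto.
Qed.

(** The path from the tail of [e] through [e] to [t] cannot cross [e0] in either direction: the tail
    of [e0] is in [F] and would then lie beyond [e]. *)
Lemma side_nested (F : TV T -> Prop) e e0 t : (forall v, F v -> ~ side T e v) ->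
  outedge T F e0 -> ~ F (talpha T e) -> side T e0 (talpha T e) ->
  side T e t -> side T e0 t.
Proof.
  intros HF [H0 H0'] He H1 [p [H2 H3]].
  apply (side_path e0 (e :: p) (talpha T e)); [exact H2| |exact H1].
  intros f Hf; split; intros ->.
  - destruct Hf as [->|Hf]; [contradiction|].
    apply (HF _ H0); apply (side_path_alpha e p t); auto.
  - apply (HF _ H0); rewrite <- omega_rev; apply (side_path_omega e p t); auto.
Qed.

Lemma fin_subtree_point v : fin_subtree T (fun u => u = v).
Proof.
  split; [split|exists (v :: nil); intros u ->; left; reflexivity].
  - exists v; reflexivity.
  - intros u w -> ->; exists nil; split; [reflexivity|intros e []].
Qed.

Lemma fin_subtree_add (F : TV T -> Prop) e : fin_subtree T F -> F (talpha T e) ->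
  fin_subtree T (fun v => F v \/ v = omega T e).
Proof.
  intros [[[v Fv] HF] [l Hl]] Fe; split; [split|].
  - exists v; auto.
  - assert (H : forall u, F u -> (exists p, is_path T p u (omega T e) /\
      forall f, In f p -> (F (talpha T f) \/ talpha T f = omega T e) /\
        (F (omega T f) \/ omega T f = omega T e)) /\
      exists p, is_path T p (omega T e) u /\
      forall f, In f p -> (F (talpha T f) \/ talpha T f = omega T e) /\
        (F (omega T f) \/ omega T f = omega T e)).
    { intros u Fu; split.
      - destruct (HF u _ Fu Fe) as [p [H1 H2]]; exists (p ++ e :: nil); split.
        + apply is_path_app; exists (talpha T e); simpl; auto.
        + intros f Hf; apply in_app_or in Hf; destruct Hf as [Hf|[<-|[]]]; [|auto].
          destruct (H2 f Hf); auto.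
      - destruct (HF _ u Fe Fu) as [p [H1 H2]]; exists (trev T e :: p); split.
        + split; [reflexivity|]; rewrite omega_rev; exact H1.
        + intros f [<-|Hf]; [rewrite omega_rev; split; auto|].
          destruct (H2 f Hf); auto. }
    intros u w [Fu| ->] [Fw| ->].
    + destruct (HF u w Fu Fw) as [p [H1 H2]]; exists p; split; [exact H1|].
      intros f Hf; destruct (H2 f Hf); auto.
    + apply H; auto.
    + apply H; auto.
    + exists nil; split; [reflexivity|intros f []].
  - exists (omega T e :: l); intros u [Fu| ->]; [right; auto|left; reflexivity].
Qed.

Lemma fin_subtree_extend (F : TV T -> Prop) v : fin_subtree T F ->
  exists F', fin_subtree T F' /\ (forall u, F u -> F' u) /\ F' v.
Proof.
  intros HF; pose proof HF as [[[u Fu] _] _]; destruct (tree_path u v) as [p [H _]].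
  revert F HF u Fu H; induction p as [|e p IH]; intros F HF u Fu H.
  - simpl in H; subst; exists F; auto.
  - destruct H as [<- H].
    destruct (IH _ (fin_subtree_add F e HF Fu) (omega T e) (or_intror eq_refl) H)
      as [F' [H1 [H2 H3]]]; exists F'; repeat split; try apply H1; auto.
Qed.

(** Finite subtrees are directed under inclusion: [H] grows from [F] by attaching a path to each
    vertex in a list containing those of [G]. *)
Lemma fin_subtree_union (F G : TV T -> Prop) : fin_subtree T F -> fin_subtree T G ->
  exists H, fin_subtree T H /\ (forall u, F u -> H u) /\ (forall u, G u -> H u).
Proof.
  intros HF [_ [l Hl]].
  assert (E : forall l : list (TV T), exists H, fin_subtree T H /\ (forall u, F u -> H u) /\
    forall u, In u l -> H u).
  { clear l Hl; induction l as [|v l [H [H1 [H2 H3]]]].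
    - exists F; split; [exact HF|]; split; [auto|intros u []].
    - destruct (fin_subtree_extend H v H1) as [H' [H4 [H5 H6]]].
      exists H'; repeat split; try apply H4; auto.
      intros u [<-|Hu]; auto. }
  destruct (E l) as [H [H1 [H2 H3]]]; exists H; auto.
Qed.

(** * Rays and their tails *)

Definition shift {A : Type} (n : nat) (r : nat -> A) : nat -> A := fun m => r (n + m)%nat.

Definition tail_eq {A : Type} (r r' : nat -> A) : Prop :=
  exists m k, forall n, r (m + n)%nat = r' (k + n)%nat.

Lemma tail_eq_refl {A : Type} (r : nat -> A) : tail_eq r r.
Proof. exists 0%nat, 0%nat; reflexivity. Qed.

Lemma tail_eq_sym {A : Type} (r r' : nat -> A) : tail_eq r r' -> tail_eq r' r.
Proof. intros [m [k H]]; exists k, m; auto. Qed.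

Lemma tail_eq_trans {A : Type} (r r' r'' : nat -> A) :
  tail_eq r r' -> tail_eq r' r'' -> tail_eq r r''.
Proof.
  intros [m [k H]] [m' [k' H']]; exists (m + m')%nat, (k' + k)%nat; intros n.
  replace (m + m' + n)%nat with (m + (m' + n))%nat by lia; rewrite H.
  replace (k + (m' + n))%nat with (m' + (k + n))%nat by lia; rewrite H'.
  f_equal; lia.
Qed.

Lemma tail_eq_shift {A : Type} n (r : nat -> A) : tail_eq (shift n r) r.
Proof. exists 0%nat, n; reflexivity. Qed.

Lemma is_ray_shift n r : is_ray T r -> is_ray T (shift n r).
Proof.
  intros H m; unfold shift; rewrite Nat.add_succ_r; apply H.
Qed.

Lemma ray_seg r m n : is_ray T r ->
  is_path T (map r (seq m n)) (talpha T (r m)) (talpha T (r (m + n)%nat)).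
Proof.
  intros H; revert m; induction n as [|n IH]; intros m; simpl.
  - rewrite Nat.add_0_r; reflexivity.
  - split; [reflexivity|]; rewrite <- (proj1 (H m)).
    replace (m + S n)%nat with (S m + n)%nat by lia; apply IH.
Qed.

Lemma ray_seg_reduced r m n : is_ray T r -> reduced T (map r (seq m n)).
Proof.
  intros H; revert m; induction n as [|n IH]; intros m; simpl seq; [exact I|].
  simpl map; apply reduced_cons; split; [apply IH|].
  intros e' p' He; destruct n as [|n]; [discriminate|]; simpl in He.
  injection He as <- _; apply H.
Qed.

Lemma ray_inj r m n : is_ray T r -> talpha T (r m) = talpha T (r n) -> m = n.
Proof.
  intros H.
  assert (L : forall m n, (m < n)%nat -> talpha T (r m) <> talpha T (r n)).
  { clear m n; intros m n Hmn E.
    pose proof (ray_seg r m (n - m) H) as H1; pose proof (ray_seg_reduced r m (n - m) H) as H2.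
    replace (m + (n - m))%nat with n in H1 by lia; rewrite <- E in H1.
    apply tree_no_loop in H1; [|exact H2].
    destruct (n - m)%nat eqn:E'; [lia|discriminate]. }
  intros E; destruct (Nat.lt_total m n) as [Hl|[Hl|Hl]]; [|exact Hl|].
  - destruct (L m n Hl E).
  - destruct (L n m Hl); auto.
Qed.

Lemma ray_side r m n : is_ray T r -> side T (r m) (talpha T (r (S m + n)%nat)).
Proof.
  intros H; exists (map r (seq (S m) n)); split.
  - apply (ray_seg r m (S n)) in H; simpl in *.
    replace (m + S n)%nat with (S (m + n)) in H by lia; exact H.
  - apply (ray_seg_reduced r m (S n) H).
Qed.

Lemma ray_leaves r (l : list (TV T)) : is_ray T r -> exists n, ~ In (talpha T (r n)) l.
Proof.
  intros H; apply NNPP; intros Hn.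
  assert (Hin : forall n, In (talpha T (r n)) l).
  { intros n; apply NNPP; intros Hn'; apply Hn; exists n; exact Hn'. }
  set (s := map (fun n => talpha T (r n)) (seq 0 (S (length l)))).
  assert (HN : NoDup s).
  { apply Injective_map_NoDup; [|apply seq_NoDup].
    intros m n; apply ray_inj; exact H. }
  assert (HI : incl s l).
  { intros v Hv; apply in_map_iff in Hv; destruct Hv as [n [<- _]]; apply Hin. }
  apply (NoDup_incl_length HN) in HI; unfold s in HI.
  rewrite length_map, length_seq in HI; lia.
Qed.

Lemma ray_exit (F : TV T -> Prop) r : fin_subtree T F -> is_ray T r ->
  F (talpha T (r 0%nat)) -> exists n, outedge T F (r n).
Proof.
  intros [_ [l Hl]] H H0; apply NNPP; intros Hn.
  assert (HF : forall n, F (talpha T (r n))).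
  { induction n as [|n IH]; [exact H0|]; rewrite (proj1 (H n)).
    apply NNPP; intros Hw; apply Hn; exists n; split; auto. }
  destruct (ray_leaves r l H) as [n Hn']; apply Hn'; apply Hl; apply HF.
Qed.

Fixpoint pcat (p : list (TO T)) (r : nat -> TO T) : nat -> TO T :=
  match p with
  | nil => r
  | e :: p => fun m => match m with O => e | S m => pcat p r m end
  end.

Lemma pcat_shift p r n : pcat p r (length p + n)%nat = r n.
Proof. induction p as [|e p IH]; simpl; auto. Qed.

Lemma pcat_tail p r : tail_eq r (pcat p r).
Proof. exists 0%nat, (length p); intros n; rewrite pcat_shift; reflexivity. Qed.

Lemma pcat_ray p r v : is_ray T r -> is_path T p v (talpha T (r 0%nat)) ->
  reduced T (p ++ r 0%nat :: nil) ->
  is_ray T (pcat p r) /\ talpha T (pcat p r 0%nat) = v.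
Proof.
  intros H; revert v; induction p as [|e p IH]; intros v H1 H2.
  - split; [exact H|auto].
  - destruct H1 as [<- H1]; simpl app in H2; apply reduced_cons in H2.
    destruct H2 as [H2 H3]; destruct (IH _ H1 H2) as [H4 H5].
    split; [|reflexivity]; intros [|n]; simpl; [|apply H4].
    split; [exact H5|]; destruct p as [|f p]; simpl; exact (H3 _ _ eq_refl).
Qed.

(** If the reduced path from [v] to the ray ends by running back along the current edge of the ray,
    that last edge is dropped and the target moves one step forward; the length of the path
    decreases, so this stops. The bound [N] lets the meeting point be chosen where the ray is known
    to lie beyond an edge. *)
Lemma ray_approach r v N : is_ray T r -> exists n p, (N <= n)%nat /\
  is_path T p v (talpha T (r n)) /\ reduced T (p ++ r n :: nil).
Proof.
  intros H; destruct (tree_path v (talpha T (r N))) as [p [H1 H2]].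
  remember (length p) as k eqn:Hk; revert N p H1 H2 Hk.
  induction k as [|k IH]; intros N p H1 H2 Hk.
  - destruct p; [|discriminate]; exists N, nil; simpl; auto.
  - destruct (classic (exists p', p = p' ++ trev T (r N) :: nil)) as [[p' ->]|Hp].
    + apply is_path_app in H1; destruct H1 as [w [H1 [<- _]]].
      apply reduced_app_inv in H2; destruct H2 as [H2 _].
      rewrite length_app in Hk; simpl in Hk.
      destruct (IH (S N) p') as [n [q [Hn Hq]]]; auto; [|lia|].
      * rewrite (proj1 (H N)); exact H1.
      * exists n, q; split; [lia|exact Hq].
    + exists N, p; repeat split; auto; apply reduced_snoc; [exact H2|].
      intros p' f Hpf He; apply Hp; exists p'; rewrite He, trev_inv; exact Hpf.
Qed.

Lemma ray_from r v : is_ray T r ->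
  exists r', is_ray T r' /\ tail_eq r r' /\ talpha T (r' 0%nat) = v.
Proof.
  intros H; destruct (ray_approach r v 0 H) as [n [p [_ [H1 H2]]]].
  destruct (pcat_ray p (shift n r) v) as [H3 H4].
  - apply is_ray_shift; exact H.
  - unfold shift; rewrite Nat.add_0_r; exact H1.
  - unfold shift; rewrite Nat.add_0_r; exact H2.
  - exists (pcat p (shift n r)); repeat split; try apply H3; auto.
    apply tail_eq_trans with (shift n r); [apply tail_eq_sym, tail_eq_shift|apply pcat_tail].
Qed.

Lemma ray_on_side r e N : is_ray T r -> (forall n, (N <= n)%nat -> side T e (talpha T (r n))) ->
  exists r', is_ray T r' /\ tail_eq r r' /\ r' 0%nat = e.
Proof.
  intros H Hs; destruct (ray_approach r (talpha T e) N H) as [n [p [Hn [H1 H2]]]].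
  destruct (path_side_eq e p _ H1) as [p' ->].
  - apply reduced_app_inv in H2; apply H2.
  - apply Hs; exact Hn.
  - destruct (pcat_ray (e :: p') (shift n r) (talpha T e)) as [H3 H4].
    + apply is_ray_shift; exact H.
    + unfold shift; rewrite Nat.add_0_r; exact H1.
    + unfold shift; rewrite Nat.add_0_r; exact H2.
    + exists (pcat (e :: p') (shift n r)); repeat split; try apply H3; auto.
      apply tail_eq_trans with (shift n r); [apply tail_eq_sym, tail_eq_shift|apply pcat_tail].
Qed.

Lemma ray_exit_unique (F : TV T -> Prop) r r' : is_subtree T F ->
  is_ray T r -> is_ray T r' -> tail_eq r r' ->
  outedge T F (r 0%nat) -> outedge T F (r' 0%nat) -> r 0%nat = r' 0%nat.
Proof.
  intros HF H H' [m [k E]] H0 H0'.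
  apply (exit_unique F _ _ (talpha T (r (1 + m)%nat)) HF H0 H0').
  - apply (ray_side r 0 m H).
  - replace (r (1 + m)%nat) with (r' (1 + k)%nat); [apply (ray_side r' 0 k H')|].
    specialize (E 1%nat); rewrite Nat.add_comm, <- E; f_equal; lia.
Qed.

Lemma ray_start_unique r r' : is_ray T r -> is_ray T r' -> tail_eq r r' ->
  talpha T (r 0%nat) = talpha T (r' 0%nat) -> forall n, r n = r' n.
Proof.
  intros H H' [m [k E]] E0 n.
  (* Both segments are reduced paths with the same ends; the summand [S n] ensures that each
     contains position [n]. *)
  assert (HS : map r (seq 0 (m + S n)) = map r' (seq 0 (k + S n))).
  { apply (tree_unique _ _ (talpha T (r 0%nat)) (talpha T (r (m + S n)%nat)));
      try (apply ray_seg_reduced; assumption).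
    - apply (ray_seg r 0 (m + S n) H).
    - rewrite E0, E; apply (ray_seg r' 0 (k + S n) H'). }
  assert (HL := f_equal (@length _) HS); rewrite !length_map, !length_seq in HL.
  assert (HN := f_equal (fun l => nth_error l n) HS); simpl in HN.
  rewrite !nth_error_map, !nth_error_seq in HN.
  replace (Nat.ltb n (m + S n)) with true in HN by (symmetry; apply Nat.ltb_lt; lia).
  replace (Nat.ltb n (k + S n)) with true in HN by (symmetry; apply Nat.ltb_lt; lia).
  simpl in HN; congruence.
Qed.

(** Between two common edges that occur in the same order on both rays, uniqueness of reduced paths
    makes the rays agree; as common edges recur, they agree from the first one on. *)
Lemma rays_common_edges r r' : is_ray T r -> is_ray T r' ->
  (forall N, exists m k, (N <= m)%nat /\ r m = r' k) -> tail_eq r r'.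
Proof.
  intros H H' Hc; destruct (Hc 0%nat) as [m [k [_ E]]]; exists m, k.
  intros n; destruct (Hc (m + S n)%nat) as [m' [k' [Hm E']]].
  assert (Hk : (k < k')%nat).
  { destruct (Nat.lt_ge_cases k k') as [Hk|Hk]; [exact Hk|exfalso].
    destruct (pcat_ray (map r' (seq k' (k - k'))) (shift m r) (talpha T (r' k'))) as [H1 H2].
    - apply is_ray_shift; exact H.
    - unfold shift; rewrite Nat.add_0_r, E; pose proof (ray_seg r' k' (k - k') H') as Hs.
      replace (k' + (k - k'))%nat with k in Hs by lia; exact Hs.
    - unfold shift; rewrite Nat.add_0_r, E.
      replace (r' k) with (r' (k' + (k - k'))%nat) by (f_equal; lia).
      pose proof (ray_seg_reduced r' k' (S (k - k')) H') as Hs.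
      rewrite seq_S, map_app in Hs; exact Hs.
    - assert (E2 : pcat (map r' (seq k' (k - k'))) (shift m r) ((k - k') + (m' - m)) = r m').
      { pose proof (pcat_shift (map r' (seq k' (k - k'))) (shift m r) (m' - m)) as Hs.
        rewrite length_map, length_seq in Hs; rewrite Hs; unfold shift; f_equal; lia. }
      assert (E3 : ((k - k') + (m' - m))%nat = 0%nat).
      { apply (ray_inj _ _ _ H1); rewrite E2, H2, E'; reflexivity. }
      lia. }
  assert (HS : map r (seq m (m' - m)) = map r' (seq k (k' - k))).
  { apply (tree_unique _ _ (talpha T (r m)) (talpha T (r m')));
      try (apply ray_seg_reduced; assumption).
    - pose proof (ray_seg r m (m' - m) H) as Hs.
      replace (m + (m' - m))%nat with m' in Hs by lia; exact Hs.
    - pose proof (ray_seg r' k (k' - k) H') as Hs.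
      replace (k + (k' - k))%nat with k' in Hs by lia; rewrite E, E'; exact Hs. }
  assert (HL := f_equal (@length _) HS); rewrite !length_map, !length_seq in HL.
  assert (HN := f_equal (fun l => nth_error l n) HS); simpl in HN.
  rewrite !nth_error_map, !nth_error_seq in HN.
  replace (Nat.ltb n (m' - m)) with true in HN by (symmetry; apply Nat.ltb_lt; lia).
  replace (Nat.ltb n (k' - k)) with true in HN by (symmetry; apply Nat.ltb_lt; lia).
  simpl in HN; congruence.
Qed.

End Tree.

(** * The limit of a tree system *)

Definition endof (T : TS) (r : nat -> TO T) (H : is_ray T r) : limT T :=
  inr (exist _ (endcls T r) (ex_intro _ r (conj H eq_refl))).

(* [q] lies beyond the edge [e]; for a point of [Sigma_e] this holds for both
   [e] and its reverse *)
Definition qside (T : TS) (e : TO T) (q : limT T) : Prop :=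
  match q with
  | inl C => exists x, proj1_sig C x /\ side T e (projT1 x)
  | inr E => exists r, proj1_sig E r /\ r 0%nat = e
  end.

Section Lim.
Context (T : TS) (HS : is_tree_system T).

Lemma ts_tree : is_tree T.
Proof. apply HS. Qed.

Lemma ts_compact t : compact_set (topn T t) (fun _ => True).
Proof. apply HS. Qed.

Lemma ts_metric t : exists d : TK T t -> TK T t -> R, is_metric d /\
  (forall U, topn T t U <-> metric_open d U) /\
  null_family d (fun e => talpha T e = t) (fun e k => tSig T e (existT _ t k)).
Proof. apply HS. Qed.

Lemma ts_topology t : topology (topn T t).
Proof. destruct (ts_metric t) as [d [_ [H _]]]; exact (metric_topology _ d H). Qed.

Lemma sig_vertex e x : tSig T e x -> projT1 x = talpha T e.
Proof. apply HS. Qed.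

Lemma sig_nonempty e : exists x, tSig T e x.
Proof. apply HS. Qed.

Lemma sig_compact e : compact_set (topn T (talpha T e)) (fun k => tSig T e (existT _ _ k)).
Proof. apply HS. Qed.

Lemma phi_sig e x y : tphi T e x y -> tSig T e x /\ tSig T (trev T e) y.
Proof. apply HS. Qed.

Lemma phi_total e x : tSig T e x -> exists y, tphi T e x y.
Proof. apply HS. Qed.

Lemma phi_fun e x y y' : tphi T e x y -> tphi T e x y' -> y = y'.
Proof. apply HS. Qed.

Lemma phi_rev e x y : tphi T (trev T e) y x <-> tphi T e x y.
Proof. apply HS. Qed.

Lemma phi_cont e W : tot_open T W -> exists W', tot_open T W' /\
  forall x y, tphi T e x y -> (W y <-> W' x).
Proof. apply HS. Qed.

Lemma sig_edge e e' x : tSig T e x -> tSig T e' x -> e = e'.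
Proof.
  intros H H'; apply NNPP; intros Hne.
  destruct HS as [_ [_ [_ [_ [_ [_ [_ [_ [_ [_ D]]]]]]]]]]; exact (D e e' x Hne H H').
Qed.

Lemma phi_vertices e x y : tphi T e x y -> projT1 x = talpha T e /\ projT1 y = omega T e.
Proof. intros H; apply phi_sig in H; split; apply sig_vertex; apply H. Qed.

(** Transitivity rests on the disjointness of the [Sigma_e]: two consecutive gluings at a point use
    an edge and its reverse, so the second undoes the first. *)
Lemma cls_iff x y : cls T x y <-> x = y \/ exists e, tphi T e x y.
Proof.
  split.
  - intros H; induction H as [x y H|x|x y _ IH|x y z _ IH1 _ IH2].
    + right; exact H.
    + left; reflexivity.
    + destruct IH as [->|[e He]]; [left; reflexivity|right].
      exists (trev T e); apply phi_rev; exact He.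
    + destruct IH1 as [->|[e He]]; [exact IH2|].
      destruct IH2 as [<-|[e' He']]; [right; exists e; exact He|left].
      assert (E : trev T e = e') by
        (apply (sig_edge _ _ y); [apply (phi_sig e x y He)|apply (phi_sig e' y z He')]).
      subst e'; apply (phi_fun (trev T e) y); [apply phi_rev; exact He|exact He'].
  - intros [->|[e He]]; [apply rst_refl|apply rst_step; exists e; exact He].
Qed.

Lemma ptof_eq x y : ptof T x = ptof T y <-> x = y \/ exists e, tphi T e x y.
Proof.
  rewrite <- cls_iff; split.
  - intros H; assert (E : cls T x = cls T y) by (injection H; auto).
    rewrite E; apply rst_refl.
  - intros H; unfold ptof; f_equal; apply sig_eq; simpl; apply set_ext; intros z.
    unfold cls in *; split; intros Hz; eapply rst_trans; [apply rst_sym; exact H|exact Hz|exact H|exact Hz].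
Qed.

Lemma ptof_mem (C : Pts T) x : proj1_sig C x <-> inl C = ptof T x.
Proof.
  destruct C as [C [y ->]]; simpl; split.
  - intros H; transitivity (ptof T y); [unfold ptof; f_equal; apply sig_eq; reflexivity|].
    apply ptof_eq, cls_iff; exact H.
  - intros H; apply cls_iff, ptof_eq; rewrite <- H; unfold ptof; f_equal; apply sig_eq; reflexivity.
Qed.

Lemma ptof_mem_self x : exists C, ptof T x = inl C /\ proj1_sig C x.
Proof. eexists; split; [reflexivity|apply rst_refl]. Qed.

Lemma endof_mem (E : Ends T) r (H : is_ray T r) : proj1_sig E r <-> inr E = endof T r H.
Proof.
  destruct E as [E [s [Hs ->]]]; simpl; split.
  - intros [_ Hr]; unfold endof; f_equal; apply sig_eq; simpl; apply set_ext; intros z.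
    split; intros [Hz Ez]; (split; [exact Hz|]); eapply tail_eq_trans; try exact Ez.
    + apply tail_eq_sym; exact Hr.
    + exact Hr.
  - intros E; assert (E' : endcls T s = endcls T r) by (injection E; auto).
    rewrite E'; split; [exact H|apply tail_eq_refl].
Qed.

Lemma end_is_ray (E : Ends T) r : proj1_sig E r -> is_ray T r.
Proof. destruct E as [E [s [Hs ->]]]; intros [H _]; exact H. Qed.

Lemma endof_eq r r' H H' : endof T r H = endof T r' H' <-> tail_eq r r'.
Proof.
  unfold endof at 1; rewrite <- endof_mem; simpl; split; [intros [_ E]; exact E|].
  intros E; split; auto.
Qed.

Lemma lim_cases (q : limT T) : (exists x, q = ptof T x) \/ exists r H, q = endof T r H.
Proof.
  destruct q as [C|E].
  - left; destruct C as [C [x ->]]; exists x; unfold ptof; f_equal; apply sig_eq; reflexivity.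
  - right; destruct E as [E [r [H ->]]]; exists r, H; unfold endof; f_equal; apply sig_eq; reflexivity.
Qed.

Lemma qside_pt e x : side T e (projT1 x) -> qside T e (ptof T x).
Proof. intros H; exists x; split; [apply rst_refl|exact H]. Qed.

Lemma qside_pt_inv e q x : q = ptof T x -> qside T e q ->
  exists y, q = ptof T y /\ side T e (projT1 y).
Proof.
  intros -> [y [H1 H2]]; exists y; split; [|exact H2].
  apply ptof_eq, cls_iff; exact H1.
Qed.

Lemma qside_end e r (H : is_ray T r) : qside T e (endof T r H) <->
  exists r', is_ray T r' /\ tail_eq r r' /\ r' 0%nat = e.
Proof.
  simpl; split.
  - intros [r' [[H1 H2] H3]]; exists r'; auto.
  - intros [r' [H1 [H2 H3]]]; exists r'; split; [split|]; auto.
Qed.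

Lemma qside_Sigma e x : tSig T e x -> qside T e (ptof T x).
Proof.
  intros H; destruct (phi_total e x H) as [y Hy].
  replace (ptof T x) with (ptof T y) by (symmetry; apply ptof_eq; right; exists e; exact Hy).
  apply qside_pt; rewrite (proj2 (phi_vertices e x y Hy)); apply side_omega.
Qed.

(** For an end, a representing ray that starts with [e] stays beyond [e'], and can therefore be
    replaced by one that starts with [e']. *)
Lemma qside_mono e e' q : (forall t, side T e t -> side T e' t) ->
  qside T e q -> qside T e' q.
Proof.
  intros H Hq; destruct (lim_cases q) as [[x ->]|[r [Hr ->]]].
  - destruct (qside_pt_inv e _ x eq_refl Hq) as [y [-> Hy]]; apply qside_pt; auto.
  - apply qside_end in Hq; destruct Hq as [r' [H1 [H2 H3]]]; apply qside_end.
    destruct (ray_on_side T ts_tree r' e' 1 H1) as [r'' [H4 [H5 H6]]].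
    + intros [|n] Hn; [lia|]; apply H; rewrite <- H3.
      apply (ray_side T r' 0 n H1).
    + exists r''; repeat split; auto; [apply H4|apply H4|].
      eapply tail_eq_trans; [exact H2|exact H5].
Qed.

(** This dichotomy makes basic sets computable: over [F] the set [G(U)] is [U], and beyond an exit
    edge [e] it is decided by whether [Sigma_e] lies in [U]. *)
Lemma qside_cases (F : TV T -> Prop) q : fin_subtree T F ->
  (exists x, F (projT1 x) /\ q = ptof T x) \/ exists e, outedge T F e /\ qside T e q.
Proof.
  intros HF; destruct (lim_cases q) as [[x ->]|[r [Hr ->]]].
  - destruct (classic (F (projT1 x))) as [Fx|Fx]; [left; exists x; auto|right].
    destruct (exit_exists T ts_tree F _ (proj1 HF) Fx) as [e [H1 H2]].
    exists e; split; [exact H1|apply qside_pt; exact H2].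
  - right; pose proof HF as [[[v Fv] _] _].
    destruct (ray_from T ts_tree r v Hr) as [r' [H1 [H2 H3]]].
    destruct (ray_exit T ts_tree F r' HF H1) as [n Hn]; [rewrite H3; exact Fv|].
    exists (r' n); split; [exact Hn|]; apply qside_end; exists (shift n r').
    split; [apply is_ray_shift; exact H1|]; split.
    + eapply tail_eq_trans; [exact H2|apply tail_eq_sym, tail_eq_shift].
    + unfold shift; rewrite Nat.add_0_r; reflexivity.
Qed.

(** [Gset] asks for some representative of the class, so the condition must be invariant under
    gluing along an edge [e]. With both ends of [e] in [F] this is the compatibility of [U], with
    one end it is saturation, and with none both points lie beyond the same exit. *)
Lemma Gset_pt F U x : is_subtree T F -> sat_open T F U ->
  (Gset T F U (ptof T x) <->
    U x \/ exists e, exits T F U e /\ side T e (projT1 x)).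
Proof.
  intros HF [HU1 [HU2 [_ HU4]]].
  assert (L : forall y, (U y \/ exists e, exits T F U e /\ beyond T F e (projT1 y)) <->
    (U y \/ exists e, exits T F U e /\ side T e (projT1 y))).
  { intros y; split; (intros [H|[e [H1 H2]]]; [left; exact H|right; exists e; split; [exact H1|]]);
      apply (beyond_side T ts_tree F e (projT1 y) HF); auto;
      destruct H1 as [H1 [H1' _]]; split; auto. }
  assert (G : forall y z e, tphi T e y z ->
    (U y \/ exists e, exits T F U e /\ side T e (projT1 y)) ->
    (U z \/ exists e, exits T F U e /\ side T e (projT1 z))).
  { intros y z e He Hy; pose proof (phi_vertices e y z He) as [Ey Ez].
    pose proof (phi_sig e y z He) as [Sy Sz].
    destruct (classic (F (talpha T e))) as [Fa|Fa]; destruct (classic (F (omega T e))) as [Fo|Fo].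
    - destruct Hy as [Hy|[f [Hf Hs]]]; [left; apply (HU2 e y z); auto|].
      destruct (subtree_not_side T ts_tree F f (projT1 y) HF); auto.
      + destruct Hf as [? [? _]]; split; auto.
      + rewrite Ey; exact Fa.
    - right; exists e; split; [|rewrite Ez; apply side_omega].
      split; [exact Fa|split; [exact Fo|]].
      destruct Hy as [Hy|[f [Hf Hs]]].
      + destruct (HU4 e Fa Fo) as [H|H]; [exact H|]; destruct (H y Sy Hy).
      + destruct (subtree_not_side T ts_tree F f (projT1 y) HF); auto.
        * destruct Hf as [? [? _]]; split; auto.
        * rewrite Ey; exact Fa.
    - left; destruct Hy as [Hy|[f [Hf Hs]]]; [apply HU1 in Hy; congruence|].
      (* Here [e] enters [F]. An exit leading to the tail of [e] must be the reverse of [e], since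
         any other would lead to its head as well, which is in [F]. *)
      assert (f = trev T e).
      { apply NNPP; intros Hne; apply (subtree_not_side T ts_tree F f (omega T e) HF); auto.
        - destruct Hf as [? [? _]]; split; auto.
        - apply side_step; [ | |rewrite <- Ey; exact Hs].
          + intros ->; apply Fa; apply Hf.
          + intros Hee; apply Hne; rewrite Hee, trev_inv; reflexivity. }
      subst f; apply Hf; exact Sz.
    - right; destruct Hy as [Hy|[f [Hf Hs]]]; [apply HU1 in Hy; congruence|].
      exists f; split; [exact Hf|]; rewrite Ez; apply side_step; [ | |congruence].
      + intros ->; apply Fa, Hf.
      + intros ->; apply Fo; rewrite omega_rev; apply Hf. }
  split.
  - intros [y [Hy Hxy]]; simpl in Hy; apply cls_iff in Hy; apply L in Hxy.
    destruct Hy as [<-|[e He]]; [exact Hxy|].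
    apply (G y x (trev T e)); [apply phi_rev; exact He|exact Hxy].
  - intros H; exists x; split; [apply rst_refl|apply L; exact H].
Qed.

Lemma Gset_pt_in F U x : is_subtree T F -> sat_open T F U -> F (projT1 x) ->
  (Gset T F U (ptof T x) <-> U x).
Proof.
  intros HF HU Fx; rewrite (Gset_pt F U x HF HU); split; [|auto].
  intros [H|[e [H1 H2]]]; [exact H|].
  destruct (subtree_not_side T ts_tree F e (projT1 x) HF); auto.
  destruct H1 as [? [? _]]; split; auto.
Qed.

Lemma Gset_qside F U e q : is_subtree T F -> sat_open T F U -> outedge T F e ->
  qside T e q -> (Gset T F U q <-> forall x, tSig T e x -> U x).
Proof.
  intros HF HU He Hq; destruct (lim_cases q) as [[x ->]|[r [Hr ->]]].
  - destruct (qside_pt_inv e _ x eq_refl Hq) as [y [-> Hy]]; rewrite (Gset_pt F U y HF HU).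
    split.
    + intros [Uy|[f [[F1 [F2 F3]] F4]]].
      * apply HU in Uy; destruct (subtree_not_side T ts_tree F e _ HF He Uy Hy).
      * rewrite (exit_unique T ts_tree F e f (projT1 y) HF); auto; split; auto.
    + intros H; right; exists e; destruct He; repeat split; auto.
  - apply qside_end in Hq; destruct Hq as [r' [H1 [H2 H3]]]; split.
    + intros [r'' [[H4 H5] [H6 [H7 H8]]]].
      rewrite <- H3, (ray_exit_unique T ts_tree F r' r'' HF H1 H4); auto.
      * eapply tail_eq_trans; [apply tail_eq_sym; exact H2|exact H5].
      * rewrite H3; exact He.
      * split; auto.
    + intros H; exists r'; split; [split; auto|]; rewrite H3; destruct He; repeat split; auto.
Qed.

(** The edge [e] may be far from [F]; everything beyond it then lies beyond the single exit of [F]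
    towards its tail. If the tail is in [F], [e] is itself an exit. *)
Lemma Gset_side_const F U e q q' : fin_subtree T F -> sat_open T F U ->
  (forall v, F v -> ~ side T e v) -> qside T e q -> qside T e q' ->
  Gset T F U q -> Gset T F U q'.
Proof.
  intros HF HU He Hq Hq'.
  assert (K : exists e0, outedge T F e0 /\ qside T e0 q /\ qside T e0 q').
  { destruct (classic (F (talpha T e))) as [Fe|Fe].
    - exists e; repeat split; auto; intros Fo; apply (He _ Fo), side_omega.
    - destruct (exit_exists T ts_tree F _ (proj1 HF) Fe) as [e0 [H1 H2]].
      exists e0; split; [exact H1|].
      split; apply (qside_mono e); auto; intros t;
        apply (side_nested T F); auto. }
  destruct K as [e0 [H1 [H2 H3]]].
  rewrite (Gset_qside F U e0 q), (Gset_qside F U e0 q'); auto; apply HF.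
Qed.

Lemma Gset_vertex_const F U t x y : fin_subtree T F -> sat_open T F U -> ~ F t ->
  projT1 x = t -> projT1 y = t -> Gset T F U (ptof T x) -> Gset T F U (ptof T y).
Proof.
  intros HF HU Ft Hx Hy.
  destruct (exit_exists T ts_tree F t (proj1 HF) Ft) as [e [H1 H2]].
  rewrite (Gset_qside F U e (ptof T x)), (Gset_qside F U e (ptof T y)); auto;
    try apply HF; apply qside_pt; congruence.
Qed.

Lemma tot_open_const (P : Prop) t : topn T t (fun _ => P).
Proof.
  destruct (classic P) as [HP|HP].
  - apply (op_ext _ (fun _ => True)); [tauto|exact (proj1 (ts_topology t))].
  - apply (op_ext _ (fun _ => False)); [tauto|apply op_empty, ts_topology].
Qed.

Lemma Gset_fiber_open F U t : fin_subtree T F -> sat_open T F U ->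
  topn T t (fun k => Gset T F U (ptof T (existT _ t k))).
Proof.
  intros HF HU; destruct (classic (F t)) as [Ft|Ft].
  - apply (op_ext _ (fun k => U (existT _ t k))); [|apply HU; exact Ft].
    intros k; symmetry; apply Gset_pt_in; auto; apply HF.
  - apply (op_ext _ (fun _ => exists k, Gset T F U (ptof T (existT _ t k))));
      [|apply tot_open_const].
    intros k; split; [|intros H; exists k; exact H].
    intros [k' H]; revert H; apply (Gset_vertex_const F U t); auto.
Qed.

Lemma Gset_Sigma F U e : fin_subtree T F -> sat_open T F U -> ~ F (omega T e) ->
  (forall x, tSig T e x -> Gset T F U (ptof T x)) \/
  (forall x, tSig T e x -> ~ Gset T F U (ptof T x)).
Proof.
  intros HF HU Fo; destruct (classic (F (talpha T e))) as [Fa|Fa].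
  - pose proof HU as [_ [_ [_ H]]]; destruct (H e Fa Fo) as [H'|H']; [left|right];
      intros x Hx; rewrite Gset_pt_in; auto; try apply HF; rewrite (sig_vertex e x Hx); auto.
  - destruct (classic (exists x, tSig T e x /\ Gset T F U (ptof T x))) as [[x [Hx Gx]]|H].
    + left; intros y Hy; revert Gx; apply (Gset_vertex_const F U (talpha T e)); auto;
        apply sig_vertex; auto.
    + right; intros x Hx Gx; apply H; exists x; auto.
Qed.

(** The trace of [G(U)] over a larger subtree [F']. It defines the same basic set, so two basic sets
    can be written over a common subtree. *)
Definition refine (F : TV T -> Prop) (U : tot T -> Prop) (F' : TV T -> Prop) (x : tot T) : Prop :=
  F' (projT1 x) /\ Gset T F U (ptof T x).

Lemma refine_sat F U F' : fin_subtree T F -> sat_open T F U -> (forall v, F v -> F' v) ->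
  sat_open T F' (refine F U F').
Proof.
  intros HF HU HFF; split; [|split; [|split]].
  - intros x [H _]; exact H.
  - intros e x y Fa Fo He; unfold refine; pose proof (phi_vertices e x y He) as [-> ->].
    replace (ptof T x) with (ptof T y) by (symmetry; apply ptof_eq; right; exists e; exact He).
    tauto.
  - intros t Ft; apply (op_ext _ (fun k => Gset T F U (ptof T (existT _ t k)))).
    + intros k; unfold refine; simpl; tauto.
    + apply Gset_fiber_open; auto.
  - intros e Fa Fo; destruct (Gset_Sigma F U e HF HU) as [H|H]; [auto|left|right]; intros x Hx.
    + split; [rewrite (sig_vertex e x Hx); exact Fa|auto].
    + intros [_ Hx']; exact (H x Hx Hx').
Qed.

Lemma Gset_refine F U F' q : fin_subtree T F -> sat_open T F U -> fin_subtree T F' ->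
  (forall v, F v -> F' v) -> (Gset T F' (refine F U F') q <-> Gset T F U q).
Proof.
  intros HF HU HF' HFF; pose proof (refine_sat F U F' HF HU HFF) as HR.
  destruct (qside_cases F' q HF') as [[x [Fx ->]]|[e [He Hq]]].
  - rewrite (Gset_pt_in F' _ x (proj1 HF') HR Fx); unfold refine; tauto.
  - rewrite (Gset_qside F' _ e q (proj1 HF') HR He Hq).
    assert (Hn : forall v, F v -> ~ side T e v).
    { intros v Fv; apply (subtree_not_side T ts_tree F'); auto; apply HF'. }
    split.
    + intros H; destruct (sig_nonempty e) as [x Hx]; destruct (H x Hx) as [_ Gx].
      revert Gx; apply (Gset_side_const F U e); auto; apply qside_Sigma; auto.
    + intros Gq x Hx; split; [rewrite (sig_vertex e x Hx); apply He|].
      revert Gq; apply (Gset_side_const F U e); auto; apply qside_Sigma; auto.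
Qed.

Lemma Gset_open F U : fin_subtree T F -> sat_open T F U -> lim_open T (Gset T F U).
Proof. intros HF HU q Hq; exists F, U; auto. Qed.

Lemma lim_topology : topology (lim_open T).
Proof.
  split; [|split].
  - intros q _.
    (* A finite subtree is nonempty; the point [q] provides a vertex for it. *)
    assert (Hv : exists v : TV T, True).
    { destruct (lim_cases q) as [[x _]|[r _]]; [exists (projT1 x)|exists (talpha T (r 0%nat))]; exact I. }
    destruct Hv as [v _]; pose proof (fin_subtree_point T v) as HF.
    assert (HU : sat_open T (fun u => u = v) (fun x => projT1 x = v)).
    { split; [auto|split; [|split]].
      - intros e x y Fa Fo He; pose proof (phi_vertices e x y He) as [-> ->]; tauto.
      - intros t ->; exact (tot_open_const (v = v) v).
      - intros e Fa Fo; left; intros x Hx; rewrite (sig_vertex e x Hx); exact Fa. }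
    exists (fun u => u = v), (fun x => projT1 x = v).
    split; [exact HF|]; split; [exact HU|]; split; [|auto].
    destruct (qside_cases _ q HF) as [[x [Fx ->]]|[e [He Hq]]].
    + apply Gset_pt_in; auto; apply HF.
    + apply (Gset_qside _ _ e); auto; [apply HF|].
      intros x Hx; rewrite (sig_vertex e x Hx); apply He.
  - intros V W HV HW q [Vq Wq].
    destruct (HV q Vq) as [F1 [U1 [HF1 [HU1 [G1 S1]]]]].
    destruct (HW q Wq) as [F2 [U2 [HF2 [HU2 [G2 S2]]]]].
    (* Over a common subtree, intersecting the saturated sets intersects the basic sets: beyond an
       exit, [Sigma_e] lies in the intersection exactly when it lies in both. *)
    destruct (fin_subtree_union T ts_tree F1 F2 HF1 HF2) as [F [HF [I1 I2]]].
    assert (R1 := refine_sat F1 U1 F HF1 HU1 I1); assert (R2 := refine_sat F2 U2 F HF2 HU2 I2).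
    set (U := fun x => refine F1 U1 F x /\ refine F2 U2 F x).
    assert (HU : sat_open T F U).
    { destruct R1 as [A1 [B1 [C1 E1]]]; destruct R2 as [A2 [B2 [C2 E2]]].
      split; [|split; [|split]].
      - intros x [Hx _]; auto.
      - intros e x y Fa Fo He; unfold U; rewrite (B1 e x y), (B2 e x y); auto; tauto.
      - intros t Ft; apply (proj1 (proj2 (ts_topology t))); auto.
      - intros e Fa Fo; destruct (E1 e Fa Fo) as [H1|H1];
          [|right; intros x Hx [Ux _]; exact (H1 x Hx Ux)].
        destruct (E2 e Fa Fo) as [H2|H2]; [|right; intros x Hx [_ Ux]; exact (H2 x Hx Ux)].
        left; intros x Hx; split; auto. }
    assert (HG : forall q, Gset T F U q <-> Gset T F1 U1 q /\ Gset T F2 U2 q).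
    { intros q'; rewrite <- (Gset_refine F1 U1 F q'), <- (Gset_refine F2 U2 F q'); auto.
      destruct (qside_cases F q' HF) as [[x [Fx ->]]|[e [He Hq]]].
      - rewrite (Gset_pt_in F U x (proj1 HF) HU Fx), (Gset_pt_in F _ x (proj1 HF) R1 Fx),
          (Gset_pt_in F _ x (proj1 HF) R2 Fx); reflexivity.
      - rewrite (Gset_qside F U e q' (proj1 HF) HU He Hq),
          (Gset_qside F _ e q' (proj1 HF) R1 He Hq), (Gset_qside F _ e q' (proj1 HF) R2 He Hq).
        unfold U; firstorder. }
    exists F, U; split; [exact HF|]; split; [exact HU|]; split; [apply HG; auto|].
    intros q' Hq'; apply HG in Hq'; destruct Hq'; auto.
  - intros U HU q Uq; destruct (HU q Uq) as [V [HV [Vq HVU]]].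
    destruct (HV q Vq) as [F [W [HF [HW [G S]]]]]; exists F, W.
    split; [exact HF|split; [exact HW|split; auto]].
Qed.

Lemma ptof_cont t W : lim_open T W -> topn T t (fun k => W (ptof T (existT _ t k))).
Proof.
  intros HW; apply (proj2 (proj2 (ts_topology t))); intros k Hk; destruct (HW _ Hk) as [F [U [HF [HU [G S]]]]].
  exists (fun k => Gset T F U (ptof T (existT _ t k))); split; [apply Gset_fiber_open; auto|].
  split; [exact G|]; intros k'; apply S.
Qed.

End Lim.

(** * Compactness of the limit and nullity in it *)

Definition fin_cov {X : Type} (W : (X -> Prop) -> Prop) (Z : X -> Prop) : Prop :=
  exists l : list (X -> Prop), (forall U, In U l -> W U) /\
    forall x, Z x -> exists U, In U l /\ U x.

Lemma fin_cov_union {X : Type} W (Y Z : X -> Prop) :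
  fin_cov W Y -> fin_cov W Z -> fin_cov W (fun x => Y x \/ Z x).
Proof.
  intros [l [H1 H2]] [l' [H1' H2']]; exists (l ++ l'); split.
  - intros U HU; apply in_app_or in HU; destruct HU; auto.
  - intros x [Hx|Hx]; [destruct (H2 x Hx) as [U [HU Ux]]|destruct (H2' x Hx) as [U [HU Ux]]];
      exists U; split; auto; apply in_or_app; auto.
Qed.

Lemma fin_cov_subset {X : Type} W (Y Z : X -> Prop) :
  (forall x, Y x -> Z x) -> fin_cov W Z -> fin_cov W Y.
Proof. intros H [l [H1 H2]]; exists l; auto. Qed.

Lemma fin_cov_one {X : Type} (W : (X -> Prop) -> Prop) (U Z : X -> Prop) :
  W U -> (forall x, Z x -> U x) -> fin_cov W Z.
Proof.
  intros HU H; exists (U :: nil); split; [intros V [<-|[]]; exact HU|].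
  intros x Zx; exists U; split; [left; reflexivity|auto].
Qed.

Lemma fin_cov_list {X A : Type} W (l : list A) (Z : A -> X -> Prop) :
  (forall a, In a l -> fin_cov W (Z a)) -> fin_cov W (fun x => exists a, In a l /\ Z a x).
Proof.
  induction l as [|a l IH]; intros H.
  - exists nil; split; [intros U []|intros x [a [[] _]]].
  - apply (fin_cov_subset W _ (fun x => Z a x \/ exists b, In b l /\ Z b x)).
    + intros x [b [[<-|Hb] Hx]]; [left; exact Hx|right; exists b; auto].
    + apply fin_cov_union; [apply H; left; reflexivity|apply IH; intros; apply H; right; auto].
Qed.

Section LimCompact.
Context (T : TS) (HS : is_tree_system T).
Let HT := ts_tree T HS.

(** Each vertex of the list lies beyond at most one edge at [t]. For every edge at [t] outside [le],
    the far side misses the whole list. *)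
Lemma edges_towards t (l : list (TV T)) : exists le, forall v e, In v l ->
  talpha T e = t -> side T e v -> In e le.
Proof.
  induction l as [|v l [le Hle]]; [exists nil; intros v e []|].
  destruct (classic (exists e, talpha T e = t /\ side T e v)) as [[e0 [H1 H2]]|H].
  - exists (e0 :: le); intros w e [<-|Hw] He Hs; [|right; eauto].
    left; apply (exit_unique T HT (fun u => u = t) e0 e v); auto.
    + apply fin_subtree_point.
    + split; [exact H1|]; rewrite <- H1; intros Ho.
      destruct (alpha_ne_omega T HT e0); auto.
    + split; [exact He|]; rewrite <- He; intros Ho.
      destruct (alpha_ne_omega T HT e); auto.
  - exists le; intros w e [<-|Hw] He Hs; [|eauto]; destruct H; exists e; auto.
Qed.

Lemma sig_null_cover t : cover_null (topn T t) (fun e => talpha T e = t)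
  (fun e k => tSig T e (existT _ t k)).
Proof.
  destruct (ts_metric T HS t) as [d [Hd [Ho Hn]]].
  apply (null_cover _ d); auto; [apply (ts_compact T HS)|].
  intros e <-; destruct (sig_nonempty T HS e) as [x Hx]; pose proof (sig_vertex T HS e x Hx) as E.
  destruct x as [t k]; simpl in E; subst t; exists k; exact Hx.
Qed.

(** Finitely many traces of basic sets, each basic set inside a member of [W], cover [K_t]. By
    nullity almost every [Sigma_e] at [t] lies in one of these traces, and for almost every such [e]
    the whole branch beyond [e] then lies in the same basic set. *)
Lemma star_fin_cov (W : (limT T -> Prop) -> Prop) t :
  (forall U, W U -> lim_open T U) -> (forall q, exists U, W U /\ U q) ->
  exists l, fin_cov W (fun q => (exists k, q = ptof T (existT _ t k)) \/
    exists e, talpha T e = t /\ ~ In e l /\ qside T e q).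
Proof.
  intros HWo HWc.
  set (O := fun V : TK T t -> Prop => exists F U Q, fin_subtree T F /\ sat_open T F U /\
    W Q /\ (forall q, Gset T F U q -> Q q) /\ V = fun k => Gset T F U (ptof T (existT _ t k))).
  assert (HO : forall V, O V -> topn T t V).
  { intros V [F [U [Q [HF [HU [_ [_ ->]]]]]]]; apply Gset_fiber_open; auto. }
  destruct (ts_compact T HS t O HO) as [lV [HlV Hcov]].
  { intros k _; destruct (HWc (ptof T (existT _ t k))) as [Q [HQ Qk]].
    destruct (HWo Q HQ _ Qk) as [F [U [HF [HU [G S]]]]].
    exists (fun k => Gset T F U (ptof T (existT _ t k))); split; [|exact G].
    exists F, U, Q; split; [exact HF|split; [exact HU|split; [exact HQ|split; [exact S|reflexivity]]]]. }
  destruct (sig_null_cover t (fun V => In V lV)) as [l0 Hl0].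
  { intros V HV; apply HO, HlV, HV. }
  { intros k; apply Hcov; exact I. }
  (* The list [l] collects the edges at [t] that point into the finite subtrees of the chosen basic
     sets; beyond any other edge these sets are constant. [Lw] collects the members of [W]
     containing them. *)
  assert (HL : forall lV, (forall V, In V lV -> O V) -> exists l Lw, (forall Q, In Q Lw -> W Q) /\
    forall V, In V lV -> (forall k, V k -> exists Q, In Q Lw /\ Q (ptof T (existT _ t k))) /\
      forall e, talpha T e = t -> ~ In e l -> (forall k, tSig T e (existT _ t k) -> V k) ->
        exists Q, In Q Lw /\ forall q, qside T e q -> Q q).
  { clear HO lV HlV Hcov l0 Hl0; induction lV as [|V lV IH]; intros HlV.
    - exists nil, nil; split; [intros Q []|intros V []].
    - destruct IH as [l [Lw [H1 H2]]]; [intros V' HV'; apply HlV; right; exact HV'|].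
      destruct (HlV V (or_introl eq_refl)) as [F [U [Q [HF [HU [HQ [S ->]]]]]]].
      pose proof HF as [_ [lF HlF]]; destruct (edges_towards t lF) as [le Hle].
      exists (le ++ l), (Q :: Lw); split; [intros Q' [<-|HQ']; auto|].
      intros V' [<-|HV']; split.
      + intros k Hk; exists Q; split; [left; reflexivity|apply S; exact Hk].
      + intros e He Hel HeV; exists Q; split; [left; reflexivity|]; intros q Hq; apply S.
        destruct (sig_nonempty T HS e) as [x Hx].
        apply (Gset_side_const T HS F U e (ptof T x)); auto.
        * intros v Fv Hs; apply Hel, in_or_app; left; apply (Hle v); auto.
        * apply (qside_Sigma T HS); exact Hx.
        * pose proof (sig_vertex T HS e x Hx) as E; rewrite He in E.
          destruct x as [t' k]; simpl in E; subst t'; apply HeV; exact Hx.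
      + intros k Hk; destruct (H2 V' HV') as [H3 _]; destruct (H3 k Hk) as [Q' [HQ' Qk]].
        exists Q'; split; [right; exact HQ'|exact Qk].
      + intros e He Hel HeV; destruct (H2 V' HV') as [_ H3].
        destruct (H3 e He) as [Q' [HQ' Qk]]; auto.
        * intros Hl; apply Hel, in_or_app; right; exact Hl.
        * exists Q'; split; [right; exact HQ'|exact Qk]. }
  destruct (HL lV HlV) as [l [Lw [H1 H2]]]; exists (l0 ++ l), Lw; split; [exact H1|].
  intros q [[k ->]|[e [He [Hel Hq]]]].
  - destruct (Hcov k I) as [V [HV Vk]]; destruct (H2 V HV) as [H3 _]; auto.
  - destruct (Hl0 e He) as [V [HV HeV]].
    + intros Hl; apply Hel, in_or_app; left; exact Hl.
    + destruct (H2 V HV) as [_ H3]; destruct (H3 e He) as [Q [HQ Qq]]; auto.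
      * intros Hl; apply Hel, in_or_app; right; exact Hl.
      * exists Q; auto.
Qed.

Lemma qside_step e q : qside T e q -> (exists k, q = ptof T (existT _ (omega T e) k)) \/
  exists e', talpha T e' = omega T e /\ e' <> trev T e /\ qside T e' q.
Proof.
  intros Hq; destruct (lim_cases T q) as [[x ->]|[r [Hr ->]]].
  - destruct (qside_pt_inv T HS e _ x eq_refl Hq) as [y [-> Hy]].
    destruct (side_cases T e _ Hy) as [E|[e' [H1 [H2 H3]]]].
    + left; destruct y as [t k]; simpl in E; subst t; exists k; reflexivity.
    + right; exists e'; repeat split; auto; apply qside_pt; exact H3.
  - apply qside_end in Hq; destruct Hq as [r' [H1 [H2 <-]]]; right; exists (r' 1%nat).
    split; [apply H1|]; split; [apply H1|]; apply qside_end; exists (shift 1 r').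
    split; [apply is_ray_shift; exact H1|]; split; [|reflexivity].
    eapply tail_eq_trans; [exact H2|apply tail_eq_sym, tail_eq_shift].
Qed.

Lemma vertex_step v q : (exists k, q = ptof T (existT _ v k)) \/
  exists e, talpha T e = v /\ qside T e q.
Proof.
  destruct (qside_cases T HS (fun u => u = v) q (fin_subtree_point T v))
    as [[[t k] [E ->]]|[e [[He _] Hq]]].
  - left; simpl in E; subst t; exists k; reflexivity.
  - right; exists e; auto.
Qed.

Lemma ray_qside_first r n q : is_ray T r -> qside T (r n) q -> qside T (r 0%nat) q.
Proof.
  intros Hr; induction n as [|n IH]; [auto|]; intros Hq; apply IH.
  apply (qside_mono T HS (r (S n))); [|exact Hq].
  intros t; apply side_cons; apply Hr.
Qed.

(* Otherwise, starting at any vertex and using that all but finitely many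
   branches at a vertex are covered together with it, one builds a ray of
   branches without finite subcover; this contradicts the fact that some member
   of the cover contains the end of that ray, hence a whole branch along it. *)
Lemma lim_compact : compact_set (lim_open T) (fun _ => True).
Proof.
  intros W HWo HWc0.
  assert (HWc : forall q, exists U, W U /\ U q) by (intros q; apply HWc0; exact I).
  change (fin_cov W (fun _ => True)); apply NNPP; intros Hbad.
  assert (Hbr : forall (t : TV T) (cond : TO T -> Prop),
    ~ fin_cov W (fun q => (exists k, q = ptof T (existT _ t k)) \/
      exists e, talpha T e = t /\ cond e /\ qside T e q) ->
    exists e, talpha T e = t /\ cond e /\ ~ fin_cov W (qside T e)).
  { intros t cond H; apply NNPP; intros Hn; apply H.
    destruct (star_fin_cov W t HWo HWc) as [l Hl].
    apply (fin_cov_subset W _ _) with (2 := fin_cov_union W _ _ Hl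
      (fin_cov_list W l (fun e q => talpha T e = t /\ cond e /\ qside T e q) ltac:(
        intros e _; destruct (classic (talpha T e = t /\ cond e)) as [[H1 H2]|H1];
        [apply (fin_cov_subset W _ (qside T e)); [tauto|];
         apply NNPP; intros Hf; apply Hn; exists e; auto
        |exists nil; split; [intros U []|intros q Hq; destruct H1; tauto]]))).
    intros q [Hk|[e [H1 [H2 H3]]]]; [left; left; exact Hk|].
    destruct (classic (In e l)) as [Hel|Hel]; [right; exists e; auto|].
    left; right; exists e; auto. }
  assert (Hv : exists v : TV T, True).
  { apply NNPP; intros Hn; apply Hbad; exists nil; split; [intros U []|].
    intros q _; exfalso; apply Hn.
    destruct (lim_cases T q) as [[x _]|[r _]]; [exists (projT1 x)|exists (talpha T (r 0%nat))]; exact I. }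
  destruct Hv as [v _].
  destruct (Hbr v (fun _ => True)) as [e0 [_ [_ He0]]].
  { intros H; apply Hbad; apply (fin_cov_subset W _ _) with (2 := H).
    intros q _; destruct (vertex_step v q) as [Hk|[e He]]; [left; exact Hk|right; exists e; tauto]. }
  set (Bad := {e : TO T | ~ fin_cov W (qside T e)}).
  destruct (fun_choice (fun e e' : Bad => talpha T (proj1_sig e') = omega T (proj1_sig e) /\
    proj1_sig e' <> trev T (proj1_sig e))) as [next Hnext].
  { intros [e He]; destruct (Hbr (omega T e) (fun e' => e' <> trev T e)) as [e' [H1 [H2 H3]]].
    - intros H; apply He; apply (fin_cov_subset W _ _) with (2 := H).
      intros q; apply qside_step.
    - exists (exist _ e' H3); auto. }
  set (b := fix b n := match n with O => exist _ e0 He0 : Bad | S n => next (b n) end).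
  set (r := fun n => proj1_sig (b n)).
  assert (Hr : is_ray T r) by (intros n; apply (Hnext (b n))).
  destruct (HWc (endof T r Hr)) as [Q [HQ Qr]].
  destruct (HWo Q HQ _ Qr) as [F [U [HF [HU [G S]]]]].
  destruct G as [r' [[H1 [m [k E]]] He]].
  (* The branch beyond [r m] lies beyond [r' k], hence beyond [r' 0], the exit through which the end
     belongs to [G(U)]; so [Q] alone covers it. *)
  apply (proj2_sig (b (m + 0)%nat)); apply (fin_cov_one W Q); [exact HQ|].
  intros q Hq; apply S; change (qside T (r (m + 0)%nat) q) in Hq; rewrite E in Hq.
  apply ray_qside_first in Hq; [|exact H1].
  apply (Gset_qside T HS F U _ q (proj1 HF) HU) in Hq; [apply Hq; apply He|].
  destruct He as [? [? _]]; split; auto.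
Qed.

(** By compactness it suffices to treat the [A j] that meet one basic set [G(U)] lying in a member
    of the cover. If [v j] is outside [F], then [G(U)] contains all of [A j], being constant on that
    vertex space; for the finitely many vertices of [F], nullity there applies. *)
Lemma lim_cover_null {J : Type} (idx : J -> Prop) (v : J -> TV T) (A : J -> tot T -> Prop) :
  (forall j x, idx j -> A j x -> projT1 x = v j) ->
  (forall j, idx j -> exists x, A j x) ->
  (forall t, cover_null (topn T t) (fun j => idx j /\ v j = t) (fun j k => A j (existT _ t k))) ->
  cover_null (lim_open T) idx (fun j q => exists x, A j x /\ q = ptof T x).
Proof.
  intros Hv Hne Hn W HWo HWc.
  destruct (compact_ind _ _ (fun O : limT T -> Prop => exists l : list J, forall j, idx j ->
    (exists x, A j x /\ O (ptof T x)) -> ~ In j l ->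
    exists U, W U /\ forall x, A j x -> U (ptof T x)) lim_compact) as [l Hl].
  - exists nil; intros j _ [x [_ []]].
  - intros O O' [l Hl] [l' Hl']; exists (l ++ l'); intros j Hj [x [Ax Ox]] Hjl.
    rewrite in_app_iff in Hjl.
    destruct Ox as [Ox|Ox]; [apply Hl|apply Hl']; auto; exists x; auto.
  - intros O O' HO [l Hl]; exists l; intros j Hj [x [Ax Ox]]; apply Hl; auto; exists x; auto.
  - intros q _; destruct (HWc q) as [Q [HQ Qq]].
    destruct (HWo Q HQ q Qq) as [F [U [HF [HU [G S]]]]].
    exists (Gset T F U); split; [apply Gset_open; auto|]; split; [exact G|].
    pose proof HF as [_ [lF HlF]].
    assert (HL : exists l : list J, forall j, idx j -> In (v j) lF -> ~ In j l ->
      exists U, W U /\ forall x, A j x -> U (ptof T x)).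
    { clear HlF; induction lF as [|t lF [l Hl]]; [exists nil; intros j _ []|].
      destruct (Hn t (fun V => exists U, W U /\ V = fun k => U (ptof T (existT _ t k)))) as [l' Hl'].
      - intros V [U' [HU' ->]]; apply ptof_cont; auto.
      - intros k; destruct (HWc (ptof T (existT _ t k))) as [U' [HU' Uk]].
        exists (fun k => U' (ptof T (existT _ t k))); split; [exists U'; auto|exact Uk].
      - exists (l' ++ l); intros j Hj Hin Hjl; rewrite in_app_iff in Hjl.
        destruct Hin as [Ht|Hin]; [|apply Hl; auto].
        destruct (Hl' j (conj Hj (eq_sym Ht))) as [V [[U' [HU' ->]] HV]]; [auto|].
        exists U'; split; [exact HU'|]; intros x Ax; pose proof (Hv j x Hj Ax) as E.
        rewrite <- Ht in E; destruct x as [t' k]; simpl in E; subst t'; apply (HV k); exact Ax. }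
    destruct HL as [l Hl]; exists l; intros j Hj [x [Ax Gx]] Hjl.
    destruct (classic (F (v j))) as [Fj|Fj]; [apply Hl; auto|].
    exists Q; split; [exact HQ|]; intros y Ay; apply S; revert Gx.
    apply (Gset_vertex_const T HS F U (v j)); auto.
  - exists l; intros j Hj Hjl.
    destruct (Hl j Hj) as [U [HU HA]]; auto.
    + destruct (Hne j Hj) as [x Ax]; exists x; auto.
    + exists U; split; [exact HU|]; intros q [x [Ax ->]]; auto.
Qed.

End LimCompact.

(** * A countable family of basic sets separating points *)

Lemma compact_singleton {X : Type} (op : (X -> Prop) -> Prop) (a : X) :
  compact_set op (fun x => x = a).
Proof.
  intros F _ Hc; destruct (Hc a eq_refl) as [U [HU Ua]]; exists (U :: nil).
  split; [intros V [<-|[]]; exact HU|].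
  intros x ->; exists U; split; [left; reflexivity|exact Ua].
Qed.

Section LimMetrizable.
Context (T : TS) (HS : is_tree_system T).
Let HT := ts_tree T HS.

(* the largest saturated subset of [W] *)
Definition sat_core (F : TV T -> Prop) (W : tot T -> Prop) (x : tot T) : Prop :=
  F (projT1 x) /\ W x /\
  forall e, outedge T F e -> tSig T e x -> forall y, tSig T e y -> W y.

Lemma sigma_closed t e : talpha T e = t ->
  closed (topn T t) (fun k => tSig T e (existT _ t k)).
Proof.
  intros <-; destruct (ts_metric T HS (talpha T e)) as [d [Hd [Ho _]]].
  apply compact_is_closed; [apply (ts_topology T HS)|apply (metric_hausdorff _ d); auto|].
  apply (sig_compact T HS).
Qed.

(** Around a point [x] of the core take a ball of radius [r] inside [W]. Finitely many [Sigma_e]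
    have diameter at least [r / 2]; those among them that exit [F] and are not inside [W] are
    closed, miss [x] and can be avoided. Any other that meets the ball of radius [r / 2] stays in
    the ball of radius [r]. *)
Lemma sat_core_open F W t : F t -> topn T t (fun k => W (existT _ t k)) ->
  topn T t (fun k => sat_core F W (existT _ t k)).
Proof.
  intros Ft HW; destruct (ts_metric T HS t) as [d [Hd [Ho Hn]]].
  pose proof (ts_topology T HS t) as Ht; apply Ht; intros x [_ [Wx Hx]].
  destruct (proj1 (Ho _) HW x Wx) as [r [Hr Hball]].
  destruct (Hn (r / 2) ltac:(lra)) as [l Hl].
  assert (HN : exists N, topn T t N /\ N x /\ forall k, N k -> forall e, In e l ->
    outedge T F e -> tSig T e (existT _ t k) -> forall y, tSig T e y -> W y).
  { clear Hl; induction l as [|e l [N [ON [Nx HN]]]].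
    - exists (fun _ => True); split; [apply (proj1 Ht)|]; split; [exact I|intros k _ e []].
    - destruct (classic (talpha T e = t /\ outedge T F e /\ ~ forall y, tSig T e y -> W y))
        as [[E [He Hb]]|Hg].
      + exists (fun k => N k /\ ~ tSig T e (existT _ t k)).
        split; [apply (proj1 (proj2 Ht)); [exact ON|apply sigma_closed; exact E]|].
        split; [split; [exact Nx|]; intros Sx; apply Hb; apply Hx; auto|].
        intros k [Nk Sk] f [<-|Hf]; [intros _ Sk'; contradiction|apply HN; auto].
      + exists N; split; [exact ON|]; split; [exact Nx|].
        intros k Nk f [<-|Hf] He Sk; [|apply (HN k Nk f Hf He Sk)].
        apply NNPP; intros Hb; apply Hg; repeat split; try apply He; auto.
        symmetry; exact (sig_vertex T HS _ _ Sk). }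
  destruct HN as [N [ON [Nx HN]]].
  exists (fun k => d x k < r / 2 /\ N k); split; [|split].
  - apply (proj1 (proj2 Ht)); [apply ball_open; auto|exact ON].
  - rewrite metric_refl by exact Hd; split; [lra|exact Nx].
  - intros k [Hk Nk]; split; [exact Ft|]; split; [apply Hball; lra|].
    intros e He Sk y Sy; apply NNPP; intros Wy.
    pose proof (sig_vertex T HS _ _ Sk) as E; simpl in E.
    assert (Hel : In e l).
    { apply Hl; [auto|]; intros delta Hdl.
      pose proof (sig_vertex T HS _ _ Sy) as E'; destruct y as [t' y]; simpl in E'.
      rewrite <- E in E'; subst t'; exists k, y; split; [exact Sk|].
      split; [exact Sy|]; apply Rnot_le_lt; intros Hle; apply Wy, Hball.
      destruct Hd as [_ [_ Htri]]; pose proof (Htri x k y); lra. }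
    exact (Wy (HN k Nk e Hel He Sk y Sy)).
Qed.

Lemma sat_core_sat F W : (forall t, F t -> topn T t (fun k => W (existT _ t k))) ->
  (forall e x y, F (talpha T e) -> F (omega T e) -> tphi T e x y -> (W x <-> W y)) ->
  sat_open T F (sat_core F W).
Proof.
  intros HW1 HW2; split; [|split; [|split]].
  - intros x [H _]; exact H.
  - assert (H : forall e x y, F (talpha T e) -> F (omega T e) -> tphi T e x y ->
      sat_core F W x -> sat_core F W y).
    { intros e x y Fa Fo He [Fx [Wx _]]; split; [|split].
      - rewrite (proj2 (phi_vertices T HS e x y He)); exact Fo.
      - apply (HW2 e x y); auto.
      - intros f Hf Sy; exfalso; apply (proj2 Hf).
        rewrite <- (sig_edge T HS (trev T e) f y); [rewrite omega_rev; exact Fa| |exact Sy].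
        apply (phi_sig T HS e x y He). }
    intros e x y Fa Fo He; split; [apply (H e); auto|].
    apply (H (trev T e)); [exact Fo|rewrite omega_rev; exact Fa|].
    apply (phi_rev T HS); exact He.
  - intros t Ft; apply sat_core_open; auto.
  - intros e Fa Fo; destruct (classic (exists x, tSig T e x /\ sat_core F W x))
      as [[x [Sx [_ [_ Hx]]]]|H].
    + left; intros y Sy; split; [rewrite (sig_vertex T HS e y Sy); exact Fa|].
      split; [apply (Hx e); auto; split; auto|].
      intros f Hf Sy'; rewrite <- (sig_edge T HS e f y Sy Sy'); apply (Hx e); auto; split; auto.
    + right; intros x Sx Hx; apply H; exists x; auto.
Qed.

Lemma Gset_disjoint F U V q : fin_subtree T F -> sat_open T F U -> sat_open T F V ->
  (forall x, U x -> V x -> False) -> Gset T F U q -> Gset T F V q -> False.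
Proof.
  intros HF HU HV D; destruct (qside_cases T HS F q HF) as [[x [Fx ->]]|[e [He Hq]]].
  - rewrite (Gset_pt_in T HS F U x (proj1 HF) HU Fx), (Gset_pt_in T HS F V x (proj1 HF) HV Fx).
    apply D.
  - rewrite (Gset_qside T HS F U e q (proj1 HF) HU He Hq),
      (Gset_qside T HS F V e q (proj1 HF) HV He Hq); intros H1 H2.
    destruct (sig_nonempty T HS e) as [x Hx]; exact (D x (H1 x Hx) (H2 x Hx)).
Qed.

Context (B : forall t, nat -> TK T t -> Prop).
Context (B_open : forall t n, topn T t (B t n)).
Context (B_sep : forall t A C, compact_set (topn T t) A -> compact_set (topn T t) C ->
  (forall x, A x -> C x -> False) -> exists m n, (forall x, A x -> B t m x) /\
    (forall x, C x -> B t n x) /\ forall x, B t m x -> B t n x -> False).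

Definition totB (t : TV T) (n : nat) (x : tot T) : Prop :=
  exists k, x = existT _ t k /\ B t n k.

Lemma totB_iff t n k : totB t n (existT _ t k) <-> B t n k.
Proof.
  split; [|intros H; exists k; auto].
  intros [k' [E H]]; apply inj_pair2 in E; subst; exact H.
Qed.

Lemma totB_vertex t n x : totB t n x -> projT1 x = t.
Proof. intros [k [-> _]]; reflexivity. Qed.

Lemma totB_open t n : tot_open T (totB t n).
Proof.
  intros t'; destruct (classic (t' = t)) as [->|Hne].
  - apply (op_ext _ (B t n)); [intros k; symmetry; apply totB_iff|apply B_open].
  - apply (op_ext _ (fun _ => False)); [|apply op_empty, (ts_topology T HS)].
    intros k; split; [intros []|]; intros H; apply Hne; exact (totB_vertex t n _ H).
Qed.

Lemma totB_disjoint t m n : (forall x, B t m x -> B t n x -> False) ->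
  forall x, totB t m x -> totB t n x -> False.
Proof.
  intros H x [k [-> H1]] H2; apply totB_iff in H2; exact (H k H1 H2).
Qed.

(* a point of [K_v] outside all [Sigma_e], or one of the sets [Sigma_e] *)
Lemma blob_exists v q : exists A, compact_set (topn T v) A /\
  (forall k, A k -> (q = ptof T (existT _ v k) /\ forall e, ~ tSig T e (existT _ v k)) \/
    exists e, talpha T e = v /\ qside T e q /\ tSig T e (existT _ v k)) /\
  (forall U, sat_open T (fun u => u = v) U -> (forall k, A k -> U (existT _ v k)) ->
    Gset T (fun u => u = v) U q) /\
  (forall k e, A k -> tSig T e (existT _ v k) -> forall k', tSig T e (existT _ v k') -> A k').
Proof.
  pose proof (fin_subtree_point T v) as HF.
  destruct (classic (exists e, talpha T e = v /\ qside T e q)) as [[e [<- Hq]]|Hn].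
  - exists (fun k => tSig T e (existT _ (talpha T e) k)); split; [apply (sig_compact T HS)|].
    split; [intros k Hk; right; exists e; auto|]; split.
    + intros U HU H; apply (Gset_qside T HS _ U e q (proj1 HF) HU); auto.
      * split; [reflexivity|]; intros Ho; apply (alpha_ne_omega T HT e); auto.
      * intros x Hx; pose proof (sig_vertex T HS e x Hx) as E.
        destruct x as [t k]; simpl in E; subst t; auto.
    + intros k f Hk Hf; rewrite <- (sig_edge T HS e f _ Hk Hf); auto.
  - destruct (vertex_step T HS v q) as [[k ->]|H]; [|contradiction].
    assert (Hs : forall e, ~ tSig T e (existT _ v k)).
    { intros e He; apply Hn; exists e; split; [symmetry; exact (sig_vertex T HS e _ He)|].
      apply (qside_Sigma T HS); exact He. }
    exists (fun k' => k' = k); split; [apply compact_singleton|].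
    split; [intros k' ->; left; auto|]; split.
    + intros U HU H; apply (Gset_pt_in T HS _ U _ (proj1 HF) HU); auto; reflexivity.
    + intros k' e -> He; destruct (Hs e He).
Qed.

Let D1 (v : TV T) (n : nat) : limT T -> Prop :=
  Gset T (fun u => u = v) (sat_core (fun u => u = v) (totB v n)).

Lemma sat_D1 v n : sat_open T (fun u => u = v) (sat_core (fun u => u = v) (totB v n)).
Proof.
  apply sat_core_sat.
  - intros t _; apply totB_open.
  - intros e x y H1 H2; destruct (alpha_ne_omega T HT e); congruence.
Qed.

(** Seen from [v], each of the two points appears as a compact set: a point of [K_v] outside all
    [Sigma_e], or one whole [Sigma_e]. These two sets are disjoint unless one edge leads to both
    points, and [B] then separates them. *)
Lemma D1_separates v q q' : q <> q' ->
  (forall e, talpha T e = v -> qside T e q -> qside T e q' -> False) ->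
  exists m n, D1 v m q /\ D1 v n q' /\ forall z, D1 v m z -> D1 v n z -> False.
Proof.
  intros Hqq Hns.
  destruct (blob_exists v q) as [A [HA [A1 [A2 A3]]]].
  destruct (blob_exists v q') as [C [HC [C1 [C2 C3]]]].
  destruct (B_sep v A C HA HC) as [m [n [Hm [Hn Hd]]]].
  - intros k Ak Ck; destruct (A1 k Ak) as [[E1 N1]|[e [H1 [H2 H3]]]];
      destruct (C1 k Ck) as [[E2 N2]|[e' [H1' [H2' H3']]]].
    + congruence.
    + exact (N1 e' H3').
    + exact (N2 e H3).
    + rewrite <- (sig_edge T HS e e' _ H3 H3') in H2'; exact (Hns e H1 H2 H2').
  - assert (H : forall A n, (forall k, A k -> B v n k) ->
      (forall k e, A k -> tSig T e (existT _ v k) -> forall k', tSig T e (existT _ v k') -> A k') ->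
      forall k, A k -> sat_core (fun u => u = v) (totB v n) (existT _ v k)).
    { clear - HS; intros A n HAB HAs k Ak; split; [reflexivity|]; split; [apply totB_iff; auto|].
      intros e [He _] Sk y Sy; pose proof (sig_vertex T HS e y Sy) as E.
      destruct y as [t k']; simpl in E; rewrite He in E; subst t.
      apply totB_iff; apply HAB; apply (HAs k e); auto. }
    exists m, n; split; [|split].
    + apply A2; [apply sat_D1|]; apply H; auto.
    + apply C2; [apply sat_D1|]; apply H; auto.
    + intros z; apply Gset_disjoint; try apply sat_D1; [apply fin_subtree_point|].
      intros x [_ [H1 _]] [_ [H2 _]]; exact (totB_disjoint v m n Hd x H1 H2).
Qed.

Context (M : TO T -> nat -> tot T -> Prop).
Context (M_open : forall e n, tot_open T (M e n)).
Context (M_spec : forall e n x y, tphi T e x y -> (totB (omega T e) n y <-> M e n x)).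

Let F2 (e : TO T) (v : TV T) : Prop := v = talpha T e \/ v = omega T e.

(** On [Sigma_e], the open set [M e n] is the preimage of [totB (omega T e) n] under [phi_e]. Near
    [Sigma_e] both disjuncts thus require that one of the two glued points be in the set of index
    [m] and its partner in that of index [n], which makes the union compatible with gluing along
    [e]. *)
Let W2 (e : TO T) (m n : nat) (x : tot T) : Prop :=
  (totB (talpha T e) m x /\ M e n x) \/ (totB (omega T e) n x /\ M (trev T e) m x).

Let D2 (e : TO T) (m n : nat) : limT T -> Prop := Gset T (F2 e) (sat_core (F2 e) (W2 e m n)).

Lemma fin_F2 e : fin_subtree T (F2 e).
Proof. apply (fin_subtree_add T (fun u => u = talpha T e) e); [apply fin_subtree_point|reflexivity]. Qed.

Lemma W2_phi e m n x y : tphi T e x y -> (W2 e m n x <-> W2 e m n y).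
Proof.
  intros He; pose proof (phi_vertices T HS e x y He) as [Ex Ey].
  pose proof (alpha_ne_omega T HT e) as Hne.
  assert (H1 : ~ totB (omega T e) n x) by (intros H; apply totB_vertex in H; congruence).
  assert (H2 : ~ totB (talpha T e) m y) by (intros H; apply totB_vertex in H; congruence).
  pose proof (M_spec e n x y He) as H3.
  pose proof (M_spec (trev T e) m y x (proj2 (phi_rev T HS e x y) He)) as H4.
  rewrite omega_rev in H4; unfold W2; tauto.
Qed.

Lemma sat_D2 e m n : sat_open T (F2 e) (sat_core (F2 e) (W2 e m n)).
Proof.
  apply sat_core_sat.
  - intros t _; apply op_union; [apply (ts_topology T HS)| |];
      apply (proj1 (proj2 (ts_topology T HS t))); solve [apply totB_open|apply M_open].
  - intros f x y [Ha|Ha] [Ho|Ho] Hf; try (destruct (alpha_ne_omega T HT f); congruence).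
    + rewrite (edge_eq T HT f e Ha Ho) in Hf; apply W2_phi; exact Hf.
    + assert (f = trev T e) by (apply (edge_eq T HT); [exact Ha|rewrite omega_rev; exact Ho]).
      subst f; symmetry; apply W2_phi; apply (phi_rev T HS); exact Hf.
Qed.

(** Two points glued along the same edge are separated on both of its vertex spaces at once: [m],
    [m'] keep the two sets apart at the tail, [n], [n'] at the head. *)
Lemma D2_separates e x x' : tSig T e x -> tSig T e x' -> x <> x' ->
  exists m n m' n', D2 e m n (ptof T x) /\ D2 e m' n' (ptof T x') /\
    forall z, D2 e m n z -> D2 e m' n' z -> False.
Proof.
  intros Sx Sx' Hne.
  destruct (phi_total T HS e x Sx) as [y Hy]; destruct (phi_total T HS e x' Sx') as [y' Hy'].
  assert (Hne' : y <> y').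
  { intros <-; apply Hne; apply (phi_fun T HS (trev T e) y); apply (phi_rev T HS); auto. }
  assert (HB : forall t (a b : tot T), projT1 a = t -> projT1 b = t -> a <> b ->
    exists m n, totB t m a /\ totB t n b /\ forall z, totB t m z -> totB t n z -> False).
  { intros t [t1 a] [t2 b]; simpl; intros -> -> Hab.
    destruct (B_sep t (fun k => k = a) (fun k => k = b)) as [m [n [H1 [H2 H3]]]];
      try apply compact_singleton.
    - intros k -> ->; apply Hab; reflexivity.
    - exists m, n; rewrite !totB_iff; split; [auto|split; [auto|]].
      apply totB_disjoint; exact H3. }
  pose proof (phi_vertices T HS e x y Hy) as [Ex Ey].
  pose proof (phi_vertices T HS e x' y' Hy') as [Ex' Ey'].
  destruct (HB (talpha T e) x x' Ex Ex' Hne) as [m [m' [H1 [H2 H3]]]].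
  destruct (HB (omega T e) y y' Ey Ey' Hne') as [n [n' [H4 [H5 H6]]]].
  assert (HD : forall a b m n, tSig T e a -> tphi T e a b -> totB (talpha T e) m a ->
    totB (omega T e) n b -> D2 e m n (ptof T a)).
  { clear - HS HT M_spec M_open B_open; intros a b m n Sa Hab Ba Bb.
    assert (Fa : F2 e (projT1 a)) by (left; apply (sig_vertex T HS); exact Sa).
    apply (Gset_pt_in T HS); [apply fin_F2|apply sat_D2|exact Fa|].
    split; [exact Fa|]; split.
    - left; split; [exact Ba|]; apply (M_spec e n a b Hab); exact Bb.
    - intros f Hf Sf; exfalso; apply (proj2 Hf).
      rewrite <- (sig_edge T HS e f a Sa Sf); right; reflexivity. }
  exists m, n, m', n'; split; [apply (HD x y); auto|]; split; [apply (HD x' y'); auto|].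
  intros z; apply Gset_disjoint; [apply fin_F2|apply sat_D2|apply sat_D2|].
  pose proof (alpha_ne_omega T HT e) as Hao.
  intros a [_ [[[A1 _]|[A1 _]] _]] [_ [[[A2 _]|[A2 _]] _]].
  - exact (H3 a A1 A2).
  - apply totB_vertex in A1; apply totB_vertex in A2; congruence.
  - apply totB_vertex in A1; apply totB_vertex in A2; congruence.
  - exact (H6 a A1 A2).
Qed.

(** The tail of [e] is not beyond [e], so another representative must be; it is glued to [x] along
    some edge, and every edge at that tail other than [e] stays on the near side. *)
Lemma qside_ptof_Sigma e x : projT1 x = talpha T e -> qside T e (ptof T x) -> tSig T e x.
Proof.
  intros Ex Hq; destruct (qside_pt_inv T HS e _ x eq_refl Hq) as [y [E Hy]].
  apply (ptof_eq T HS) in E; destruct E as [<-|[f Hf]].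
  - destruct (not_side_alpha T HT e); rewrite <- Ex; exact Hy.
  - pose proof (phi_vertices T HS f x y Hf) as [Hx Hy'].
    replace e with f; [apply (phi_sig T HS f x y Hf)|].
    apply NNPP; intros Hne; apply (not_side_alpha T HT e).
    replace (talpha T e) with (omega T (trev T f)) by (rewrite omega_rev; congruence).
    apply side_step.
    + intros E; apply (not_side_alpha T HT e); rewrite <- E at 2.
      exfalso; apply (alpha_ne_omega T HT f); rewrite <- Hx, Ex, <- E; reflexivity.
    + intros E; apply Hne; rewrite <- (trev_inv T f), E, trev_inv; reflexivity.
    + change (talpha T (trev T f)) with (omega T f); rewrite <- Hy'; exact Hy.
Qed.

(** Suppose that at every vertex one edge leads to both points. If [q] is the class of [x], this
    applied at the two vertices of [q] gives an edge [e] with [x] in [Sigma_e] and [q'] beyond both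
    [e] and its reverse, which forces [q'] onto [Sigma_e] too. Two distinct ends are excluded at a
    vertex where their rays part. *)
Lemma separation_cases q q' : q <> q' ->
  (exists v, forall e, talpha T e = v -> qside T e q -> qside T e q' -> False) \/
  exists e x x', tSig T e x /\ tSig T e x' /\ q = ptof T x /\ q' = ptof T x'.
Proof.
  intros Hqq; apply NNPP; intros Hn.
  assert (Hboth : forall v, exists e, talpha T e = v /\ qside T e q /\ qside T e q').
  { intros v; apply NNPP; intros Hv; apply Hn; left; exists v.
    intros e H1 H2 H3; apply Hv; exists e; auto. }
  assert (Hpt : forall q q' x, q = ptof T x ->
    (forall v, exists e, talpha T e = v /\ qside T e q /\ qside T e q') ->
    exists e x x', tSig T e x /\ tSig T e x' /\ q = ptof T x /\ q' = ptof T x').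
  { clear q q' Hqq Hn Hboth; intros q q' x -> Hb.
    destruct (Hb (projT1 x)) as [e [H1 [H2 H3]]].
    assert (Sx : tSig T e x) by (apply qside_ptof_Sigma; auto).
    destruct (phi_total T HS e x Sx) as [y Hy].
    assert (E : ptof T x = ptof T y) by (apply (ptof_eq T HS); right; exists e; exact Hy).
    destruct (Hb (projT1 y)) as [e' [H1' [H2' H3']]]; rewrite E in H2'.
    assert (e' = trev T e).
    { apply (sig_edge T HS _ _ y); [apply qside_ptof_Sigma; auto|apply (phi_sig T HS e x y Hy)]. }
    subst e'; exists e, x; destruct (lim_cases T q') as [[z ->]|[r [Hr ->]]].
    - destruct (qside_pt_inv T HS e _ z eq_refl H3) as [z1 [E1 Z1]].
      destruct (qside_pt_inv T HS (trev T e) _ z eq_refl H3') as [z2 [E2 Z2]].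
      assert (Ez : z1 = z2 \/ exists f, tphi T f z1 z2) by (apply (ptof_eq T HS); congruence).
      (* The representatives [z1] and [z2] of [q'] lie on opposite sides of [e], so they are glued
         along [e] itself. *)
      destruct Ez as [<-|[f Hf]]; [destruct (side_not_rev T HT e _ Z1 Z2)|].
      pose proof (phi_vertices T HS f z1 z2 Hf) as [V1 V2].
      assert (f = trev T e).
      { apply NNPP; intros Hne.
        apply (side_not_rev T HT e (projT1 z2)); [|exact Z2].
        rewrite V2; apply side_step; [|exact Hne|rewrite <- V1; exact Z1].
        intros ->; apply (not_side_alpha T HT e); rewrite <- V1; exact Z1. }
      subst f; exists z2; split; [exact Sx|]; split; [|split; [reflexivity|congruence]].
      rewrite <- (trev_inv T e); apply (phi_sig T HS _ z1 z2 Hf).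
    - exfalso; apply qside_end in H3; apply qside_end in H3'.
      destruct H3 as [r1 [R1 [T1 <-]]]; destruct H3' as [r2 [R2 [T2 E2]]].
      assert (Ht : tail_eq r1 r2) by (eapply tail_eq_trans; [apply tail_eq_sym; exact T1|exact T2]).
      destruct Ht as [m [k Ht]].
      apply (side_not_rev T HT (r1 0%nat) (talpha T (r1 (1 + m)%nat))); [apply (ray_side T r1 0 m R1)|].
      replace (r1 (1 + m)%nat) with (r2 (1 + k)%nat).
      + rewrite <- E2; apply (ray_side T r2 0 k R2).
      + specialize (Ht 1%nat); rewrite Nat.add_comm, <- Ht; f_equal; lia. }
  destruct (lim_cases T q) as [[x E]|[r [Hr E]]].
  { apply Hn; right; exact (Hpt q q' x E Hboth). }
  destruct (lim_cases T q') as [[x E']|[r' [Hr' E']]].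
  { apply Hn; right; destruct (Hpt q' q x E') as [e [y [y' H]]].
    - intros v; destruct (Hboth v) as [e He]; exists e; tauto.
    - exists e, y', y; tauto. }
  destruct (ray_from T HT r' (talpha T (r 0%nat)) Hr') as [s [Hs [Ts Es]]].
  assert (Hdiff : exists n, r n <> s n).
  { apply NNPP; intros H; apply Hqq; rewrite E, E'; apply endof_eq.
    eapply tail_eq_trans; [|apply tail_eq_sym; exact Ts].
    exists 0%nat, 0%nat; intros n; apply NNPP; intros Hrs; apply H; exists n; exact Hrs. }
  (* The rays [r] and [s] start at the same vertex; at the vertex where they part, an edge leading
     to both ends would have to equal both [r n] and [s n]. *)
  assert (Hfirst : exists n, talpha T (r n) = talpha T (s n) /\ r n <> s n).
  { destruct Hdiff as [n Hn']; revert Hn'; induction n as [|n IH]; intros Hrs.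
    - exists 0%nat; auto.
    - destruct (classic (r n = s n)) as [En|En]; [|auto].
      exists (S n); split; [|exact Hrs].
      rewrite (proj1 (Hr n)), (proj1 (Hs n)), En; reflexivity. }
  destruct Hfirst as [n [En Hrs]]; destruct (Hboth (talpha T (r n))) as [e [H1 [H2 H3]]].
  rewrite E in H2; rewrite E' in H3; apply qside_end in H2; apply qside_end in H3.
  destruct H2 as [r1 [R1 [T1 E1]]]; destruct H3 as [r2 [R2 [T2 E2]]].
  assert (HK : forall a b : nat -> TO T, is_ray T a -> is_ray T b -> tail_eq b a -> b 0%nat = e ->
    talpha T (a n) = talpha T e -> a n = e).
  { clear - HT; intros a b Ha Hb Hab Eb Ea.
    pose proof (ray_start_unique T HT b (shift n a) Hb (is_ray_shift T n a Ha)) as H.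
    unfold shift at 2 in H; rewrite Nat.add_0_r in H.
    rewrite <- Eb, (H ltac:(eapply tail_eq_trans; [exact Hab|apply tail_eq_sym, tail_eq_shift])).
    - unfold shift; rewrite Nat.add_0_r; reflexivity.
    - congruence. }
  apply Hrs; transitivity e; [|symmetry]; [apply (HK r r1)|apply (HK s r2)]; auto.
  - apply tail_eq_sym; exact T1.
  - eapply tail_eq_trans; [apply tail_eq_sym; exact T2|exact Ts].
  - congruence.
Qed.

(** The tags 0 and 1 distinguish vertex sets from edge sets. Countability is given for vertices, so
    an edge is coded by its two ends, which determine it in a tree. Numbers that code nothing index
    the empty set. *)
Lemma lim_separating_family : exists D, (forall n, lim_open T (D n)) /\ separating D.
Proof.
  destruct HT as [[f Hf] _].
  set (D := fun n q =>
    (exists v m, n = to_nat (0, to_nat (f v, m))%nat /\ D1 v m q) \/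
    exists e m k, n = to_nat (1, to_nat (to_nat (f (talpha T e), f (omega T e)), to_nat (m, k)))%nat
      /\ D2 e m k q).
  assert (Hto : forall a b c d, to_nat (a, b) = to_nat (c, d) -> a = c /\ b = d).
  { intros a b c d H; apply pair_equal_spec.
    rewrite <- (cancel_of_to (a, b)), <- (cancel_of_to (c, d)), H; reflexivity. }
  assert (E1 : forall v m, D (to_nat (0, to_nat (f v, m)))%nat = D1 v m).
  { intros v m; apply set_ext; intros q; split; [|intros H; left; exists v, m; auto].
    intros [[v' [m' [E H]]]|[e [m' [k [E _]]]]].
    - apply Hto in E; destruct E as [_ E]; apply Hto in E; destruct E as [E <-].
      apply Hf in E; subst; exact H.
    - apply Hto in E; destruct E; discriminate. }
  assert (E2 : forall e m k, D (to_nat (1, to_nat (to_nat (f (talpha T e), f (omega T e)),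
    to_nat (m, k))))%nat = D2 e m k).
  { intros e m k; apply set_ext; intros q; split; [|intros H; right; exists e, m, k; auto].
    intros [[v' [m' [E _]]]|[e' [m' [k' [E H]]]]].
    - apply Hto in E; destruct E; discriminate.
    - apply Hto in E; destruct E as [_ E]; apply Hto in E; destruct E as [E E'].
      apply Hto in E; apply Hto in E'; destruct E as [Ea Eo]; destruct E' as [<- <-].
      apply Hf in Ea; apply Hf in Eo; rewrite (edge_eq T HT e e'); auto. }
  exists D; split.
  - intros n; destruct (classic (exists v m, n = to_nat (0, to_nat (f v, m))%nat)) as [[v [m ->]]|N1].
    { rewrite E1; apply Gset_open; [apply fin_subtree_point|apply sat_D1]. }
    destruct (classic (exists e m k, n = to_nat (1, to_nat (to_nat (f (talpha T e), f (omega T e)),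
      to_nat (m, k))))%nat) as [[e [m [k ->]]]|N2].
    { rewrite E2; apply Gset_open; [apply fin_F2|apply sat_D2]. }
    apply (op_ext _ (fun _ => False)); [|apply op_empty, lim_topology; exact HS].
    intros q; split; [intros []|]; intros [[v [m [E _]]]|[e [m [k [E _]]]]].
    + apply N1; exists v, m; exact E.
    + apply N2; exists e, m, k; exact E.
  - intros q q' Hqq; destruct (separation_cases q q' Hqq) as [[v Hv]|[e [x [x' [Sx [Sx' [-> ->]]]]]]].
    + destruct (D1_separates v q q' Hqq Hv) as [m [n H]].
      exists (to_nat (0, to_nat (f v, m)))%nat, (to_nat (0, to_nat (f v, n)))%nat.
      rewrite !E1; exact H.
    + destruct (D2_separates e x x' Sx Sx') as [m [n [m' [n' H]]]]; [intros ->; auto|].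
      exists (to_nat (1, to_nat (to_nat (f (talpha T e), f (omega T e)), to_nat (m, n))))%nat,
        (to_nat (1, to_nat (to_nat (f (talpha T e), f (omega T e)), to_nat (m', n'))))%nat.
      rewrite !E2; exact H.
Qed.

End LimMetrizable.

Lemma lim_metrizable (T : TS) : is_tree_system T ->
  exists d : limT T -> limT T -> R, is_metric d /\
    forall U, lim_open T U <-> metric_open d U.
Proof.
  intros HS.
  assert (HB : forall t, exists B : nat -> TK T t -> Prop, (forall n, topn T t (B n)) /\
    forall A C, compact_set (topn T t) A -> compact_set (topn T t) C ->
    (forall x, A x -> C x -> False) -> exists m n, (forall x, A x -> B m x) /\
    (forall x, C x -> B n x) /\ forall x, B m x -> B n x -> False).
  { intros t; destruct (ts_metric T HS t) as [d [Hd [Ho _]]].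
    apply (compact_metric_separating _ d); auto; apply (ts_compact T HS). }
  destruct (dep_choice _ HB) as [B HB'].
  destruct (fun_choice (fun (p : TO T * nat) M => tot_open T M /\
    forall x y, tphi T (fst p) x y -> (totB T B (omega T (fst p)) (snd p) y <-> M x))) as [M HM].
  { intros [e n]; apply (phi_cont T HS), totB_open; [exact HS|intros t; apply HB']. }
  destruct (lim_separating_family T HS B) with (M := fun e n => M (e, n)) as [D [HD Hs]].
  - intros t; apply HB'.
  - intros t; apply HB'.
  - intros e n; apply (HM (e, n)).
  - intros e n; apply (HM (e, n)).
  - apply (metrizable_of_separating _ D); auto; [apply lim_topology|apply lim_compact]; exact HS.
Qed.

Lemma lim_hausdorff (T : TS) : is_tree_system T -> hausdorff (lim_open T).
Proof.
  intros HS; destruct (lim_metrizable T HS) as [d [Hd Ho]]; exact (metric_hausdorff _ d Hd Ho).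
Qed.

(** * Restriction to a subtree *)

Lemma list_preimage {A C : Type} (f : A -> C) (l : list C) :
  (forall a b, f a = f b -> a = b) -> exists l' : list A, forall a, In (f a) l -> In a l'.
Proof.
  intros Hf; induction l as [|c l [l' Hl]]; [exists nil; intros a []|].
  destruct (classic (exists a, f a = c)) as [[a <-]|Hc].
  - exists (a :: l'); intros b [Hb|Hb]; [left; auto|right; auto].
  - exists l'; intros a [Ha|Ha]; [destruct Hc; exists a; auto|auto].
Qed.

Lemma restr_emb_inj (T : TS) (B : TV T -> Prop) x y :
  restr_emb T B x = restr_emb T B y -> x = y.
Proof.
  destruct x as [[v h] k], y as [[v' h'] k']; unfold restr_emb; simpl; intros E.
  assert (Ev : v = v') by exact (f_equal (@projT1 _ _) E); subst v'.
  apply inj_pair2 in E; subst k'; rewrite (proof_irrelevance _ h h'); reflexivity.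
Qed.

Lemma restr_emb_surj (T : TS) (B : TV T -> Prop) (x : tot T) : B (projT1 x) ->
  exists y, restr_emb T B y = x.
Proof.
  destruct x as [v k]; intros h.
  exists (existT (fun t : {v | B v} => TK T (proj1_sig t)) (exist _ v h) k); reflexivity.
Qed.

Lemma restr_is_ray (T : TS) (B : TV T -> Prop) (r : nat -> TO (restr T B)) :
  is_ray (restr T B) r -> is_ray T (fun n => proj1_sig (r n)).
Proof.
  intros H n; destruct (H n) as [H1 H2]; split.
  - exact (f_equal (@proj1_sig _ _) H1).
  - intros E; apply H2; apply sig_eq; exact E.
Qed.

Lemma restr_ray_lift (T : TS) (B : TV T -> Prop) (r : nat -> TO T) : is_ray T r ->
  (forall n, B (talpha T (r n))) ->
  exists r' : nat -> TO (restr T B), is_ray (restr T B) r' /\ forall n, proj1_sig (r' n) = r n.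
Proof.
  intros H HB.
  assert (HB' : forall n, B (talpha T (r n)) /\ B (omega T (r n))).
  { intros n; split; [apply HB|]; rewrite <- (proj1 (H n)); apply HB. }
  exists (fun n => exist _ (r n) (HB' n)); split; [|reflexivity].
  intros n; destruct (H n) as [H1 H2]; split; [apply sig_eq; exact H1|].
  intros E; apply H2; exact (f_equal (@proj1_sig _ _) E).
Qed.

Section Restr.
Context (T : TS) (HS : is_tree_system T) (B : TV T -> Prop) (HB : is_subtree T B).
Let HT := ts_tree T HS.
Local Notation R := (restr T B).

Lemma restr_subtree_path u v : exists p, is_path R p u v /\ reduced R p /\
  is_path T (map (@proj1_sig _ _) p) (proj1_sig u) (proj1_sig v).
Proof.
  destruct (tree_path T HT (proj1_sig u) (proj1_sig v)) as [p [H1 H2]].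
  destruct (restr_path_lift T B p u v H1) as [q [<- H3]].
  - apply (subtree_path T HT B _ _ p HB (proj2_sig u) (proj2_sig v) H1 H2).
  - exists q; split; [exact H3|]; split; [apply restr_reduced; exact H2|exact H1].
Qed.

Lemma restr_tree : is_tree R.
Proof.
  split.
  - destruct HT as [[f Hf] _]; exists (fun v => f (proj1_sig v)); intros u v E.
    apply sig_eq, Hf, E.
  - intros u v; destruct (restr_subtree_path u v) as [p [H1 [H2 H3]]]; exists p.
    split; [auto|]; intros q [H4 H5].
    assert (E : map (@proj1_sig _ _) q = map (@proj1_sig _ _) p).
    { apply (tree_unique T HT _ _ (proj1_sig u) (proj1_sig v)).
      - exact (restr_path T B q u v H4).
      - apply restr_reduced; exact H5.
      - exact H3.
      - apply restr_reduced; exact H2. }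
    revert E.
    clear; revert p; induction q as [|e q IH]; intros [|f p] E; try discriminate; auto.
    injection E as E1 E2; f_equal; [apply sig_eq; exact E1|auto].
Qed.

Lemma restr_tree_system : is_tree_system R.
Proof.
  split; [exact restr_tree|]; split; [|split; [|split; [|split; [|split; [|split; [|split; [|split; [|split]]]]]]]].
  - intros t; split; [exact (ts_compact T HS (proj1_sig t))|].
    destruct (ts_metric T HS (proj1_sig t)) as [d [Hd [Ho Hn]]]; exists d.
    split; [exact Hd|]; split; [exact Ho|].
    intros eps He; destruct (Hn eps He) as [l Hl].
    destruct (list_preimage (@proj1_sig _ (fun e => B (talpha T e) /\ B (omega T e))) l (sig_eq _))
      as [l' Hl'].
    exists l'; intros e Ee HD; apply Hl', Hl; [exact (f_equal (@proj1_sig _ _) Ee)|exact HD].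
  - intros e x Hx; apply sig_eq; exact (sig_vertex T HS _ _ Hx).
  - intros e; destruct (sig_nonempty T HS (proj1_sig e)) as [x Hx].
    destruct (restr_emb_surj T B x) as [y <-]; [|exists y; exact Hx].
    rewrite (sig_vertex T HS _ _ Hx); apply (proj2_sig e).
  - intros e; exact (sig_compact T HS (proj1_sig e)).
  - intros e x y; exact (phi_sig T HS (proj1_sig e) _ _).
  - intros e x Hx; destruct (phi_total T HS _ _ Hx) as [y Hy].
    destruct (restr_emb_surj T B y) as [y' <-]; [|exists y'; exact Hy].
    rewrite (proj2 (phi_vertices T HS _ _ _ Hy)); apply (proj2_sig e).
  - intros e x y y' H1 H2; apply restr_emb_inj; exact (phi_fun T HS _ _ _ _ H1 H2).
  - intros e x y; exact (phi_rev T HS (proj1_sig e) _ _).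
  - intros e W HW.
    (* This extends [W] by the whole of [K_t] at every vertex [t] outside [B], which keeps it
       open. *)
    destruct (phi_cont T HS (proj1_sig e) (fun x => forall y, restr_emb T B y = x -> W y))
      as [W' [HW' H]].
    + intros t; destruct (classic (B t)) as [Bt|Bt].
      * apply (op_ext _ (fun k => W (existT (fun t : {v | B v} => TK T (proj1_sig t))
          (exist _ t Bt) k))); [|exact (HW (exist _ t Bt))].
        intros k; split; [|intros Hk; apply Hk; reflexivity].
        intros Hk y Ey; match type of Hk with W ?z =>
          assert (E : y = z) by (apply restr_emb_inj; exact Ey) end.
        rewrite E; exact Hk.
      * apply (op_ext _ (fun _ => True)); [|exact (proj1 (ts_topology T HS t))].
        intros k; split; [|auto]; intros _ y Ey; destruct Bt.
        rewrite <- (f_equal (@projT1 _ _) Ey : _ = t); apply (proj2_sig (projT1 y)).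
    + exists (fun y => W' (restr_emb T B y)); split; [intros t; exact (HW' (proj1_sig t))|].
      intros x y Hxy; rewrite <- (H _ _ Hxy); split; [|intros Hy; apply Hy; reflexivity].
      intros Wy z Ez; apply restr_emb_inj in Ez; subst; exact Wy.
  - intros e e' x Hne H1 H2; apply Hne, sig_eq; exact (sig_edge T HS _ _ _ H1 H2).
Qed.

Lemma restr_side e t : side R e t -> side T (proj1_sig e) (proj1_sig t).
Proof.
  intros [p [H1 H2]]; exists (map (@proj1_sig _ _) p).
  split; [exact (restr_path T B (e :: p) _ _ H1)|exact (proj1 (restr_reduced T B (e :: p)) H2)].
Qed.

(** The inclusion of [lim Theta_B] into [lim Theta] is stated on representatives and turned into a
    function by choice; [lim_incl_pt] and [lim_incl_end] then show that it may be computed on any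
    representative. *)
Definition incl_rel (q : limT R) (p : limT T) : Prop :=
  (exists x, q = ptof R x /\ p = ptof T (restr_emb T B x)) \/
  (exists r H H', q = endof R r H /\ p = endof T (fun n => proj1_sig (r n)) H').

Lemma incl_total q : exists p, incl_rel q p.
Proof.
  destruct (lim_cases R q) as [[x ->]|[r [H ->]]].
  - exists (ptof T (restr_emb T B x)); left; exists x; auto.
  - exists (endof T _ (restr_is_ray T B r H)); right; exists r, H, (restr_is_ray T B r H); auto.
Qed.

Definition lim_incl (q : limT R) : limT T :=
  proj1_sig (constructive_indefinite_description _ (incl_total q)).

Lemma lim_incl_spec q : incl_rel q (lim_incl q).
Proof. unfold lim_incl; apply proj2_sig. Qed.

Lemma lim_incl_pt x : lim_incl (ptof R x) = ptof T (restr_emb T B x).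
Proof.
  destruct (lim_incl_spec (ptof R x)) as [[y [E ->]]|[r [H [_ [E _]]]]]; [|discriminate].
  apply (ptof_eq R restr_tree_system) in E; apply (ptof_eq T HS).
  destruct E as [->|[e He]]; [left; reflexivity|right].
  exists (trev T (proj1_sig e)); apply (phi_rev T HS); exact He.
Qed.

Lemma lim_incl_end r H H' : lim_incl (endof R r H) = endof T (fun n => proj1_sig (r n)) H'.
Proof.
  destruct (lim_incl_spec (endof R r H)) as [[y [E _]]|[s [Hs [Hs' [E ->]]]]]; [discriminate|].
  apply endof_eq in E; apply endof_eq; apply tail_eq_sym; destruct E as [m [k E]].
  exists m, k; intros n; rewrite E; reflexivity.
Qed.

Lemma lim_incl_qside e q : qside R e q -> qside T (proj1_sig e) (lim_incl q).
Proof.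
  intros Hq; destruct (lim_cases R q) as [[x ->]|[r [H ->]]].
  - destruct (qside_pt_inv R restr_tree_system e _ x eq_refl Hq) as [y [-> Hy]].
    rewrite lim_incl_pt; apply qside_pt; apply restr_side; exact Hy.
  - rewrite (lim_incl_end r H (restr_is_ray T B r H)).
    apply qside_end in Hq; destruct Hq as [r' [H1 [[m [k H2]] <-]]]; apply qside_end.
    exists (fun n => proj1_sig (r' n)); split; [apply restr_is_ray; exact H1|].
    split; [exists m, k; intros n; rewrite H2; reflexivity|reflexivity].
Qed.

Lemma lim_incl_side e q : (forall v, B v -> side T e v) -> qside T e (lim_incl q).
Proof.
  intros He; destruct (lim_cases R q) as [[x ->]|[r [H ->]]].
  - rewrite lim_incl_pt; apply qside_pt, He; exact (proj2_sig (projT1 x)).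
  - rewrite (lim_incl_end r H (restr_is_ray T B r H)); apply qside_end.
    destruct (ray_on_side T HT _ e 0 (restr_is_ray T B r H)) as [r' H']; [|exists r'; exact H'].
    intros n _; apply He; apply (proj2_sig (r n)).
Qed.

(** If [B] meets [F], the preimage is the basic set given by the trace of [U] on the intersection of
    [F] and [B]. Otherwise [B] lies beyond a single exit of [F], and the preimage is everything or
    empty. *)
Lemma lim_incl_Gset_open F U : fin_subtree T F -> sat_open T F U ->
  lim_open R (fun q => Gset T F U (lim_incl q)).
Proof.
  intros HF HU; pose proof restr_tree_system as HR; pose proof (lim_topology R HR) as Ht.
  destruct (classic (exists v, B v /\ F v)) as [[v0 [Bv0 Fv0]]|HBF].
  - set (FB := fun v : TV R => F (proj1_sig v)); set (UB := fun y : tot R => U (restr_emb T B y)).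
    assert (HFB : fin_subtree R FB).
    { split; [split|].
      - exists (exist _ v0 Bv0); exact Fv0.
      - intros u v Fu Fv; destruct (restr_subtree_path u v) as [p [H1 [H2 H3]]]; exists p.
        split; [exact H1|]; intros e He.
        apply (subtree_path T HT F _ _ _ (proj1 HF) Fu Fv H3).
        + apply restr_reduced; exact H2.
        + apply in_map; exact He.
      - destruct HF as [_ [l Hl]]; destruct (list_preimage (@proj1_sig _ B) l (sig_eq _)) as [l' Hl'].
        exists l'.
        intros v Fv; apply Hl', Hl, Fv. }
    assert (HUB : sat_open R FB UB).
    { destruct HU as [A1 [A2 [A3 A4]]]; split; [|split; [|split]].
      - intros x Hx; apply A1 in Hx; exact Hx.
      - intros e x y Fa Fo He; exact (A2 _ _ _ Fa Fo He).
      - intros t Ft; exact (A3 _ Ft).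
      - intros e Fa Fo; destruct (A4 (proj1_sig e) Fa Fo) as [H|H]; [left|right];
          intros x Hx; apply H; exact Hx. }
    apply (op_ext _ (Gset R FB UB)); [|apply Gset_open; auto].
    intros q; destruct (qside_cases R HR FB q HFB) as [[x [Fx ->]]|[e [He Hq]]].
    + rewrite lim_incl_pt, (Gset_pt_in R HR FB UB x (proj1 HFB) HUB Fx).
      rewrite (Gset_pt_in T HS F U (restr_emb T B x) (proj1 HF) HU Fx); reflexivity.
    + rewrite (Gset_qside R HR FB UB e q (proj1 HFB) HUB He Hq).
      rewrite (Gset_qside T HS F U (proj1_sig e) (lim_incl q) (proj1 HF) HU He
        (lim_incl_qside e q Hq)).
      split; [|intros H x Hx; apply H; exact Hx].
      intros H x Hx; destruct (restr_emb_surj T B x) as [y <-]; [|apply H; exact Hx].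
      rewrite (sig_vertex T HS _ _ Hx); apply (proj2_sig e).
  - assert (He : exists e, outedge T F e /\ forall v, B v -> side T e v).
    { pose proof HB as [[v Bv] _].
      destruct (exit_exists T HT F v (proj1 HF)) as [e [H1 H2]].
      - intros Fv; apply HBF; exists v; auto.
      - exists e; split; [exact H1|]; intros w Bw.
        apply (subtree_same_side T HT B e v w HB); auto.
        intros [Ba _]; apply HBF; exists (talpha T e); split; [exact Ba|apply H1]. }
    destruct He as [e [H1 H2]].
    assert (E : forall q, Gset T F U (lim_incl q) <-> forall x, tSig T e x -> U x).
    { intros q; apply (Gset_qside T HS F U e _ (proj1 HF) HU H1); apply lim_incl_side; auto. }
    destruct (classic (forall x, tSig T e x -> U x)) as [H|H].
    + apply (op_ext _ (fun _ => True)); [intros q; rewrite E; tauto|apply (proj1 Ht)].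
    + apply (op_ext _ (fun _ => False)); [intros q; rewrite E; tauto|apply op_empty; exact Ht].
Qed.

End Restr.

(** * Consolidation *)

Section Consol.
Context (T : TS) (HS : is_tree_system T) (I : Type) (blk : TV T -> I).
Context (Hblk : forall i, is_subtree T (fun v => blk v = i)).
Let HT := ts_tree T HS.
Local Notation C := (consol T blk).

Lemma blk_system i : is_tree_system (blkT T blk i).
Proof. exact (restr_tree_system T HS _ (Hblk i)). Qed.

Lemma blk_inhabited i : exists v, blk v = i.
Proof. exact (proj1 (Hblk i)). Qed.

Lemma block_path u v : blk u = blk v -> exists q, is_path T q u v /\ reduced T q /\
  forall e, In e q -> blk (talpha T e) = blk u /\ blk (omega T e) = blk u.
Proof.
  intros E; destruct (tree_path T HT u v) as [q [H1 H2]]; exists q.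
  split; [exact H1|]; split; [exact H2|].
  apply (subtree_path T HT (fun w => blk w = blk u) u v q (Hblk (blk u))); auto.
Qed.

(** [lifts q p] says that [p] lists the block-crossing edges of [q] in order. It is a relation
    because equality of blocks is not decided by computation and the edges of [C] carry proofs. *)
Inductive lifts : list (TO T) -> list (TO C) -> Prop :=
  | lifts_nil : lifts nil nil
  | lifts_in e q p : blk (talpha T e) = blk (omega T e) -> lifts q p -> lifts (e :: q) p
  | lifts_cross e q p : lifts q p -> lifts (proj1_sig e :: q) (e :: p).

Lemma lifts_fun q p p' : lifts q p -> lifts q p' -> p = p'.
Proof.
  intros H; revert p'; induction H as [|e q p He H IH|e q p H IH]; intros p' H'.
  - inversion H'; reflexivity.
  - inversion H' as [|f q' p'' Hf Hq|f q' p'' Hq Ef]; subst; [auto|].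
    destruct (proj2_sig f He).
  - inversion H' as [|f q' p'' Hf Hq|f q' p'' Hq Ef]; subst.
    + destruct (proj2_sig e Hf).
    + f_equal; [apply sig_eq; auto|auto].
Qed.

Lemma lifts_block b q p : (forall e, In e b -> blk (talpha T e) = blk (omega T e)) ->
  lifts q p -> lifts (b ++ q) p.
Proof.
  induction b as [|e b IH]; intros Hb H; [exact H|].
  apply lifts_in; [apply Hb; left; reflexivity|apply IH; auto].
  intros f Hf; apply Hb; right; exact Hf.
Qed.

Lemma cross_rev (e : TO C) : blk (talpha T (trev T (proj1_sig e))) <>
  blk (omega T (trev T (proj1_sig e))).
Proof. rewrite omega_rev; intros E; apply (proj2_sig e); symmetry; exact E. Qed.

(** The first edge of [q] either stays in a block, and is then not the reverse of a crossing edge,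
    or it is the first edge of [p], where reducedness in [C] applies. *)
Lemma lifts_junction e q p : reduced C (e :: p) -> lifts q p -> reduced T q ->
  reduced T (proj1_sig e :: q).
Proof.
  intros H1 H2 H3; apply reduced_cons; split; [exact H3|].
  intros f q' -> ->; apply reduced_cons in H1; destruct H1 as [_ H1].
  inversion H2 as [|f q0 p0 Hf Hq|f q0 p0 Hq Ef]; subst.
  - exact (cross_rev e Hf).
  - apply (H1 f p0 eq_refl); apply sig_eq; exact Ef.
Qed.

(** Reduced paths inside the blocks are inserted before each crossing and at the end. Their edges do
    not cross, so no backtracking arises where they meet a crossing edge. *)
Lemma lift_path p i j u v : is_path C p i j -> reduced C p -> blk u = i -> blk v = j ->
  exists q, is_path T q u v /\ reduced T q /\ lifts q p.
Proof.
  revert i u; induction p as [|e p IH]; intros i u H1 H2 Hu Hv.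
  - simpl in H1; destruct (block_path u v) as [q [H3 [H4 H5]]]; [congruence|].
    exists q; split; [exact H3|]; split; [exact H4|].
    rewrite <- (app_nil_r q); apply lifts_block; [|apply lifts_nil].
    intros e He; destruct (H5 e He); congruence.
  - destruct H1 as [Hi H1].
    destruct (IH _ (omega T (proj1_sig e)) H1) as [q [H3 [H4 H5]]]; auto.
    { apply reduced_cons in H2; apply H2. }
    destruct (block_path u (talpha T (proj1_sig e))) as [b [B1 [B2 B3]]].
    { rewrite Hu, <- Hi; reflexivity. }
    exists (b ++ proj1_sig e :: q); split; [|split].
    + apply is_path_app; exists (talpha T (proj1_sig e)); split; [exact B1|split; auto].
    + apply reduced_app; [|apply (lifts_junction e q p); auto].
      apply reduced_snoc; [exact B2|]; intros b' f -> E.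
      destruct (B3 f) as [E1 E2]; [apply in_or_app; right; left; reflexivity|].
      apply (proj2_sig e); rewrite E, omega_rev; unfold omega in E2; congruence.
    + apply lifts_block; [|apply lifts_cross; exact H5].
      intros f Hf; destruct (B3 f Hf); congruence.
Qed.

Lemma project_path p u v : is_path T p u v -> exists p', is_path C p' (blk u) (blk v) /\
  forall e, In e p' -> In (proj1_sig e) p.
Proof.
  revert u; induction p as [|e p IH]; intros u H.
  - exists nil; simpl in *; split; [congruence|intros e []].
  - destruct H as [<- H]; destruct (IH _ H) as [p' [H1 H2]].
    destruct (classic (blk (talpha T e) = blk (omega T e))) as [E|E].
    + exists p'; rewrite E; split; [exact H1|intros f Hf; right; auto].
    + exists (exist _ e E :: p'); split; [split; [reflexivity|exact H1]|].
      intros f [<-|Hf]; [left; reflexivity|right; auto].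
Qed.

(** Two reduced paths of [C] with the same ends lift to reduced paths of [T] with the same ends. The
    lifts coincide, and a path of [T] determines its sequence of crossings. *)
Lemma consol_tree : is_tree C.
Proof.
  split.
  - destruct HT as [[f Hf] _].
    destruct (fun_choice (fun i v => blk v = i) blk_inhabited) as [c Hc].
    exists (fun i => f (c i)); intros i j E; apply Hf in E.
    rewrite <- (Hc i), <- (Hc j), E; reflexivity.
  - intros i j; destruct (blk_inhabited i) as [u <-]; destruct (blk_inhabited j) as [v <-].
    destruct (tree_path T HT u v) as [p [H1 _]]; destruct (project_path p u v H1) as [p' [H2 _]].
    destruct (path_reduce C p' _ _ H2) as [q [H3 [H4 _]]]; exists q; split; [auto|].
    intros q' [H5 H6].
    destruct (lift_path q _ _ u v H3 H4 eq_refl eq_refl) as [l [L1 [L2 L3]]].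
    destruct (lift_path q' _ _ u v H5 H6 eq_refl eq_refl) as [l' [L1' [L2' L3']]].
    rewrite (tree_unique T HT l' l u v) in L3' by auto; exact (lifts_fun l q' q L3' L3).
Qed.

Lemma consol_side e v : side C e (blk v) -> side T (proj1_sig e) v.
Proof.
  intros [p [[_ H1] H2]].
  destruct (lift_path p _ _ (omega T (proj1_sig e)) v H1) as [q [L1 [L2 L3]]]; auto.
  - apply reduced_cons in H2; apply H2.
  - exists q; split; [split; auto|apply (lifts_junction e q p); auto].
Qed.

Lemma consol_side_iff e v : side C e (blk v) <-> side T (proj1_sig e) v.
Proof.
  split; [apply consol_side|]; intros H.
  destruct (side_or C consol_tree e (blk v)) as [H'|H']; [exact H'|].
  apply consol_side in H'; destruct (side_not_rev T HT _ _ H H').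
Qed.

Lemma lim_incl_inblk i x H : lim_incl T _ (inblk T blk i x H) = ptof T x.
Proof.
  unfold inblk; rewrite (lim_incl_pt T HS _ (Hblk i)); destruct x; reflexivity.
Qed.

Lemma lim_incl_blk_end i r H H' : lim_incl T (fun v => blk v = i) (endof (blkT T blk i) r H) =
  endof T (fun n => proj1_sig (r n)) H'.
Proof. exact (lim_incl_end T _ r H H'). Qed.

Lemma inblk_irrel i x H H' : inblk T blk i x H = inblk T blk i x H'.
Proof. rewrite (proof_irrelevance _ H H'); reflexivity. Qed.

Lemma inblk_eq i x x' H H' : inblk T blk i x H = inblk T blk i x' H' <->
  x = x' \/ exists e, blk (talpha T e) = i /\ blk (omega T e) = i /\ tphi T e x x'.
Proof.
  unfold inblk; rewrite (ptof_eq _ (blk_system i)); split.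
  - intros [E|[e He]].
    + left; apply (f_equal (restr_emb T _)) in E; destruct x, x'; exact E.
    + right; exists (proj1_sig e); split; [apply (proj2_sig e)|]; split; [apply (proj2_sig e)|].
      destruct x, x'; exact He.
  - intros [->|[e [H1 [H2 He]]]]; [left; rewrite (proof_irrelevance _ H H'); reflexivity|].
    right; exists (exist _ e (conj H1 H2)); destruct x, x'; exact He.
Qed.

(** A gluing inside the block uses an edge that does not cross, whose set is disjoint from that of
    the crossing edge [e]. Hence [Sigma_e] embeds in the limit of the block. *)
Lemma inblk_inj_cross (e : TO C) i x x' H H' : tSig T (proj1_sig e) x ->
  inblk T blk i x H = inblk T blk i x' H' -> x = x'.
Proof.
  intros Hx E; apply inblk_eq in E; destruct E as [E|[f [F1 [F2 Hf]]]]; [exact E|].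
  destruct (proj2_sig e); rewrite <- (sig_edge T HS f (proj1_sig e) x); [congruence| |exact Hx].
  apply (phi_sig T HS f x x' Hf).
Qed.

Lemma inblk_rep i (y : tot (blkT T blk i)) : exists H,
  ptof (blkT T blk i) y = inblk T blk i (restr_emb T _ y) H.
Proof. destruct y as [[v h] k]; exists h; reflexivity. Qed.

Lemma inblk_cont t W : lim_open (blkT T blk (blk t)) W ->
  topn T t (fun k => W (inblk T blk (blk t) (existT _ t k) eq_refl)).
Proof.
  exact (ptof_cont _ (blk_system (blk t)) (exist _ t eq_refl) W).
Qed.


(** The type [J] gathers the edges leaving block [i], so that each index has its tail as a vertex of
    the block, as [lim_cover_null] demands. *)
Lemma consol_sig_cover_null i : cover_null (lim_open (blkT T blk i))
  (fun e : TO C => talpha C e = i) (fun e q => tSig C e (existT _ i q)).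
Proof.
  set (J := {e : TO C | talpha C e = i}).
  assert (HJ : cover_null (lim_open (blkT T blk i)) (fun _ : J => True)
    (fun j q => exists x, tSig T (proj1_sig (proj1_sig j)) (restr_emb T _ x) /\
      q = ptof (blkT T blk i) x)).
  { apply (lim_cover_null _ (blk_system i) _
      (fun j : J => exist (fun v => blk v = i) (talpha T (proj1_sig (proj1_sig j))) (proj2_sig j))).
    - intros j x _ Hx; apply sig_eq; exact (sig_vertex T HS _ _ Hx).
    - intros [e He] _; destruct (sig_nonempty T HS (proj1_sig e)) as [x Hx].
      destruct (restr_emb_surj T (fun v => blk v = i) x) as [y <-]; [|exists y; exact Hx].
      rewrite (sig_vertex T HS _ _ Hx); exact He.
    - intros t W HW Hc; destruct (sig_null_cover T HS (proj1_sig t) W HW Hc) as [l Hl].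
      destruct (list_preimage (fun j : J => proj1_sig (proj1_sig j)) l) as [l' Hl'].
      + intros a b E; do 2 apply sig_eq; exact E.
      + exists l'; intros j [_ Ej] Hj; apply Hl.
        * exact (f_equal (@proj1_sig _ _) Ej).
        * intros H; apply Hj, Hl', H. }
  intros W HW Hc; destruct (HJ W HW Hc) as [l Hl]; exists (map (@proj1_sig _ _) l).
  intros e He Hel; destruct (Hl (exist _ e He) Logic.I) as [U [HU HUe]].
  - intros H; apply Hel; apply (in_map (@proj1_sig _ _)) in H; exact H.
  - exists U; split; [exact HU|]; intros q [x [H [Hx E]]]; apply HUe; simpl in *.
    destruct (restr_emb_surj T (fun v => blk v = i) x H) as [y <-]; exists y; split; [exact Hx|].
    rewrite E; destruct (inblk_rep i y) as [H' ->]; apply inblk_irrel.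
Qed.

(** With [P] trivial this is compactness of [Sigma_e] in the limit of the block; with [P] the
    complement of an open set it serves the continuity of [phi_e]. *)
Lemma sigma_image_compact (e : TO C) (P : tot T -> Prop) :
  compact_set (topn T (talpha T (proj1_sig e)))
    (fun k => tSig T (proj1_sig e) (existT _ _ k) /\ P (existT _ _ k)) ->
  compact_set (lim_open (blkT T blk (talpha C e)))
    (fun q => exists x H, tSig T (proj1_sig e) x /\ P x /\ q = inblk T blk (talpha C e) x H).
Proof.
  intros Hc.
  apply (compact_image _ (lim_open (blkT T blk (talpha C e)))
    (fun k => inblk T blk (talpha C e) (existT _ (talpha T (proj1_sig e)) k) eq_refl)) in Hc.
  - match type of Hc with compact_set _ ?A =>
      match goal with |- compact_set _ ?A' => replace A' with A; [exact Hc|] end end.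
    apply set_ext; intros q; split.
    + intros [k [[H1 H2] ->]]; exists (existT _ _ k), eq_refl; auto.
    + intros [x [H [Hx [Px ->]]]]; pose proof (sig_vertex T HS _ _ Hx) as E.
      destruct x as [t k]; simpl in E; subst t; exists k; split; [auto|apply inblk_irrel].
  - intros W HW; apply inblk_cont; exact HW.
Qed.

Lemma consol_tree_system : is_tree_system C.
Proof.
  split; [exact consol_tree|]; split; [|split; [|split; [|split; [|split; [|split; [|split; [|split; [|split]]]]]]]].
  - intros i; split; [exact (lim_compact _ (blk_system i))|].
    destruct (lim_metrizable _ (blk_system i)) as [d [Hd Ho]]; exists d.
    split; [exact Hd|]; split; [exact Ho|].
    apply (cover_null_null (lim_open (blkT T blk i)) d); auto; apply consol_sig_cover_null.
  - intros e [i y] [x [H [Hx _]]]; simpl in *; rewrite <- H, (sig_vertex T HS _ _ Hx); reflexivity.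
  - intros e; destruct (sig_nonempty T HS (proj1_sig e)) as [x Hx].
    exists (existT (fun i => limT (blkT T blk i)) (blk (projT1 x)) (inblk T blk _ x eq_refl)).
    exists x, eq_refl; auto.
  - intros e; pose proof (sigma_image_compact e (fun _ => True)) as H.
    match goal with |- compact_set _ ?A => replace A with (fun q => exists x H,
      tSig T (proj1_sig e) x /\ True /\ q = inblk T blk (talpha C e) x H) end.
    + apply H; apply (op_ext (fun A => compact_set (topn T (talpha T (proj1_sig e))) A)
        (fun k => tSig T (proj1_sig e) (existT _ _ k))); [tauto|apply (sig_compact T HS)].
    + apply set_ext; intros q; split.
      * intros [x [Hb [Hx [_ E]]]]; exists x, Hb; auto.
      * intros [x [Hb [Hx E]]]; exists x, Hb; auto.
  - intros e y z [x [x' [H [H' [Hx [Ey Ez]]]]]]; apply (phi_sig T HS) in Hx.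
    split; [exists x, H|exists x', H']; split; try apply Hx; auto.
  - intros e y [x [H [Hx Ey]]]; destruct (phi_total T HS _ _ Hx) as [x' Hx'].
    exists (existT (fun i => limT (blkT T blk i)) (blk (projT1 x')) (inblk T blk _ x' eq_refl)).
    exists x, x', H, eq_refl; auto.
  - intros e y [i z] [i' z'] [x1 [x1' [H1 [H1' [P1 [E1 E1']]]]]] [x2 [x2' [H2 [H2' [P2 [E2 E2']]]]]].
    simpl in *; assert (E : x1 = x2).
    { apply (inblk_inj_cross e (projT1 y) x1 x2 H1 H2); [apply (phi_sig T HS _ _ _ P1)|congruence]. }
    subst x2; pose proof (phi_fun T HS _ _ _ _ P1 P2) as E; subst x2'.
    subst; reflexivity.
  - intros e y z; split.
    + intros [x [x' [H [H' [P [E E']]]]]]; exists x', x, H', H; split; [|auto].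
      apply (phi_rev T HS); exact P.
    + intros [x [x' [H [H' [P [E E']]]]]]; exists x', x, H', H; split; [|auto].
      apply (phi_rev T HS) in P; exact P.
  - intros e W HW.
    destruct (phi_cont T HS (proj1_sig e) (fun x => W (existT _ (blk (projT1 x))
      (inblk T blk (blk (projT1 x)) x eq_refl)))) as [V [HV HVW]].
    { intros t; exact (inblk_cont t _ (HW (blk t))). }
    (* [V] is open in the spaces [K_t], not in the limit of the block. The part of [Sigma_e] outside
       [V] has compact, hence closed, image there, and the complement of that image has the trace of
       [V] on [Sigma_e]. *)
    exists (fun y => ~ exists x H, tSig T (proj1_sig e) x /\ ~ V x /\
      projT2 y = inblk T blk (projT1 y) x H); split.
    + intros i; simpl; destruct (classic (i = talpha C e)) as [->|Hi].
      * apply (compact_is_closed (lim_open (blkT T blk (talpha C e)))).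
        -- exact (lim_topology _ (blk_system _)).
        -- exact (lim_hausdorff _ (blk_system _)).
        -- apply sigma_image_compact; apply compact_inter_closed; [apply (sig_compact T HS)|].
           apply (op_ext (topn T _) (fun k => V (existT _ _ k))); [|apply HV].
           intros k; split; [tauto|apply NNPP].
      * apply (op_ext _ (fun _ => True)); [|exact (proj1 (lim_topology _ (blk_system i)))].
        intros q; split; [|auto]; intros _ [x [H [Hx _]]]; apply Hi.
        rewrite <- H, (sig_vertex T HS _ _ Hx); reflexivity.
    + intros [i y] [j z] [x [x' [H [H' [P [Ey Ez]]]]]]; simpl in *; subst.
      rewrite (HVW x x' P); split.
      * intros Vx [x2 [H2 [S2 [V2 E]]]].
        rewrite (inblk_inj_cross e _ x2 x H2 eq_refl S2 (eq_sym E)) in V2; contradiction.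
      * intros Hn; apply NNPP; intros Vx; apply Hn; exists x, eq_refl.
        split; [apply (phi_sig T HS _ _ _ P)|auto].
  - intros e e' y Hne [x [H [Hx E]]] [x' [H' [Hx' E']]].
    assert (x = x') by (apply (inblk_inj_cross e (projT1 y) x x' H H' Hx); exact (eq_trans (eq_sym E) E')).
    subst x'.
    apply Hne, sig_eq; exact (sig_edge T HS _ _ x Hx Hx').
Qed.

End Consol.

(** * The canonical bijection *)

Lemma incr_ge (k : nat -> nat) : (forall n, (k n < k (S n))%nat) ->
  forall n, (k 0 + n <= k n)%nat.
Proof. intros H n; induction n as [|n IH]; [lia|specialize (H n); lia]. Qed.

Lemma incr_bracket (k : nat -> nat) m : (forall n, (k n < k (S n))%nat) ->
  (k 0 <= m)%nat -> exists n, (k n <= m < k (S n))%nat.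
Proof.
  intros H H0; pose proof (incr_ge k H m) as Hm.
  assert (L : forall j, (m < k j)%nat -> exists n, (k n <= m < k (S n))%nat).
  { induction j as [|j IH]; intros Hj; [lia|].
    destruct (Nat.lt_ge_cases m (k j)) as [Hl|Hl]; [auto|exists j; lia]. }
  apply (L (S m)); specialize (H m); lia.
Qed.

Lemma infinite_enum (P : nat -> Prop) : (forall N, exists n, (N <= n)%nat /\ P n) ->
  exists k : nat -> nat, (forall n, (k n < k (S n))%nat) /\ (forall n, P (k n)) /\
    forall n m, (k n < m < k (S n))%nat -> ~ P m.
Proof.
  intros HP.
  assert (Hnx : forall N, exists n, (N <= n)%nat /\ P n /\ forall m, (N <= m < n)%nat -> ~ P m).
  { intros N; destruct (HP N) as [n [Hn Pn]]; revert N Hn.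
    assert (L : forall d N, (n - N = d)%nat -> (N <= n)%nat -> exists n, (N <= n)%nat /\ P n /\
      forall m, (N <= m < n)%nat -> ~ P m).
    { induction d as [|d IH]; intros N Hd Hn.
      - exists n; repeat split; auto; intros m Hm; lia.
      - destruct (classic (P N)) as [PN|PN]; [exists N; repeat split; auto; intros m Hm; lia|].
        destruct (IH (S N)) as [n' [H1 [H2 H3]]]; [lia|lia|].
        exists n'; repeat split; auto; [lia|]; intros m Hm.
        destruct (Nat.eq_dec m N) as [->|]; [exact PN|apply H3; lia]. }
    intros N Hn; exact (L _ N eq_refl Hn). }
  destruct (fun_choice _ Hnx) as [nx H].
  exists (fix k n := match n with O => nx 0%nat | S n => nx (S (k n)) end).
  split; [|split].
  - intros n; apply H.
  - intros [|n]; apply H.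
  - intros n m Hm; apply (proj2 (proj2 (H _))) with (1 := conj (proj1 Hm) (proj2 Hm)).
Qed.

Lemma path_consecutive (T : TS) (l : list (TO T)) d u v m : is_path T l u v -> reduced T l ->
  (S m < length l)%nat -> talpha T (nth (S m) l d) = omega T (nth m l d) /\
    nth (S m) l d <> trev T (nth m l d).
Proof.
  revert u m; induction l as [|e l IH]; intros u m H1 H2 Hm; [simpl in Hm; lia|].
  destruct H1 as [_ H1]; apply reduced_cons in H2; destruct H2 as [H2 H3].
  destruct m as [|m]; [|apply (IH _ m H1 H2); simpl in Hm; lia].
  destruct l as [|f l]; [simpl in Hm; lia|].
  split; [apply H1|apply (H3 f l eq_refl)].
Qed.

Section Canon.
Context (T : TS) (HS : is_tree_system T) (I : Type) (blk : TV T -> I).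
Context (Hblk : forall i, is_subtree T (fun v => blk v = i)).
Let HT := ts_tree T HS.
Local Notation C := (consol T blk).
Let HC : is_tree_system C := consol_tree_system T HS I blk Hblk.

(** The combinatorial part of [canon] at an end: [k] gives the positions of the crossings on [r],
    and [k 0 = 0] makes [r] begin with the first of them. *)
Definition expands (rho : nat -> TO C) (r : nat -> TO T) : Prop :=
  exists k : nat -> nat, k 0%nat = 0%nat /\ (forall n, (k n < k (S n))%nat) /\
    (forall n, r (k n) = proj1_sig (rho n)) /\
    (forall m, (forall n, m <> k n) -> blk (talpha T (r m)) = blk (omega T (r m))).

(** [L n] joins the first [n] crossings, each followed by the reduced path in the block it enters.
    It is reduced: a path inside a block contains no reverse of a crossing, and adjacent crossings
    are not mutually reverse because [rho] is a ray. *)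
Lemma expands_exists rho : is_ray C rho -> exists r, is_ray T r /\ expands rho r.
Proof.
  intros Hrho.
  destruct (fun_choice (fun n p => is_path T p (omega T (proj1_sig (rho n)))
      (talpha T (proj1_sig (rho (S n)))) /\ reduced T p /\
      forall e, In e p -> blk (talpha T e) = blk (omega T e))) as [p Hp].
  { intros n; destruct (block_path T HS I blk Hblk (omega T (proj1_sig (rho n)))
      (talpha T (proj1_sig (rho (S n))))) as [q [H1 [H2 H3]]].
    - symmetry; exact (proj1 (Hrho n)).
    - exists q; repeat split; auto; intros e He; destruct (H3 e He); congruence. }
  set (L := fix L n := match n with O => nil | S n => L n ++ proj1_sig (rho n) :: p n end).
  assert (LS : forall n, L (S n) = L n ++ proj1_sig (rho n) :: p n) by reflexivity.
  set (k := fun n => length (L n)).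
  assert (Hk : forall n, (k n < k (S n))%nat).
  { intros n; unfold k; rewrite LS, length_app; simpl; lia. }
  assert (Hge : forall n, (n <= k n)%nat) by (intros n; exact (incr_ge k Hk n)).
  assert (Hpath : forall n, is_path T (L n) (talpha T (proj1_sig (rho 0%nat)))
    (talpha T (proj1_sig (rho n)))).
  { induction n as [|n IH]; [reflexivity|]; rewrite LS; apply is_path_app.
    exists (talpha T (proj1_sig (rho n))); split; [exact IH|].
    split; [reflexivity|apply Hp]. }
  assert (Hred : forall n, reduced T (L n ++ proj1_sig (rho n) :: nil)).
  { induction n as [|n IH]; [exact Logic.I|].
    rewrite LS, <- app_assoc; simpl app; apply reduced_app; [exact IH|].
    destruct (Hp n) as [_ [P2 P3]]; apply reduced_cons; split.
    - apply reduced_snoc; [exact P2|]; intros q f E E'.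
      apply (proj2_sig (rho (S n))); rewrite E', omega_rev; symmetry; apply P3.
      rewrite E; apply in_or_app; right; left; reflexivity.
    - intros f q E E'; destruct (p n) as [|g pn]; simpl in E; injection E as E _.
      + apply (proj2 (Hrho n)); apply sig_eq; rewrite E; exact E'.
      + apply (cross_rev T I blk (rho n)); rewrite <- E', <- E; apply P3; left; reflexivity. }
  assert (Hnth : forall n j m d, (m < k n)%nat -> nth m (L (j + n)%nat) d = nth m (L n) d).
  { intros n j m d Hm; induction j as [|j IH]; [reflexivity|].
    simpl plus; rewrite LS, app_nth1; [exact IH|].
    pose proof (Hge n); fold (k (j + n)%nat).
    assert (k n <= k (j + n))%nat; [|lia].
    clear -Hk; induction j as [|j IH]; [auto|]; specialize (Hk (j + n)%nat); simpl; lia. }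
  (* Each stage adds at least one edge, so [L (S m)] already has position [m], and longer prefixes
     agree with it there; [d] merely completes [nth]. *)
  set (d := proj1_sig (rho 0%nat)); set (r := fun m => nth m (L (S m)) d).
  assert (Hr : forall n m, (m < k n)%nat -> r m = nth m (L n) d).
  { intros n m Hm; unfold r; destruct (Nat.le_ge_cases n (S m)) as [Hn|Hn].
    - replace (S m) with ((S m - n) + n)%nat by lia; apply Hnth; exact Hm.
    - replace n with ((n - S m) + S m)%nat by lia; symmetry; apply Hnth.
      pose proof (Hge (S m)); lia. }
  exists r; split.
  - intros m; pose proof (Hge (S (S m))) as Hm.
    rewrite (Hr (S (S m)) m), (Hr (S (S m)) (S m)) by lia.
    apply (path_consecutive T (L (S (S m))) d _ _ m (Hpath _)); [|exact Hm].
    apply (reduced_app_inv T _ (proj1_sig (rho (S (S m))) :: nil)); apply Hred.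
  - exists k; split; [reflexivity|]; split; [exact Hk|]; split.
    + intros n; rewrite (Hr (S n)) by apply Hk; rewrite LS, app_nth2; unfold k; [|lia].
      rewrite Nat.sub_diag; reflexivity.
    + intros m Hm; destruct (incr_bracket k m Hk (Nat.le_0_l m)) as [n [H1 H2]].
      rewrite (Hr (S n)) by exact H2; rewrite LS, app_nth2 by exact H1; fold (k n).
      assert (H3 : k n <> m) by (intros E; exact (Hm n (eq_sym E))).
      destruct (m - k n)%nat as [|j] eqn:Ej; [lia|]; simpl nth.
      apply (proj2 (proj2 (Hp n))); apply nth_In.
      unfold k in *; rewrite LS, length_app in H2; simpl in H2; lia.
Qed.

(** The crossings shared by [rho] and [rho'] are common edges of the expansions, arbitrarily far out
    on [r]. *)
Lemma expands_tail rho rho' r r' : is_ray T r -> is_ray T r' -> expands rho r ->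
  expands rho' r' -> tail_eq rho rho' -> tail_eq r r'.
Proof.
  intros Hr Hr' [k [_ [K1 [K2 _]]]] [k' [_ [_ [K2' _]]]] [a [b E]].
  apply (rays_common_edges T HT); auto; intros N; exists (k (a + N)%nat), (k' (b + N)%nat).
  split; [pose proof (incr_ge k K1 (a + N)); lia|]; rewrite K2, K2', E; reflexivity.
Qed.

(** A late crossing of [r] lies on the common tail, hence on [r']. All edges of [r'] away from the
    positions [k'] stay in a block, so it is a crossing of [rho'] as well. *)
Lemma expands_tail_inv rho rho' r r' : is_ray C rho -> is_ray C rho' -> expands rho r ->
  expands rho' r' -> tail_eq r r' -> tail_eq rho rho'.
Proof.
  intros Hr Hr' [k [_ [K1 [K2 _]]]] [k' [_ [_ [K2' K3']]]] [a [b E]].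
  apply (rays_common_edges C (ts_tree C HC)); auto; intros N; exists (N + a)%nat.
  pose proof (incr_ge k K1 (N + a)) as Hk.
  assert (E' : r (k (N + a)%nat) = r' (b + (k (N + a)%nat - a))%nat).
  { rewrite <- E; f_equal; lia. }
  destruct (classic (exists n, (b + (k (N + a)%nat - a))%nat = k' n)) as [[n En]|Hn].
  - exists n; split; [lia|]; apply sig_eq; rewrite <- K2, <- K2', <- En; exact E'.
  - exfalso; apply (proj2_sig (rho (N + a)%nat)); rewrite <- K2, E'; apply K3'.
    intros n En; apply Hn; exists n; exact En.
Qed.

Lemma expands_first rho r : expands rho r -> r 0%nat = proj1_sig (rho 0%nat).
Proof. intros [k [K0 [_ [K2 _]]]]; rewrite <- K2, K0; reflexivity. Qed.

Lemma expands_from_ray r : is_ray T r ->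
  (forall N, exists n, (N <= n)%nat /\ blk (talpha T (r n)) <> blk (omega T (r n))) ->
  exists rho r', is_ray C rho /\ is_ray T r' /\ expands rho r' /\ tail_eq r' r.
Proof.
  intros Hr Hinf; destruct (infinite_enum _ Hinf) as [k [K1 [K2 K3]]].
  exists (fun n => exist _ (r (k n)) (K2 n)), (shift (k 0%nat) r).
  split; [|split; [apply is_ray_shift; exact Hr|split; [|apply tail_eq_shift]]].
  - intros n; split.
    + assert (L : forall j, (S (k n) + j <= k (S n))%nat ->
        blk (talpha T (r (S (k n) + j)%nat)) = blk (omega T (r (k n)))).
      { induction j as [|j IH]; intros Hj.
        - rewrite Nat.add_0_r, (proj1 (Hr (k n))); reflexivity.
        - rewrite <- IH by lia; rewrite Nat.add_succ_r, (proj1 (Hr _)); symmetry.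
          apply NNPP; apply (K3 n); lia. }
      specialize (L (k (S n) - S (k n))%nat); specialize (K1 n).
      replace (S (k n) + (k (S n) - S (k n)))%nat with (k (S n)) in L by lia.
      apply L; lia.
    + intros E; apply (f_equal (@proj1_sig _ _)) in E; simpl in E.
      (* The reverse of [r (k n)] starts where [r (k n)] ends, and a ray visits each vertex once; so
         it would have to be the very next edge, which a ray forbids. *)
      assert (Ek : k (S n) = S (k n)).
      { apply (ray_inj T HT r); [exact Hr|]; rewrite E; symmetry; apply (Hr (k n)). }
      rewrite Ek in E; exact (proj2 (Hr (k n)) E).
  - exists (fun n => (k n - k 0)%nat); split; [lia|].
    pose proof (incr_ge k K1) as Hge; split; [|split].
    + intros n; specialize (K1 n); pose proof (Hge n); lia.
    + intros n; unfold shift; simpl; f_equal; pose proof (Hge n); lia.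
    + intros m Hm; unfold shift; apply NNPP; intros Hc.
      destruct (incr_bracket k (k 0 + m)%nat K1) as [n Hn]; [lia|].
      destruct (Nat.eq_dec (k n) (k 0 + m)%nat) as [E|E]; [apply (Hm n); lia|].
      apply (K3 n (k 0 + m)%nat); [lia|exact Hc].
Qed.

Local Notation incl := (fun y : tot C => lim_incl T (fun v => blk v = projT1 y) (projT2 y)).

Lemma incl_cls y y' : ptof C y = ptof C y' -> incl y = incl y'.
Proof.
  intros E; apply (ptof_eq C HC) in E; destruct E as [->|[e [x [x' [H [H' [P [Ey Ey']]]]]]]].
  - reflexivity.
  - simpl in *; rewrite Ey, Ey', !(lim_incl_inblk T HS I blk Hblk).
    apply (ptof_eq T HS); right; exists (proj1_sig e); exact P.
Qed.

Lemma canon_pt y q : canon T blk (ptof C y) q <-> q = incl y.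
Proof.
  split.
  - intros [y' [Hy' H]].
    assert (E : ptof C y = ptof C y') by (apply (ptof_eq C HC), (cls_iff C HC); exact Hy').
    rewrite (incl_cls y y' E); destruct H as [[x [H [Ey [D [-> HD]]]]]|[E0 [r [Ey [Hr [E' [-> HE']]]]]]].
    + apply (ptof_mem T HS) in HD; rewrite HD; simpl in *; rewrite Ey.
      symmetry; apply (lim_incl_inblk T HS I blk Hblk).
    + pose proof (end_is_ray _ E0 r Hr) as Rr; pose proof (restr_is_ray T _ r Rr) as Rr'.
      apply (endof_mem _ E0 r Rr) in Hr; apply (endof_mem T E' _ Rr') in HE'.
      simpl in *; rewrite HE', Ey; symmetry.
      etransitivity; [apply (f_equal (lim_incl T _)); exact Hr|apply lim_incl_blk_end].
  - intros ->; exists y; split; [apply rst_refl|]; destruct y as [i z]; simpl in *.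
    destruct (lim_cases (blkT T blk i) z) as [[x ->]|[r [Hr ->]]].
    + left; destruct (inblk_rep T I blk i x) as [H E]; exists (restr_emb T _ x), H.
      split; [exact E|]; rewrite E, (lim_incl_inblk T HS I blk Hblk); apply ptof_mem_self.
    + right; pose proof (restr_is_ray T _ r Hr) as Rr.
      eexists; exists r; split; [reflexivity|].
      split; [split; [exact Hr|apply tail_eq_refl]|].
      eexists; split; [exact (lim_incl_blk_end T I blk i r Hr Rr)|].
      split; [exact Rr|exact (tail_eq_refl (fun n => proj1_sig (r n)))].
Qed.

Lemma canon_end rho r H Hr q : expands rho r ->
  (canon T blk (endof C rho H) q <-> q = endof T r Hr).
Proof.
  intros Hx; split.
  - intros [rho' [r' [k [[H' Ht] [[E' [-> HE']] Hk]]]]].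
    pose proof (end_is_ray T E' r' HE') as Hr'.
    apply (endof_mem T E' r' Hr') in HE'; rewrite HE'; apply endof_eq.
    apply (expands_tail rho' rho); auto; [exists k; exact Hk|apply tail_eq_sym; exact Ht].
  - intros ->; destruct Hx as [k Hk]; exists rho, r, k; split; [split; [exact H|apply tail_eq_refl]|].
    split; [|exact Hk]; eexists; split; [reflexivity|split; [exact Hr|apply tail_eq_refl]].
Qed.

Lemma canon_total a : exists p, forall q, canon T blk a q <-> q = p.
Proof.
  destruct (lim_cases C a) as [[y ->]|[rho [H ->]]].
  - exists (incl y); apply canon_pt.
  - destruct (expands_exists rho H) as [r [Hr Hx]]; exists (endof T r Hr).
    intros q; apply canon_end; exact Hx.
Qed.

Context (f : limT C -> limT T) (Hf : forall a q, canon T blk a q <-> q = f a).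

Lemma f_pt y : f (ptof C y) = incl y.
Proof. symmetry; apply Hf, canon_pt; reflexivity. Qed.

Lemma f_end rho r H Hr : expands rho r -> f (endof C rho H) = endof T r Hr.
Proof. intros Hx; symmetry; apply Hf, (canon_end rho r H Hr); auto. Qed.

(** An end of a block is represented by edges inside that block, while an expansion has crossings
    arbitrarily far out. This keeps the images of vertex points and of ends of [T_Pi] disjoint. *)
Lemma incl_not_expanded y rho r Hr : expands rho r -> incl y <> endof T r Hr.
Proof.
  destruct y as [i z]; simpl; intros [k [_ [K1 [K2 _]]]] E.
  destruct (lim_cases (blkT T blk i) z) as [[x ->]|[s [Hs ->]]].
  - destruct (inblk_rep T I blk i x) as [H Ex]; simpl in *.
    rewrite Ex, (lim_incl_inblk T HS I blk Hblk) in E; discriminate.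
  - rewrite (lim_incl_blk_end T I blk _ s Hs (restr_is_ray T _ s Hs)) in E.
    apply endof_eq in E; destruct E as [a [b E]].
    pose proof (incr_ge k K1 b) as Hk; apply (proj2_sig (rho b)); rewrite <- K2.
    replace (k b) with (b + (k b - b))%nat by lia; rewrite <- E.
    destruct (proj2_sig (s (a + (k b - b))%nat)); congruence.
Qed.

Lemma incl_inj y y' : incl y = incl y' -> ptof C y = ptof C y'.
Proof.
  destruct y as [i z], y' as [j z']; simpl; intros E.
  destruct (lim_cases (blkT T blk i) z) as [[x ->]|[s [Hs ->]]];
    destruct (lim_cases (blkT T blk j) z') as [[x' ->]|[s' [Hs' ->]]].
  - destruct (inblk_rep T I blk i x) as [H Ex]; destruct (inblk_rep T I blk j x') as [H' Ex'].
    revert H H' Ex Ex'; generalize (restr_emb T (fun v => blk v = i) x) as u.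
    generalize (restr_emb T (fun v => blk v = j) x') as u'; intros u' u H H' Ex Ex'.
    simpl in *; rewrite Ex, Ex' in E |- *; rewrite !(lim_incl_inblk T HS I blk Hblk) in E.
    clear Ex Ex'; subst i j; apply (ptof_eq T HS) in E.
    destruct E as [<-|[e He]]; [reflexivity|].
    pose proof (phi_vertices T HS e u u' He) as [Eu Eu'].
    (* A gluing edge inside a block already identifies the two points in the limit of that block; a
       crossing edge identifies them by the gluing of the consolidation. *)
    destruct (classic (blk (talpha T e) = blk (omega T e))) as [Eb|Eb].
    + assert (Ei : blk (projT1 u') = blk (projT1 u)) by congruence.
      transitivity (ptof C (existT (fun i => limT (blkT T blk i)) (blk (projT1 u))
        (inblk T blk (blk (projT1 u)) u' Ei))); [|destruct Ei; reflexivity].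
      do 2 f_equal; apply (inblk_eq T HS I blk Hblk); right; exists e.
      split; [congruence|split; [congruence|exact He]].
    + apply (ptof_eq C HC); right; exists (exist _ e Eb), u, u', eq_refl, eq_refl; auto.
  - destruct (inblk_rep T I blk i x) as [H Ex]; simpl in *; rewrite Ex in E.
    rewrite (lim_incl_inblk T HS I blk Hblk) in E.
    rewrite (lim_incl_blk_end T I blk _ s' Hs' (restr_is_ray T _ s' Hs')) in E; discriminate.
  - destruct (inblk_rep T I blk j x') as [H Ex]; simpl in *; rewrite Ex in E.
    rewrite (lim_incl_inblk T HS I blk Hblk) in E.
    rewrite (lim_incl_blk_end T I blk _ s Hs (restr_is_ray T _ s Hs)) in E; discriminate.
  - rewrite (lim_incl_blk_end T I blk _ s' Hs' (restr_is_ray T _ s' Hs')) in E.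
    rewrite (lim_incl_blk_end T I blk _ s Hs (restr_is_ray T _ s Hs)) in E.
    apply endof_eq in E; destruct E as [a [b E]].
    assert (Eij : i = j).
    { rewrite <- (proj1 (proj2_sig (s (a + 0)%nat))), <- (proj1 (proj2_sig (s' (b + 0)%nat))), E.
      reflexivity. }
    subst j; do 2 f_equal; apply endof_eq; exists a, b; intros n; apply sig_eq; apply E.
Qed.

Lemma f_inj a a' : f a = f a' -> a = a'.
Proof.
  destruct (lim_cases C a) as [[y ->]|[rho [H ->]]];
    destruct (lim_cases C a') as [[y' ->]|[rho' [H' ->]]].
  - rewrite !f_pt; apply incl_inj.
  - destruct (expands_exists rho' H') as [r' [Hr' Hx']].
    rewrite f_pt, (f_end rho' r' H' Hr' Hx'); intros E.
    destruct (incl_not_expanded y rho' r' Hr' Hx' E).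
  - destruct (expands_exists rho H) as [r [Hr Hx]].
    rewrite f_pt, (f_end rho r H Hr Hx); intros E.
    destruct (incl_not_expanded y' rho r Hr Hx (eq_sym E)).
  - destruct (expands_exists rho H) as [r [Hr Hx]].
    destruct (expands_exists rho' H') as [r' [Hr' Hx']].
    rewrite (f_end rho r H Hr Hx), (f_end rho' r' H' Hr' Hx'), !endof_eq.
    apply (expands_tail_inv rho rho' r r'); auto.
Qed.

(** A ray that crosses infinitely often comes from an end of [T_Pi]; one that crosses finitely often
    has a tail in a single block and comes from an end of that block. *)
Lemma f_surj q : exists a, f a = q.
Proof.
  destruct (lim_cases T q) as [[x ->]|[r [Hr ->]]].
  - exists (ptof C (existT (fun i => limT (blkT T blk i)) (blk (projT1 x))
      (inblk T blk _ x eq_refl))).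
    rewrite f_pt; apply (lim_incl_inblk T HS I blk Hblk).
  - destruct (classic (forall N, exists n, (N <= n)%nat /\
      blk (talpha T (r n)) <> blk (omega T (r n)))) as [Hinf|Hfin].
    + destruct (expands_from_ray r Hr Hinf) as [rho [r' [H1 [H2 [H3 H4]]]]].
      exists (endof C rho H1); rewrite (f_end rho r' H1 H2 H3); apply endof_eq; exact H4.
    + apply not_all_ex_not in Hfin; destruct Hfin as [N HN].
      assert (Hin : forall n, blk (talpha T (shift N r n)) = blk (talpha T (r N))).
      { induction n as [|n IH]; unfold shift in *; [rewrite Nat.add_0_r; reflexivity|].
        rewrite <- IH, Nat.add_succ_r, (proj1 (Hr _)); symmetry; apply NNPP; intros Hc.
        apply HN; exists (N + n)%nat; split; [lia|exact Hc]. }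
      destruct (restr_ray_lift T (fun v => blk v = blk (talpha T (r N))) (shift N r)
        (is_ray_shift T N r Hr) Hin) as [s [Hs Es]].
      exists (ptof C (existT (fun i => limT (blkT T blk i)) (blk (talpha T (r N)))
        (endof (blkT T blk (blk (talpha T (r N)))) s Hs))).
      rewrite f_pt; simpl.
      etransitivity; [exact (lim_incl_blk_end T I blk _ s Hs (restr_is_ray T _ s Hs))|].
      apply endof_eq; exists 0%nat, N; intros n; simpl; rewrite Es; reflexivity.
Qed.

Lemma f_qside e a : qside C e a -> qside T (proj1_sig e) (f a).
Proof.
  intros Ha; destruct (lim_cases C a) as [[y ->]|[rho [H ->]]].
  - destruct (qside_pt_inv C HC e _ y eq_refl Ha) as [y' [-> Hy']]; rewrite f_pt.
    apply (lim_incl_side T HS _ (Hblk (projT1 y'))); intros v Hv.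
    apply (consol_side T HS I blk Hblk); rewrite Hv; exact Hy'.
  - apply qside_end in Ha; destruct Ha as [rho' [H1 [H2 <-]]].
    replace (endof C rho H) with (endof C rho' H1) by (apply endof_eq, tail_eq_sym; exact H2).
    destruct (expands_exists rho' H1) as [r [Hr Hx]]; rewrite (f_end rho' r H1 Hr Hx).
    apply qside_end; exists r; split; [exact Hr|split; [apply tail_eq_refl|]].
    apply expands_first; exact Hx.
Qed.

Lemma f_cont : lim_cont C T f.
Proof.
  intros W HW; apply (lim_topology C HC); intros a Wa.
  destruct (HW _ Wa) as [F [U [HF [HU [G S]]]]].
  exists (fun a => Gset T F U (f a)); split; [|split; [exact G|intros a'; apply S]].
  set (FC := fun i : TV C => exists v, F v /\ blk v = i).
  set (UC := fun y : tot C => FC (projT1 y) /\ Gset T F U (f (ptof C y))).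
  assert (HFC : fin_subtree C FC).
  { destruct HF as [[[v Fv] HFp] [l Hl]]; split; [split|].
    - exists (blk v), v; auto.
    - intros i j [u [Fu <-]] [w [Fw <-]]; destruct (HFp u w Fu Fw) as [p [H1 H2]].
      destruct (project_path T I blk p u w H1) as [p' [H3 H4]]; exists p'; split; [exact H3|].
      intros e He; destruct (H2 _ (H4 e He)) as [Fa Fo].
      split; [exists (talpha T (proj1_sig e))|exists (omega T (proj1_sig e))]; auto.
    - exists (map blk l); intros i [u [Fu <-]]; apply in_map, Hl, Fu. }
  assert (Hout : forall e, outedge C FC e -> ~ F (omega T (proj1_sig e))).
  { intros e [_ Ho] Fo; apply Ho; exists (omega T (proj1_sig e)); auto. }
  assert (Hsig : forall e y, tSig C e y -> exists x, tSig T (proj1_sig e) x /\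
    f (ptof C y) = ptof T x).
  { intros e y [x [H [Hx Ey]]]; exists x; split; [exact Hx|].
    rewrite f_pt; simpl in *; rewrite Ey; apply (lim_incl_inblk T HS I blk Hblk). }
  assert (HUC : sat_open C FC UC).
  { split; [|split; [|split]].
    - intros y [H _]; exact H.
    - intros e y y' Fa Fo He; pose proof (phi_vertices C HC e y y' He) as [Ey Ey']; unfold UC.
      rewrite Ey, Ey'; replace (ptof C y') with (ptof C y); [tauto|].
      apply (ptof_eq C HC); right; exists e; exact He.
    - intros i Fi; apply (op_ext _ (fun z => Gset T F U (lim_incl T (fun v => blk v = i) z))).
      + intros z; unfold UC; rewrite f_pt; simpl; tauto.
      + exact (lim_incl_Gset_open T HS _ (Hblk i) F U HF HU).
    - intros e Fa Fo; destruct (Gset_Sigma T HS F U (proj1_sig e) HF HU (Hout e (conj Fa Fo)))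
        as [H|H]; [left|right]; intros y Hy; destruct (Hsig e y Hy) as [x [Hx Ex]]; unfold UC; rewrite Ex.
      + split; [rewrite (sig_vertex C HC e y Hy); exact Fa|auto].
      + intros [_ Gx]; exact (H x Hx Gx). }
  apply (op_ext _ (Gset C FC UC)); [|apply Gset_open; auto].
  intros b; destruct (qside_cases C HC FC b HFC) as [[y [Fy ->]]|[e [He Hq]]].
  - rewrite (Gset_pt_in C HC FC UC y (proj1 HFC) HUC Fy); unfold UC; tauto.
  - rewrite (Gset_qside C HC FC UC e b (proj1 HFC) HUC He Hq).
    (* A vertex of [F] beyond [e] in [T] would put its block beyond [e] in [C]; but that block
       belongs to [FC], which [e] leaves. *)
    assert (Hn : forall v, F v -> ~ side T (proj1_sig e) v).
    { intros v Fv Hs; apply (consol_side_iff T HS I blk Hblk) in Hs; revert Hs.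
      apply (subtree_not_side C (ts_tree C HC) FC); auto; [apply HFC|exists v; auto]. }
    pose proof (f_qside e b Hq) as Hb; split.
    + intros H; destruct (sig_nonempty C HC e) as [y Hy]; destruct (H y Hy) as [_ Gy].
      destruct (Hsig e y Hy) as [x [Hx Ex]]; rewrite Ex in Gy; revert Gy.
      apply (Gset_side_const T HS F U (proj1_sig e)); auto; apply qside_Sigma; auto.
    + intros Gb y Hy; split; [rewrite (sig_vertex C HC e y Hy); apply He|].
      destruct (Hsig e y Hy) as [x [Hx ->]]; revert Gb.
      apply (Gset_side_const T HS F U (proj1_sig e)); auto; apply qside_Sigma; auto.
Qed.

End Canon.

(** A closed subset of the source is compact, so its image is compact and therefore closed in the
    Hausdorff target. *)
Lemma compact_bijection_inverse {X Y : Type} (opX : (X -> Prop) -> Prop)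
  (opY : (Y -> Prop) -> Prop) (f : X -> Y) (g : Y -> X) :
  compact_set opX (fun _ => True) -> topology opX -> topology opY -> hausdorff opY ->
  (forall W, opY W -> opX (fun x => W (f x))) ->
  (forall x, g (f x) = x) -> (forall y, f (g y) = y) ->
  forall W, opX W -> opY (fun y => W (g y)).
Proof.
  intros Hc HtX HtY Hh Hf Hgf Hfg W HW.
  assert (HK : compact_set opY (fun y => exists x, (True /\ ~ W x) /\ y = f x)).
  { apply (compact_image opX opY f (fun x => True /\ ~ W x) Hf).
    apply (compact_inter_closed opX _ (fun x => ~ W x) Hc).
    apply (op_ext opX W); [intros x; split; [tauto|apply NNPP]|exact HW]. }
  apply (compact_is_closed opY _ HtY Hh) in HK.
  refine (op_ext opY _ _ _ HK); intros y; split.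
  - intros H; apply NNPP; intros Wy; apply H; exists (g y); auto.
  - intros Wy [x [[_ Wx] ->]]; rewrite Hgf in Wy; contradiction.
Qed.

Theorem theorem3 (T : TS) (I : Type) (blk : TV T -> I) :
  is_tree_system T ->
  (forall i : I, is_subtree T (fun v => blk v = i)) ->
  is_tree_system (consol T blk) /\
  exists f : limT (consol T blk) -> limT T,
    (forall a q, canon T blk a q <-> f a = q) /\
    exists g : limT T -> limT (consol T blk),
      (forall a, g (f a) = a) /\ (forall q, f (g q) = q) /\
      lim_cont (consol T blk) T f /\ lim_cont T (consol T blk) g.
Proof.
  intros HS Hblk; pose proof (consol_tree_system T HS I blk Hblk) as HC; split; [exact HC|].
  destruct (fun_choice _ (canon_total T HS I blk Hblk)) as [f Hf]; exists f.
  split; [intros a q; rewrite Hf; split; auto|].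
  destruct (fun_choice _ (f_surj T HS I blk Hblk f Hf)) as [g Hfg]; exists g.
  assert (Hgf : forall a, g (f a) = a).
  { intros a; apply (f_inj T HS I blk Hblk f Hf); apply Hfg. }
  pose proof (f_cont T HS I blk Hblk f Hf) as Hcf.
  split; [exact Hgf|split; [exact Hfg|split; [exact Hcf|]]].
  exact (compact_bijection_inverse _ _ f g (lim_compact _ HC) (lim_topology _ HC)
    (lim_topology _ HS) (lim_hausdorff _ HS) Hcf Hgf Hfg).
Qed.
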